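(* The Menelaus cyclic operad is the quotient of the free cyclic operad generated by the irreducible $\mathcal M$-complexes under the equivalence relation generated by the equalities of the form $$\mathcal T_1\,{_u\circ_v}\,\mathcal T_2=\mathcal T'_1\,{_{u'}\circ_{v'}}\,\mathcal T'_2,$$ for each quadruple $(\mathcal T_1,\mathcal T_2,\mathcal T_1',\mathcal T_2')$ of unrooted trees (with nodes decorated by irreducible $\mathcal M$-complexes) and each quadruple $(u,v,u',v')$ of leaves of $\mathcal T_1,\mathcal T_2,\mathcal T'_1,\mathcal T'_2$ respectively, such that both sides are well formed and evaluate, up to $<\!2$-isomorphism, to the same $\mathcal M$-complex $K$, in which the cut-triangles $T$ and $T'$ associated with the pairs $(u,v)$ and $(u',v')$ are imbricated.
   Context: **$\Delta$-complexes.** A $\Delta$-complex $K$ consists of mutually disjoint sets $K_0,K_1,\ldots$ (elements of $K_n$ are $n$-cells) and functions (faces) $d^n_i\colon K_n\to K_{n-1}$, $n\ge 1$, $0\le i\le n$, with $d^{n-1}_j\circ d^n_l=d^{n-1}_{l-1}\circ d^n_j$ whenever $l-1\ge j$; superscripts are often omitted. Morphisms are families of maps $K_n\to L_n$ commuting with faces. $C_n$ is the free abelian group on $K_n$ and $\partial_n\colon C_n\to C_{n-1}$, $\partial_n x=\sum_{i=0}^n(-1)^id_ix$. A face of a 2-cell is an *edge* of it; a face of an edge of a 2-cell is a *vertex* of that 2-cell; a face of a 1-cell is a *vertex* of it. A $\Delta$-complex is connected when any two distinct 0-cells are joined by a sequence of 0-cells in which any two consecutive ones are the pair of vertices of a 1-cell.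 Two 2-cells are *$w$-neighbours* when they share an edge having the 0-cell $w$ as a vertex. **$\mathcal M$-complexes.** An $\mathcal M$-complex is a connected $\Delta$-complex $L$ such that: (0) $L$ has finitely many cells; (1) $L_m=\emptyset$ for $m\ge3$, every 0-cell is a face of some 1-cell and every 1-cell is a face of some 2-cell; (2) two different faces map an element of $L_2$ (resp. $L_1$) to two different elements of $L_1$ (resp. $L_0$); (3) every 1-cell is an edge of exactly two 2-cells; (4) for every $w\in L_0$, any two elements of $L_w=\{u\in L_2\mid w \text{ is a vertex of }u\}$ are joined by a sequence of 2-cells in which consecutive ones are $w$-neighbours; (5) $H_2(L;\mathbf Z)=\mathrm{Ker}\,\partial_2\cong\mathbf Z$. A *$<\!2$-isomorphism* is a morphism whose components in dimensions 0 and 1 are bijections and whose component in dimension 2 is the identity. **Connected sum.** For disjoint $\mathcal M$-complexes $X,Y$, $x\in X_2$, $y\in Y_2$, the complex $X\,{_x\circ_y}\,Y$ has 2-cells $(X_2-\{x\})\cup(Y_2-\{y\})$; its 1-cells are $X_1\cup Y_1$ with $d_ix$ identified with $d_iy$ for $i=0,1,2$; its 0-cells are $X_0\cup Y_0$ with $d_1d_2x\sim d_1d_2y$, $d_0d_2x\sim d_0d_2y$, $d_0d_0x\sim d_0d_0y$; faces are induced. **Cyclic operads.** A cyclic operad $\mathcal C$ consists of: a set $\mathcal C(X)$ of operations of arity $X$ for each finite set $X$; for each bijection $\sigma\colon Z\to X$ and $f\in\mathcal C(X)$ an operation $f^\sigma\in\mathcal C(Z)$ with $f^{\mathrm{id}}=f$,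 $(f^\sigma)^\tau=f^{\sigma\circ\tau}$; for $f\in\mathcal C(X)$, $g\in\mathcal C(Y)$, $x\in X$, $y\in Y$ with $X-\{x\}$ and $Y-\{y\}$ disjoint, an operation $f\,{_x\circ_y}\,g$ of arity $(X-\{x\})\cup(Y-\{y\})$; and unit operations in $\mathcal C(\{x,y\})$ for $x\neq y$; satisfying associativity $(f\,{_x\circ_y}\,g)\,{_u\circ_z}\,h=f\,{_x\circ_y}\,(g\,{_u\circ_z}\,h)$ (for distinct entries $y,u$ of $g$), commutativity $f\,{_x\circ_y}\,g=g\,{_y\circ_x}\,f$, compatibility of the bijection actions with compositions and units, and unit laws (composing with a unit renames an entry). The free cyclic operad on a collection of generating operations (closed under renaming of entries) has as operations the finite unrooted trees whose nodes are decorated by generators, the half-edges at a node being labelled by the entries of the generator; edges are pairs of half-edges, and the open half-edges (leaves) form the arity; composition ${_u\circ_v}$ grafts two trees along leaves $u$ and $v$; units are added. Every tree *evaluates* in a cyclic operad by iterated composition along its edges. **The Menelaus cyclic operad.** Operations of arity $X$ are the $<\!2$-isomorphism classes $[K]$ of $\mathcal M$-complexes $K$ with $K_2=X$; composition is the connected sum (choosing disjoint representatives); the units are the $\mathcal M$-complexes with exactly two 2-cells, having the same boundary ($d_i$ of one equals $d_i$ of the other for all $i$); for a bijection $\sigma\colon Z\to K_2$, $[K]^\sigma$ is represented by the complex with 2-cells $Z$, the same cells in dimensions 0 and 1, and $d^2_iu=d^2_i(\sigma(u))$. **Cut-triangles, irreducibility.** Let $K$ be an $\mathcal M$-complex and $T=\{e_0,e_1,e_2\}\subseteq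 K_1$ with $\partial_1(e_0-e_1+e_2)=0$. Let $\tau$ be the transitive closure of the binary relation on $K_2$ of sharing an edge from $K_1-T$. $T$ is a *cut-triangle* when $\tau$ is an equivalence relation with exactly two classes; these are denoted $K^l_T,K^r_T$. $K$ is *reducible* if it contains a cut-triangle. An $\mathcal M$-complex is *proper* if it is not a unit; ''irreducible $\mathcal M$-complex'' as a generator means a proper $\mathcal M$-complex containing no cut-triangle (equivalently, a proper $\mathcal M$-complex that is not a connected sum of two proper $\mathcal M$-complexes). For $o\in\{l,r\}$, the $\mathcal M$-complex $\hat K^o_T$ *induced by* $T$ has 2-cells $K^o_T\cup\{t\}$ with $t$ a new element, 1-cells all edges of members of $K^o_T$, 0-cells all vertices of these, faces restricted from $K$ and $d_kt=e_k$ (with $e_0,e_1,e_2$ indexed so that the face identities hold). A cut-triangle $T_1$ is *disjoint* from a cut-triangle $T_2$ of $K$ if all edges of $T_1$ are 1-cells of one of the two $\mathcal M$-complexes $\hat K^l_{T_2},\hat K^r_{T_2}$; two cut-triangles are *imbricated* if they are not disjoint. **Cut-triangle associated with $(u,v)$.** If $\mathcal T_1\,{_u\circ_v}\,\mathcal T_2$ evaluates to $K=K_1\,{_u\circ_v}\,K_2$, where $K_i$ is the evaluation of $\mathcal T_i$, then the cut-triangle of $K$ associated with $(u,v)$ consists of the three 1-cells of $K$ resulting from the identification of the edges of $u$ with those of $v$. *)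

(* Defs.v *)
From HB Require Import structures.
From mathcomp Require Import all_boot all_order all_algebra.
From Stdlib Require Import Relation_Operators.

Set Implicit Arguments.
Unset Strict Implicit.
Unset Printing Implicit Defensive.

Import GRing.Theory.

(** * Conventions
   The arity of an operation is a [finType].  The set (X - {x}) u (Y - {y}),
   for X - {x} and Y - {y} disjoint, is rendered by the disjoint sum
   [comp_arity x y]; other representatives are reached by the action of
   bijections.  As in the text the action is contravariant: [s : Z -> X] sends
   operations of arity X to operations of arity Z.

   An operation is given by a representative (a complex, a tree, ...), a
   predicate selecting the meaningful representatives, and a relation telling
   when two representatives denote the same operation. *)

Definition comp_arity (X Y : finType) (x : X) (y : Y) : finType :=
  ({a : X | a != x} + {b : Y | b != y})%type.

(** * Delta-complexes *)

(* Finite Delta-complexes without cells in dimension >= 3, with prescribed set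
   X of 2-cells.  In [face_law], j ranges over 0, 1 and l = k + 1 over 1, 2:
   [lift ord0 k : 'I_3] is l and [lift ord_max j : 'I_3] is j, so that the law
   reads d_j d_l = d_(l-1) d_j for j <= l - 1. *)
Record dcomplex (X : finType) := DComplex {
  c0 : finType;
  c1 : finType;
  d1 : 'I_2 -> c1 -> c0;
  d2 : 'I_3 -> X -> c1;
  face_law : forall (j k : 'I_2) (u : X), j <= k ->
    d1 j (d2 (lift ord0 k) u) = d1 k (d2 (lift ord_max j) u)
}.

(* The components f0, f1 of a <2-isomorphism; the component in dimension 2 is
   the identity of X. *)
Definition is_lt2iso (X : finType) (K L : dcomplex X)
    (f0 : c0 K -> c0 L) (f1 : c1 K -> c1 L) : Prop :=
  [/\ bijective f0, bijective f1,
      forall i e, f0 (d1 i e) = d1 i (f1 e)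
    & forall i u, f1 (d2 K i u) = d2 L i u].

Definition lt2iso (X : finType) (K L : dcomplex X) : Prop :=
  exists f0 f1, @is_lt2iso X K L f0 f1.

Definition crename (X Z : finType) (s : Z -> X) (K : dcomplex X) : dcomplex Z :=
  @DComplex Z (c0 K) (c1 K) (@d1 X K) (fun i z => d2 K i (s z))
    (fun j k z => @face_law X K j k (s z)).

Section Cells.
Variables (X : finType) (K : dcomplex X).

Definition edge_of (e : c1 K) (u : X) : bool := [exists i, d2 K i u == e].
Definition end_of (w : c0 K) (e : c1 K) : bool := [exists i, d1 i e == w].
Definition vertex_of (w : c0 K) (u : X) : bool :=
  [exists e, edge_of e u && end_of w e].

Definition adjacent (a b : c0 K) : bool :=
  [exists e : c1 K, ((d1 ord0 e == a) && (d1 ord_max e == b))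
                 || ((d1 ord0 e == b) && (d1 ord_max e == a))].

Definition neighbours (w : c0 K) (u v : X) : bool :=
  [exists e, [&& edge_of e u, edge_of e v & end_of w e]].

End Cells.

(* The boundary of chains with integer coefficients. *)
Definition boundary (n : nat) (A B : finType) (d : 'I_n.+1 -> A -> B)
    (c : {ffun A -> int}) : {ffun B -> int} :=
  [ffun b => (\sum_(a : A) \sum_(i < n.+1 | d i a == b) (-1) ^+ i * c a)%R].

Definition cell (A : finType) (a : A) : {ffun A -> int} :=
  [ffun b => ((b == a)%:R)%R].

(** * M-complexes *)

(* Finiteness and the absence of cells of dimension >= 3 are built in
   [dcomplex]. *)
Record m_complex (X : finType) (K : dcomplex X) : Prop := MComplex {
  m_connected : forall a b : c0 K, connect (@adjacent X K) a b;
  m_end : forall w : c0 K, exists e : c1 K, end_of w e;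
  m_edge : forall e : c1 K, exists u : X, edge_of e u;
  m_faces2 : forall (i j : 'I_3) (u : X), i != j -> d2 K i u != d2 K j u;
  m_faces1 : forall (i j : 'I_2) (e : c1 K), i != j -> d1 i e != d1 j e;
  m_two : forall e : c1 K, #|[set u | edge_of e u]| = 2;
  m_link : forall (w : c0 K) (u v : X), vertex_of w u -> vertex_of w v ->
    connect (neighbours w) u v;
  m_H2 : exists h : int -> {ffun X -> int},
    [/\ {morph h : a b / (a + b)%R}, injective h
      & forall c, boundary (d2 K) c = 0%R <-> exists a, c = h a]
}.

Definition unit_complex (X : finType) (K : dcomplex X) : Prop :=
  [/\ m_complex K, #|X| = 2 & forall i (u v : X), d2 K i u = d2 K i v].

(** * Connected sum *)

(* The quotient of a finite type by the equivalence relation generated by r,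
   each class being represented by its root. *)
Section Gluing.
Variables (A : finType) (r : rel A).

Definition symr : rel A := fun a b => r a b || r b a.

Lemma symr_sym : connect_sym symr.
Proof. by apply: sym_connect_sym => a b; rewrite /symr orbC. Qed.

Definition gluing : finType := {a : A | roots symr a}.

Definition class_of (a : A) : gluing :=
  exist (fun b => roots symr b) (fingraph.root symr a) (roots_root symr_sym a).

Lemma class_of_connect a b : connect symr a b -> class_of a = class_of b.
Proof. by move=> ab; apply: val_inj; apply/eqP; rewrite /= root_connect //; exact: symr_sym. Qed.

Lemma connect_class_of a : connect symr a (val (class_of a)).
Proof. exact: connect_root. Qed.

End Gluing.

Section ConnectedSum.
Variables (X Y : finType) (K : dcomplex X) (L : dcomplex Y) (x : X) (y : Y).

Definition glue0 (a b : c0 K + c0 L) : bool :=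
  [|| (a == inl (d1 ord_max (d2 K ord_max x)))
        && (b == inr (d1 ord_max (d2 L ord_max y))),
      (a == inl (d1 ord0 (d2 K ord_max x)))
        && (b == inr (d1 ord0 (d2 L ord_max y)))
    | (a == inl (d1 ord0 (d2 K ord0 x)))
        && (b == inr (d1 ord0 (d2 L ord0 y)))].

Definition glue1 (a b : c1 K + c1 L) : bool :=
  [exists i, (a == inl (d2 K i x)) && (b == inr (d2 L i y))].

Definition sum_end (k : 'I_2) (e : c1 K + c1 L) : c0 K + c0 L :=
  match e with inl e => inl (d1 k e) | inr e => inr (d1 k e) end.

Definition csum_d1 (k : 'I_2) (e : gluing glue1) : gluing glue0 :=
  class_of glue0 (sum_end k (val e)).

Definition csum_d2 (i : 'I_3) (u : comp_arity x y) : gluing glue1 :=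
  match u with
  | inl a => class_of glue1 (inl (d2 K i (val a)))
  | inr b => class_of glue1 (inr (d2 L i (val b)))
  end.

Lemma glue_end (k : 'I_2) a b : glue1 a b -> glue0 (sum_end k a) (sum_end k b).
Proof.
have lw (Z : finType) (M : dcomplex Z) (u : Z) :
    [/\ d1 ord_max (d2 M (lift ord0 ord0) u) = d1 ord_max (d2 M ord_max u),
        d1 ord0 (d2 M (lift ord0 ord0) u) = d1 ord0 (d2 M ord0 u)
      & d1 ord_max (d2 M ord0 u) = d1 ord0 (d2 M ord_max u)].
  have E01 : lift ord_max (ord_max : 'I_2) = lift ord0 ord0 :> 'I_3 by exact: val_inj.
  have E00 : lift ord_max (ord0 : 'I_2) = ord0 :> 'I_3 by exact: val_inj.
  have E12 : lift ord0 (ord_max : 'I_2) = ord_max :> 'I_3 by exact: val_inj.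
  have h1 := @face_law Z M ord_max ord_max u isT.
  have h2 := @face_law Z M ord0 ord0 u isT.
  have h3 := @face_law Z M ord0 ord_max u isT.
  by rewrite E01 E12 in h1; rewrite E00 in h2; rewrite E00 E12 in h3.
case/existsP=> i /andP[/eqP-> /eqP->] /=.
have [hK1 hK2 hK3] := lw _ K x; have [hL1 hL2 hL3] := lw _ L y.
have ck : k = ord0 \/ k = ord_max.
  by case: k => [[|[|m]] lm] //; [left | right]; exact: val_inj.
have ci : [\/ i = ord0, i = lift ord0 ord0 | i = ord_max].
  by case: i => [[|[|[|m]]] lm] //;
     [apply: Or31 | apply: Or32 | apply: Or33]; exact: val_inj.
by rewrite /glue0; case: ck => ->; case: ci => ->;
   rewrite ?hK1 ?hK2 ?hK3 ?hL1 ?hL2 ?hL3 !eqxx ?orbT.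
Qed.

Lemma class_end (k : 'I_2) (a : c1 K + c1 L) :
  csum_d1 k (class_of glue1 a) = class_of glue0 (sum_end k a).
Proof.
apply/esym/class_of_connect.
case/connectP: (connect_class_of glue1 a) => p; move: (val _) => c.
elim: p a => [|b p IH] a /=.
  by move=> _ ->; exact: connect0.
case/andP=> ab bp lp; apply: (connect_trans _ (IH b bp lp)).
apply: connect1; by case/orP: ab => /(glue_end k) h; rewrite /symr h ?orbT.
Qed.

Lemma csum_face_law (j k : 'I_2) (u : comp_arity x y) : j <= k ->
  csum_d1 j (csum_d2 (lift ord0 k) u) = csum_d1 k (csum_d2 (lift ord_max j) u).
Proof. by case: u => u jk; rewrite /csum_d2 !class_end /= face_law. Qed.

Definition csum : dcomplex (comp_arity x y) := DComplex csum_face_law.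

Definition glued_triangle : {set c1 csum} :=
  [set class_of glue1 (inl (d2 K i x)) | i : 'I_3].

End ConnectedSum.

(** * Cut-triangles *)

Section CutTriangles.
Variables (X : finType) (K : dcomplex X).

Definition triangle (T : {set c1 K}) : Prop :=
  exists e0 e1 e2 : c1 K,
    T = [set e0; e1; e2] /\
    boundary (@d1 X K) (cell e0 - cell e1 + cell e2)%R = 0%R.

Definition shares (T : {set c1 K}) (u v : X) : bool :=
  [exists e in ~: T, edge_of e u && edge_of e v].

(* The transitive closure of [shares T]: at least one step is required, so
   that it need not be reflexive. *)
Definition tau (T : {set c1 K}) (u v : X) : bool :=
  [exists w, shares T u w && connect (shares T) w v].

Definition cut_triangle (T : {set c1 K}) : Prop :=
  [/\ triangle T,
      [/\ reflexive (tau T), symmetric (tau T) & transitive (tau T)]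
    & #|equivalence_partition (tau T) [set: X]| = 2].

(* The 1-cells of the complex induced by T on the side B, where B is one of
   the two classes of [tau T]. *)
Definition side_edges (B : {set X}) : {set c1 K} :=
  [set e | [exists u in B, edge_of e u]].

Definition disjoint_triangles (T1 T2 : {set c1 K}) : Prop :=
  exists2 B, B \in equivalence_partition (tau T2) [set: X]
           & T1 \subset side_edges B.

Definition imbricated (T1 T2 : {set c1 K}) : Prop :=
  [/\ cut_triangle T1, cut_triangle T2 & ~ disjoint_triangles T1 T2].

Definition irreducible : Prop :=
  [/\ m_complex K, ~ unit_complex K & forall T, ~ cut_triangle T].

End CutTriangles.

(** * Unrooted trees decorated by irreducible M-complexes *)

(* A graph with open half-edges: the half-edges at the node n are the elements
   of [har n], the decoration [dec n] is an operation of arity [har n], and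
   [mate] pairs the two halves of every edge and fixes the open half-edges,
   which [leaf] labels by the arity X. *)
Record tree (X : finType) := Tree {
  node : finType;
  har : node -> finType;
  dec : forall n : node, dcomplex (har n);
  mate : {n : node & har n} -> {n : node & har n};
  leaf : X -> {n : node & har n}
}.

Definition half (X : finType) (t : tree X) : finType := {n : node t & har n}.

Definition linked (X : finType) (t : tree X) (E : pred (half t)) (n m : node t)
    : bool :=
  [exists h : half t, [&& E h, tag h == n & tag (mate h) == m]].

(* Acyclicity is expressed by saying that every edge is a bridge. *)
Record is_tree (X : finType) (t : tree X) : Prop := IsTree {
  tree_dec : forall n : node t, irreducible (dec n);
  tree_mate : involutive (@mate X t);
  tree_leaf_inj : injective (@leaf X t);
  tree_leaf : forall h : half t, mate h = h <-> exists x, leaf t x = h;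
  tree_inhabited : 0 < #|node t|;
  tree_connected : forall n m : node t, connect (linked (t := t) predT) n m;
  tree_acyclic : forall h : half t, mate h != h ->
    ~~ connect (linked [pred k | (k != h) && (k != mate h)])
         (tag h) (tag (mate h))
}.

(* Trees are considered up to renaming of the nodes and of the half-edges, and
   decorations up to <2-isomorphism. *)
Definition tree_iso (X : finType) (t t' : tree X) : Prop :=
  exists (f : node t -> node t') (g : forall n, har n -> har (f n)),
    let G (h : half t) : half t' := existT _ (f (tag h)) (g (tag h) (tagged h)) in
    [/\ bijective f, forall n, bijective (g n),
        forall n, lt2iso (dec n) (crename (g n) (dec (f n))),
        forall h, mate (G h) = G (mate h)
      & forall x, G (leaf t x) = leaf t' x].

Definition corolla (X : finType) (K : dcomplex X) : tree X :=
  @Tree X unit (fun _ => X) (fun _ => K) id (fun x => existT _ tt x).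

Definition trename (X Z : finType) (s : Z -> X) (t : tree X) : tree Z :=
  @Tree Z (node t) (@har X t) (@dec X t) (@mate X t) (fun z => leaf t (s z)).

Section Graft.
Variables (X Y : finType) (t1 : tree X) (u : X) (t2 : tree Y) (v : Y).

Definition graft_node : finType := (node t1 + node t2)%type.

Definition graft_har (n : graft_node) : finType :=
  match n with inl n => har n | inr n => har n end.

Definition graft_dec (n : graft_node) : dcomplex (graft_har n) :=
  match n with inl n => dec n | inr n => dec n end.

Definition injl (h : half t1) : {n : graft_node & graft_har n} :=
  existT (fun n => graft_har n : Type) (inl (tag h)) (tagged h).

Definition injr (h : half t2) : {n : graft_node & graft_har n} :=
  existT (fun n => graft_har n : Type) (inr (tag h)) (tagged h).

Definition graft_mate (h : {n : graft_node & graft_har n})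
    : {n : graft_node & graft_har n} :=
  match h with
  | existT (inl n) a =>
      let h1 : half t1 := existT _ n a in
      if h1 == leaf t1 u then injr (leaf t2 v) else injl (mate h1)
  | existT (inr n) b =>
      let h2 : half t2 := existT _ n b in
      if h2 == leaf t2 v then injl (leaf t1 u) else injr (mate h2)
  end.

Definition graft_leaf (z : comp_arity u v) : {n : graft_node & graft_har n} :=
  match z with
  | inl a => injl (leaf t1 (val a))
  | inr b => injr (leaf t2 (val b))
  end.

Definition graft : tree (comp_arity u v) :=
  @Tree _ graft_node graft_har graft_dec graft_mate graft_leaf.

End Graft.

(* [evaluates t K]: iterated composition along the edges of t yields the class
   of K up to <2-isomorphism. *)
Inductive evaluates (Z : finType) (t : tree Z) (K : dcomplex Z) : Prop :=
| EvCorolla (G : dcomplex Z) of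
    irreducible G & tree_iso t (corolla G) & lt2iso K G
| EvGraft (X Y : finType) (u : X) (v : Y) (s : Z -> comp_arity u v)
    (t1 : tree X) (t2 : tree Y) (K1 : dcomplex X) (K2 : dcomplex Y) of
    bijective s & evaluates t1 K1 & evaluates t2 K2 &
    tree_iso t (trename s (graft t1 u t2 v)) &
    lt2iso K (crename s (csum K1 K2 u v)).

(** * Cyclic operads *)

Record operad_data := OperadData {
  rep : finType -> Type;
  isop : forall X : finType, rep X -> Prop;
  same : forall X : finType, rep X -> rep X -> Prop;
  ren : forall X Z : finType, (Z -> X) -> rep X -> rep Z;
  comp : forall (X Y : finType) (f : rep X) (x : X) (g : rep Y) (y : Y),
    rep (comp_arity x y);
  is_unit : forall X : finType, rep X -> Prop
}.

(* The quotient by the equivalence relation generated by the equalities E. *)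
Definition quotient (C : operad_data)
    (E : forall X : finType, rep C X -> rep C X -> Prop) : operad_data :=
  @OperadData (rep C) (@isop C)
    (fun X => clos_refl_sym_trans _ (fun f g => same f g \/ E X f g))
    (@ren C) (@comp C) (@is_unit C).

Definition operad_isomorphism (C D : operad_data)
    (phi : forall X : finType, rep C X -> rep D X) : Prop :=
  [/\ forall (X : finType) (f : rep C X), isop f -> isop (phi X f),
      forall (X : finType) (f g : rep C X), isop f -> isop g ->
        (same f g <-> same (phi X f) (phi X g)),
      forall (X : finType) (k : rep D X), isop k ->
        exists2 f, isop f & same (phi X f) k
    & [/\ forall (X Z : finType) (s : Z -> X) (f : rep C X),
            bijective s -> isop f -> same (phi Z (ren s f)) (ren s (phi X f)),
          forall (X Y : finType) (f : rep C X) (x : X) (g : rep C Y) (y : Y),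
            isop f -> isop g ->
            same (phi _ (comp f x g y)) (comp (phi X f) x (phi Y g) y)
        & forall (X : finType) (f : rep C X),
            isop f -> is_unit f -> is_unit (phi X f)]].

Definition menelaus : operad_data :=
  @OperadData dcomplex m_complex lt2iso crename
    (fun X Y K x L y => csum K L x y) unit_complex.

(** * The free cyclic operad generated by the irreducible M-complexes *)

Variant free_op (X : finType) := FTree of tree X | FUnit.
Arguments FUnit {X}.

Definition free_isop (X : finType) (f : free_op X) : Prop :=
  match f with FTree t => is_tree t | FUnit => #|X| = 2 end.

Definition free_same (X : finType) (f g : free_op X) : Prop :=
  match f, g with
  | FTree t, FTree t' => tree_iso t t'
  | FUnit, FUnit => True
  | _, _ => False
  end.

Definition free_ren (X Z : finType) (s : Z -> X) (f : free_op X) : free_op Z :=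
  match f with FTree t => FTree (trename s t) | FUnit => FUnit end.

(* Composing a tree of arity X with a unit at x gives to the entry x the name
   of the other entry of the unit. *)
Definition free_comp (X Y : finType) (f : free_op X) (x : X) (g : free_op Y)
    (y : Y) : free_op (comp_arity x y) :=
  match f, g with
  | FTree t1, FTree t2 => FTree (graft t1 x t2 y)
  | FTree t1, FUnit =>
      FTree (trename (fun z : comp_arity x y =>
        match z with inl a => val a | inr _ => x end) t1)
  | FUnit, FTree t2 =>
      FTree (trename (fun z : comp_arity x y =>
        match z with inl _ => y | inr b => val b end) t2)
  | FUnit, FUnit => FUnit
  end.

Definition free_operad : operad_data :=
  @OperadData free_op free_isop free_same free_ren free_comp
    (fun X f => f = FUnit).

Definition free_evaluates (X : finType) (f : free_op X) (K : dcomplex X) : Prop :=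
  match f with FTree t => evaluates t K | FUnit => unit_complex K end.

(* The cut-triangles associated with (u, v) and (u', v') are transported to
   K along <2-isomorphisms; s and s' identify the arities of the two sides. *)
Definition menelaus_eq (Z : finType) (f g : free_op Z) : Prop :=
  exists (X Y : finType) (u : X) (v : Y) (t1 : tree X) (t2 : tree Y)
         (s : Z -> comp_arity u v)
         (X' Y' : finType) (u' : X') (v' : Y') (t1' : tree X') (t2' : tree Y')
         (s' : Z -> comp_arity u' v')
         (K1 : dcomplex X) (K2 : dcomplex Y)
         (K1' : dcomplex X') (K2' : dcomplex Y') (K : dcomplex Z)
         (p0 : c0 (csum K1 K2 u v) -> c0 K)
         (p1 : c1 (csum K1 K2 u v) -> c1 K)
         (q0 : c0 (csum K1' K2' u' v') -> c0 K)
         (q1 : c1 (csum K1' K2' u' v') -> c1 K),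
    [/\ [/\ is_tree t1, is_tree t2, is_tree t1' & is_tree t2'],
        [/\ bijective s, bijective s',
            f = FTree (trename s (graft t1 u t2 v))
          & g = FTree (trename s' (graft t1' u' t2' v'))],
        [/\ evaluates t1 K1, evaluates t2 K2,
            evaluates t1' K1' & evaluates t2' K2'],
        [/\ m_complex K,
            @is_lt2iso Z (crename s (csum K1 K2 u v)) K p0 p1
          & @is_lt2iso Z (crename s' (csum K1' K2' u' v')) K q0 q1]
      & imbricated (p1 @: glued_triangle K1 K2 u v)
                   (q1 @: glued_triangle K1' K2' u' v')].

(* Main.v *)
(** A tree is realized by gluing all its decorations at once along its edges.
    This quotient satisfies the universal properties needed to compare it with
    iterated connected sums, so that evaluation is well defined up to
    <2-isomorphism without any discussion of the order of composition.

    Chains of the form "orientation restricted to a set of 2-cells", together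
    with d d = 0, control everything that is topological: the boundary of a set
    of 2-cells which is contained in a triangle is empty or the whole triangle.
    Hence removing a 2-cell does not disconnect a proper M-complex, the glued
    triangle of a connected sum is a cut-triangle whose classes are the two
    sides, and a triangle on one side is a cut-triangle of the summand exactly
    when it is one of the sum.

    Every edge of a tree t thus gives a cut-triangle of its complex K.  A
    cut-triangle of K disjoint from all of these is one of them: otherwise it
    would survive in an irreducible decoration.  Consequently two trees with the
    same complex K either have an imbricated pair of such triangles, and are
    identified by a single generating equality, or have exactly the same
    triangles, and are isomorphic, as one sees by cutting both along a common
    one.  In particular the generating equalities need not be closed under
    composition by hand.  Surjectivity holds because cutting a reducible
    M-complex along a cut-triangle gives two smaller proper M-complexes. *)
Require Import Defs.
From mathcomp Require Import all_boot all_order all_algebra.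
From mathcomp Require Import ring zify.
From Stdlib Require Import Relation_Operators Classical_Prop.

Set Implicit Arguments.
Unset Strict Implicit.
Unset Printing Implicit Defensive.

Import GRing.Theory Num.Theory.
Import Defs.

(** The condition on H_2 is traded for an orientation: a sign on every 2-cell such that neighbours
    cancel along their common edge. The signs of a sum and of a piece can be written down, whereas
    their H_2 would have to be computed.

    The obstacle to the rest is that sums, glued trees and pieces of a cut are quotients or subtypes
    with unrelated carriers. They are not compared as such: [summing] and [assembly] present a
    complex by maps into it, together with the exact coincidences between the values of these maps,
    and two presentations from the same data are isomorphic. One set of lemmas then serves the
    quotient [csum], the branches of a tree, the two pieces along a cut-triangle, and even
    renamings, which are sums with a unit.

    Between a sum and a summand, disjointness of triangles is transferred downwards only, because
    both the search for a triangle in a tree and the comparison of two trees proceed by cutting. *)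

(** * Finite types and walks in relations *)

Lemma bij_onto (A B : finType) (f : A -> B) :
  injective f -> (forall b, exists a, f a = b) -> bijective f.
Proof.
move=> fi fs.
have fs' b : exists a, f a == b by case: (fs b) => a <-; exists a.
have K b : f (xchoose (fs' b)) = b by apply/eqP; exact: (xchooseP (fs' b)).
by exists (fun b => xchoose (fs' b)) => [a|b] //; apply: fi; rewrite K.
Qed.

Lemma bij_surj (A B : finType) (f : A -> B) :
  bijective f -> forall b, exists a, f a = b.
Proof. by case=> g _ gK b; exists (g b). Qed.

(** [p] and [q] present one quotient of [A] twice. Isomorphisms between glued complexes are obtained
    in this way, from equality of kernels alone. *)
Lemma same_kernel_bij (A B C : finType) (p : A -> B) (q : A -> C) :
  (forall b, exists a, p a = b) -> (forall c, exists a, q a = c) ->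
  (forall a a', p a = p a' <-> q a = q a') ->
  exists2 f : B -> C, bijective f & forall a, f (p a) = q a.
Proof.
move=> ps qs ker.
have ps' b : exists a, p a == b by case: (ps b) => a <-; exists a.
pose f b := q (xchoose (ps' b)).
have fE a : f (p a) = q a.
  by apply/ker; apply/eqP; exact: (xchooseP (ps' (p a))).
exists f => //; apply: bij_onto.
  move=> b b'; case: (ps b) => a <-; case: (ps b') => a' <-.
  by rewrite !fE => /ker.
by move=> c; case: (qs c) => a <-; exists (p a).
Qed.

(** Dual to [same_kernel_bij]; it serves to recover a summand from the cells that it occupies in a
    sum. *)
Lemma same_image_bij (A B C : finType) (j : A -> C) (k : B -> C) :
  injective j -> injective k ->
  (forall c, (exists a, j a = c) <-> (exists b, k b = c)) ->
  exists2 f : A -> B, bijective f & forall a, k (f a) = j a.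
Proof.
move=> ji ki im.
have ex a : exists b, k b == j a.
  by case: (im (j a)) => /(_ (ex_intro _ a erefl)) [b bE] _; exists b; rewrite bE.
have kE a : k (xchoose (ex a)) = j a by apply/eqP; exact: (xchooseP (ex a)).
exists (fun a => xchoose (ex a)) => //; apply: bij_onto.
  by move=> a a' E; apply: ji; rewrite -!kE E.
move=> b; case: (im (k b)) => _ /(_ (ex_intro _ b erefl)) [a aE].
by exists a; apply: ki; rewrite kE.
Qed.

Lemma Tagged_inj (I : eqType) (T : I -> eqType) (i : I) (a b : T i) :
  existT (fun i => T i : Type) i a = existT (fun i => T i : Type) i b -> a = b.
Proof. by move/eqP; rewrite -tag_eqE /tag_eq /= eqxx tagged_asE /= => /eqP. Qed.

Lemma connect_exit (T : finType) (r : rel T) (C : {set T}) (u v : T) :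
  connect r u v -> u \in C -> v \notin C ->
  exists a b, [/\ a \in C, b \notin C & r a b].
Proof.
case/connectP=> p; elim: p u => [|a p IH] u /=; first by move=> _ -> ->.
case/andP=> ua pp lp uC vC; case aC: (a \in C); first exact: (IH a).
by exists u, a; rewrite aC.
Qed.

Lemma connect_mono (T S : finType) (f : T -> S) (r : rel T) (q : rel S) u v :
  (forall a b, r a b -> connect q (f a) (f b)) ->
  connect r u v -> connect q (f u) (f v).
Proof.
move=> H /connectP[p]; elim: p u => [|a p IH] u /=; first by move=> _ ->.
by case/andP=> /H ua pp lp; apply: connect_trans ua (IH a pp lp).
Qed.

Lemma connect_eq_or (T : finType) (r : rel T) u v :
  (forall a b c, r a b -> r b c -> a = c) ->
  connect r u v = (u == v) || r u v.
Proof.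
move=> H; apply/idP/idP; last first.
  by case/orP=> [/eqP->|/connect1].
case/connectP=> p; elim: p u => [|a p IH] u /=; first by move=> _ ->; rewrite eqxx.
case/andP=> ua pp lp; case/orP: (IH a pp lp) => [/eqP<-|av]; first by rewrite ua orbT.
by rewrite (H _ _ _ ua av) eqxx.
Qed.

(** * Quotients by generated equivalence relations *)

Section Quotients.
Variables (A : finType) (r : rel A).

Lemma class_of_eq a b : class_of r a = class_of r b <-> connect (symr r) a b.
Proof.
split; last exact: class_of_connect.
move/(congr1 val) => /= E; rewrite -(root_connect (symr_sym r)); exact/eqP.
Qed.

Lemma symr_const (B : Type) (F : A -> B) a b :
  (forall c d, r c d -> F c = F d) -> connect (symr r) a b -> F a = F b.
Proof.
move=> H /connectP[p]; elim: p a => [|c p IH] a /=; first by move=> _ ->.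
by case/andP=> ac pp lp; rewrite -(IH c pp lp); case/orP: ac => /H.
Qed.

Lemma symr_mono (B : finType) (q : rel B) (f : A -> B) a b :
  (forall c d, r c d -> c = d \/ q (f c) (f d)) ->
  connect (symr r) a b -> connect (symr q) (f a) (f b).
Proof.
move=> H; apply: connect_mono => c d; rewrite /symr.
by case/orP=> /H[->|h]; rewrite ?connect0 //; apply: connect1; rewrite /= h ?orbT.
Qed.

Lemma class_of_val (c : gluing r) : class_of r (val c) = c.
Proof. by apply: val_inj => /=; apply/eqP; exact: (valP c). Qed.

Lemma class_of_onto (c : gluing r) : exists a, class_of r a = c.
Proof. by exists (val c); exact: class_of_val. Qed.

End Quotients.

(** * Cells and incidence *)

Lemma I2P (k : 'I_2) : k = ord0 \/ k = ord_max.
Proof. by case: k => [[|[|m]] lm] //; [left | right]; exact: val_inj. Qed.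

Definition i0 : 'I_3 := ord0.
Definition i1 : 'I_3 := lift ord0 ord0.
Definition i2 : 'I_3 := ord_max.

Lemma I3P (i : 'I_3) : [\/ i = i0, i = i1 | i = i2].
Proof.
by case: i => [[|[|[|m]]] lm] //;
   [apply: Or31 | apply: Or32 | apply: Or33]; exact: val_inj.
Qed.

(* The k-th face of the i-th edge is the vertex number [co i k]. *)
Definition co (i : 'I_3) (k : 'I_2) : 'I_3 := lift i (rev_ord k).

Lemma coE (i : 'I_3) (k : 'I_2) : co i k =
  if k == ord0 then (if i == i2 then i1 else i2)
  else (if i == i0 then i1 else i0).
Proof. by case: (I3P i) => ->; case: (I2P k) => ->; apply: val_inj. Qed.

Lemma co_neq i k : co i k != i.
Proof. by rewrite eq_sym neq_lift. Qed.

Lemma co_ex i j : i != j -> exists k, co i k = j.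
Proof.
move=> ij; case: (unliftP i j) => [k ->|E]; last by rewrite E eqxx in ij.
by exists (rev_ord k); rewrite /co rev_ordK.
Qed.

Lemma third (i j : 'I_3) : exists2 l, l != i & l != j.
Proof.
case: (I3P i) => ->; case: (I3P j) => ->;
 first [by exists i0 | by exists i1 | by exists i2].
Qed.

Section Faces.
Variables (X : finType) (K : dcomplex X).

(** The numbering makes vertex [j] the one opposite to edge [j] ([end_vtx]); the three expressions
    are those that [glue0] identifies. *)
Definition vtx (j : 'I_3) (u : X) : c0 K :=
  if j == i0 then d1 ord_max (d2 K i2 u)
  else if j == i1 then d1 ord0 (d2 K i2 u) else d1 ord0 (d2 K i0 u).

Lemma d1_d2 k i u : d1 k (d2 K i u) = vtx (co i k) u.
Proof.
have E01 : lift ord_max (ord_max : 'I_2) = i1 by exact: val_inj.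
have E00 : lift ord_max (ord0 : 'I_2) = i0 by exact: val_inj.
have E12 : lift ord0 (ord_max : 'I_2) = i2 by exact: val_inj.
have h1 := @face_law X K ord_max ord_max u isT.
have h2 := @face_law X K ord0 ord0 u isT.
have h3 := @face_law X K ord0 ord_max u isT.
rewrite E01 E12 in h1; rewrite E00 in h2; rewrite E00 E12 in h3.
rewrite coE /vtx; case: (I3P i) => ->; case: (I2P k) => -> //=.
Qed.

Lemma edge_ofP e u : reflect (exists i, d2 K i u = e) (edge_of e u).
Proof. by apply: (iffP existsP) => -[i /eqP H]; exists i => //; apply/eqP. Qed.

Lemma edge_of_d2 i u : edge_of (d2 K i u) u.
Proof. by apply/edge_ofP; exists i. Qed.

Lemma end_ofP (w : c0 K) e : reflect (exists k, d1 k e = w) (end_of w e).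
Proof. by apply: (iffP existsP) => -[i /eqP H]; exists i => //; apply/eqP. Qed.

Lemma end_of_d1 k (e : c1 K) : end_of (d1 k e) e.
Proof. by apply/end_ofP; exists k. Qed.

Lemma vertex_ofP (w : c0 K) u : reflect (exists j, vtx j u = w) (vertex_of w u).
Proof.
apply: (iffP existsP).
  case=> e /andP[/edge_ofP[i <-] /end_ofP[k <-]]; exists (co i k).
  by rewrite d1_d2.
case=> j <-; have [i ij _] := third j j; have [k kE] := co_ex ij.
exists (d2 K i u); rewrite edge_of_d2; apply/end_ofP.
by exists k; rewrite d1_d2 kE.
Qed.

Lemma vertex_of_vtx j u : vertex_of (vtx j u) u.
Proof. by apply/vertex_ofP; exists j. Qed.

Lemma vertex_of_end (w : c0 K) e u : edge_of e u -> end_of w e -> vertex_of w u.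
Proof. by move=> h1 h2; apply/existsP; exists e; rewrite h1. Qed.

Lemma vtx_end i j u : i != j -> end_of (vtx j u) (d2 K i u).
Proof.
by move=> /co_ex[k kE]; apply/end_ofP; exists k; rewrite d1_d2 kE.
Qed.

Hypothesis f1 : forall (i j : 'I_2) (e : c1 K), i != j -> d1 i e != d1 j e.

(** Any two of the three vertices are the ends of an edge, and the ends of an edge differ. *)
Lemma vtx_inj u : injective (vtx^~ u).
Proof.
have ne i : vtx (co i ord0) u != vtx (co i ord_max) u by rewrite -!d1_d2 f1.
move: (ne i0) (ne i1) (ne i2); rewrite !coE /= => n0 n1 n2 i j.
case: (I3P i) => ->; case: (I3P j) => -> //= E; move: n0 n1 n2;
  by rewrite E eqxx.
Qed.

Lemma end_vtx i j u : end_of (vtx j u) (d2 K i u) = (i != j).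
Proof.
apply/idP/idP; last exact: vtx_end.
by case/end_ofP=> k; rewrite d1_d2 => /vtx_inj <-; rewrite eq_sym co_neq.
Qed.

End Faces.

Arguments vtx {X} K j u.

(** * M-complexes *)

Section Incidence.
Variables (X : finType) (K : dcomplex X).

Lemma sharesP (T : {set c1 K}) u v :
  reflect (exists e, [/\ e \notin T, edge_of e u & edge_of e v]) (shares T u v).
Proof.
apply: (iffP existsP) => -[e].
  by case/andP; rewrite inE => h /andP[? ?]; exists e.
by case=> h hu hv; exists e; rewrite inE h hu.
Qed.

Lemma shares_sym (T : {set c1 K}) u v : shares T u v = shares T v u.
Proof. by apply/sharesP/sharesP => -[e [? ? ?]]; exists e. Qed.

(** In an oriented closed complex this is the support of the boundary of the chain carried by [C];
    see [chain_bd]. *)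
Definition bd (C : {set X}) (e : c1 K) : bool :=
  [exists u in C, edge_of e u] && [exists u in ~: C, edge_of e u].

Lemma bdP (C : {set X}) (e : c1 K) : reflect
  (exists u v, [/\ u \in C, v \notin C, edge_of e u & edge_of e v]) (bd C e).
Proof.
apply: (iffP andP).
  by case=> /existsP[u /andP[uC eu]] /existsP[v /andP[]]; rewrite inE => ? ?; exists u, v.
case=> u [v [uC vC eu ev]]; split; apply/existsP; first by exists u; rewrite uC.
by exists v; rewrite inE vC.
Qed.

(** The equation [o u * o u = 1] encodes a sign inside the ring of coefficients, where it can be
    used for rewriting. When every edge has two cells, the second clause says that [o] is a
    cycle. *)
Definition oriented (o : X -> int) : Prop :=
  (forall u, o u * o u = 1)%R /\
  forall (i j : 'I_3) u v, u != v -> d2 K i u = d2 K j v ->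
    ((-1) ^+ i * o u + (-1) ^+ j * o v = 0)%R.

(* The axioms of an M-complex in which H_2 = Z is replaced by its
   consequence that there is a 2-cell. *)
Record closed_complex : Prop := ClosedComplex {
  cc_cell : exists u : X, True;
  cc_connected : forall a b : c0 K, connect (@adjacent X K) a b;
  cc_end : forall w : c0 K, exists e : c1 K, end_of w e;
  cc_edge : forall e : c1 K, exists u : X, edge_of e u;
  cc_faces2 : forall (i j : 'I_3) (u : X), i != j -> d2 K i u != d2 K j u;
  cc_faces1 : forall (i j : 'I_2) (e : c1 K), i != j -> d1 i e != d1 j e;
  cc_two : forall e : c1 K, #|[set u | edge_of e u]| = 2;
  cc_link : forall (w : c0 K) (u v : X), vertex_of w u -> vertex_of w v ->
    connect (neighbours w) u v
}.

Lemma m_complex_closed : m_complex K -> closed_complex.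
Proof.
case=> h1 h2 h3 h4 h5 h6 h7 [h [hD hi _]]; split=> //.
(* Without 2-cells all chains coincide, against the injectivity of [h]. *)
apply: NNPP => nX; suff: (1 : int) = 0%R by [].
apply: hi; apply/ffunP => u; by case: nX; exists u.
Qed.

(** Only [u] and [v] have [e] as an edge, each through a single face, so two terms of the double sum
    survive. *)
Lemma boundary2E (c : {ffun X -> int}) (i j : 'I_3) u v e :
  (forall (i j : 'I_3) (u : X), i != j -> d2 K i u != d2 K j u) ->
  (forall e : c1 K, #|[set u | edge_of e u]| = 2) ->
  u != v -> d2 K i u = e -> d2 K j v = e ->
  (boundary (d2 K) c e = (-1) ^+ i * c u + (-1) ^+ j * c v)%R.
Proof.
move=> f2 two uv iu jv.
have one k z : d2 K k z = e ->
    (\sum_(i < 3 | d2 K i z == e) (-1) ^+ i * c z = (-1) ^+ k * c z)%R.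
  move=> kz; rewrite (bigD1 k) ?kz //= big1 ?addr0 // => l /andP[/eqP lz lk].
  by move: (f2 _ _ z lk); rewrite lz kz eqxx.
rewrite ffunE (bigD1 u) //= (bigD1 v) 1?eq_sym //= (one i) // (one j) //.
rewrite big1 ?addr0 // => z /andP[zu zv]; apply: big1 => k /eqP kz.
have : [set u; v; z] \subset [set u | edge_of e u].
  apply/subsetP => a; rewrite !inE -orbA => /or3P[] /eqP->;
    apply/edge_ofP; by [exists i|exists j|exists k].
move/subset_leq_card; rewrite two.
have : #|[set u; v; z]| = 3.
  by rewrite setUC cardsU1 cards2 uv !inE negb_or zu zv.
by move=> ->.
Qed.

(** Reindexed by a 2-cell, one of its edges and one of the ends of that edge, the sum has six terms
    for each 2-cell, two for each of its vertices, with opposite signs. *)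
Lemma boundary_boundary (c : {ffun X -> int}) :
  boundary (@d1 X K) (boundary (d2 K) c) = 0%R.
Proof.
apply/ffunP => w; rewrite !ffunE.
have -> : (\sum_e \sum_(k < 2 | d1 k e == w) (-1) ^+ k * boundary (d2 K) c e
   = \sum_u \sum_(i < 3) \sum_(k < 2 | d1 k (d2 K i u) == w)
      (-1) ^+ k * ((-1) ^+ i * c u) :> int)%R.
  under eq_bigr => e _ do under eq_bigr => k _ do
    rewrite ffunE mulr_sumr.
  under eq_bigr => e _ do rewrite exchange_big /=.
  rewrite exchange_big; apply: eq_bigr => u _ /=.
  under eq_bigr => e _ do under eq_bigr => k _ do rewrite mulr_sumr.
  under eq_bigr => e _ do rewrite exchange_big /=.
  rewrite (exchange_big_dep xpredT) //=; apply: eq_bigr => i _.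
  rewrite big_mkcond (bigD1 (d2 K i u)) //= eqxx [X in (_ + X)%R]big1 ?addr0 // => e ne.
  by rewrite eq_sym (negPf ne).
apply: big1 => u _.
under eq_bigr => i _ do rewrite big_mkcond.
rewrite !big_ord_recl !big_ord0 !d1_d2.
have -> : ord0 = i0 by [].
have -> : lift i0 (ord0 : 'I_2) = i1 by [].
have -> : lift i0 (lift ord0 (ord0 : 'I_1)) = i2 by exact: val_inj.
have -> : lift (ord0 : 'I_2) (ord0 : 'I_1) = ord_max by exact: val_inj.
rewrite !coE /=.
by do 3 case: eqP => _; ring.
Qed.

End Incidence.

Section Closed.
Variables (X : finType) (K : dcomplex X).
Hypothesis HK : closed_complex K.

Lemma d2_inj u : injective (fun i => d2 K i u).
Proof.
move=> i j /= E; apply/eqP; case: (boolP (i == j)) => // /(cc_faces2 HK u).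
by rewrite E eqxx.
Qed.

Lemma vtx_injK u : injective (fun j => vtx K j u).
Proof. by apply: vtx_inj; exact: cc_faces1 HK. Qed.

Lemma other_cell (e : c1 K) u : edge_of e u ->
  exists v, [/\ v != u, edge_of e v & forall z, edge_of e z -> z = u \/ z = v].
Proof.
move=> eu; have /eqP/cards2P[a [b [ab E]]] := cc_two HK e.
have cE z : edge_of e z = (z == a) || (z == b).
  by have := in_set (fun u => edge_of e u) z; rewrite E !inE => ->.
move: eu; rewrite cE => /orP[] /eqP->.
  exists b; split; first by rewrite eq_sym.
    by rewrite cE eqxx orbT.
  by move=> z; rewrite cE => /orP[] /eqP; [left|right].
exists a; split=> //; first by rewrite cE eqxx.
by move=> z; rewrite cE => /orP[] /eqP; [right|left].
Qed.

Lemma cells_of u v (e : c1 K) : u != v -> edge_of e u -> edge_of e v ->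
  forall z, edge_of e z -> z = u \/ z = v.
Proof.
move=> uv /other_cell[w [wu ew H]] ev z /H[->|->]; first by left.
by right; case: (H _ ev) => // E; move: uv; rewrite E eqxx.
Qed.

(** A path of 0-cells drags a path of 2-cells along: consecutive 0-cells lie on a common 2-cell, and
    the 2-cells around one 0-cell are linked through edges. *)
Lemma strongly_connected u v : connect (shares (set0 : {set c1 K})) u v.
Proof.
have loc (w : c0 K) a b : vertex_of w a -> vertex_of w b ->
    connect (shares (set0 : {set c1 K})) a b.
  move=> wa wb; have := cc_link HK wa wb; apply: connect_sub => x y.
  case/existsP=> e /and3P[ex ey _]; apply/connect1/sharesP; exists e.
  by rewrite inE.
move: (vertex_of_vtx K i0 u) (vertex_of_vtx K i0 v).
have := cc_connected HK (vtx K i0 u) (vtx K i0 v).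
case/connectP=> p; move: (vtx K i0 u) (vtx K i0 v) => a b.
elim: p a u => [|c p IH] a u /=; first by move=> _ -> au bv; exact: loc au bv.
case/andP=> ac pp lp au bv; case/existsP: ac => e ac.
have [z ez] := cc_edge HK e.
have za : vertex_of a z.
  apply: vertex_of_end ez _; apply/end_ofP.
  by case/orP: ac => /andP[/eqP ? /eqP ?]; [exists ord0|exists ord_max].
have zc : vertex_of c z.
  apply: vertex_of_end ez _; apply/end_ofP.
  by case/orP: ac => /andP[/eqP ? /eqP ?]; [exists ord_max|exists ord0].
exact: connect_trans (loc _ _ _ au za) (IH _ _ pp lp zc bv).
Qed.

Lemma bd_ex (C : {set X}) u v : u \in C -> v \notin C -> exists e : c1 K, bd C e.
Proof.
move=> uC vC; have [a [b [aC bC]]] := connect_exit (strongly_connected u v) uC vC.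
by case/sharesP=> e [_ ea eb]; exists e; apply/bdP; exists a, b.
Qed.

(** Two 2-cells sharing an edge must cancel there, so a cycle has the same absolute value on both;
    strong connectedness propagates this to all 2-cells. *)
Lemma cycle_norm (c : {ffun X -> int}) u v :
  boundary (d2 K) c = 0%R -> (`|c u| = `|c v|)%R.
Proof.
move=> bc; have := strongly_connected u v.
have step a b : shares (set0 : {set c1 K}) a b -> (`|c a| = `|c b|)%R.
  case/sharesP=> e [_ /edge_ofP[i ia] /edge_ofP[j jb]].
  case: (eqVneq a b) => [->//|ab].
  have := boundary2E c (cc_faces2 HK) (cc_two HK) ab ia jb.
  rewrite bc ffunE => /esym/eqP; rewrite addr_eq0 => /eqP/(congr1 Num.norm).
  by rewrite normrN !normrM !normrX !normrN1 !expr1n !mul1r.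
case/connectP=> p; elim: p u => [|a p IH] u /=; first by move=> _ ->.
by case/andP=> /step-> pp lp; apply: IH.
Qed.

(** The cycle [h 1] has constant absolute value, nonzero because [h] is injective; its signs are the
    orientation. *)
Lemma orientation_of_H2 : m_complex K -> exists o, oriented K o.
Proof.
move=> MK; have [h [hD hi hc]] := m_H2 MK; pose c := h 1%R.
have bc : boundary (d2 K) c = 0%R by apply/hc; exists 1%R.
have h0 : h 0%R = 0%R by apply: (addIr (h 0%R)); rewrite -hD !add0r.
have c0 u : c u != 0%R.
  apply/eqP => cu0; suff: (1 : int) = 0%R by [].
  apply: hi; rewrite h0; apply/ffunP => v; rewrite [RHS]ffunE.
  by apply/eqP; rewrite -normr_eq0 (cycle_norm v u bc) cu0 normr0.
exists (fun u => Num.sg (c u)); split=> [u|i j u v uv E].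
  by rewrite -expr2 sqr_sg c0.
have := boundary2E c (cc_faces2 HK) (cc_two HK) uv erefl (esym E).
rewrite bc ffunE => /esym H.
have nz : (`|c u| != 0)%R by rewrite normr_eq0.
apply: (mulfI nz); rewrite mulr0 -H mulrDr.
rewrite mulrCA [X in (_ * X)%R]mulrC -numEsg; congr (_ + _)%R.
by rewrite (cycle_norm u v bc) mulrCA [X in (_ * X)%R]mulrC -numEsg.
Qed.

Lemma H2_of_orientation o : oriented K o -> m_complex K.
Proof.
move=> [o1 oE]; split; try by case: HK.
pose f := [ffun u => o u]; have fE u : f u = o u by rewrite ffunE.
have bE (c : {ffun X -> int}) : boundary (d2 K) c = 0%R <->
    forall (i j : 'I_3) u v, u != v -> d2 K i u = d2 K j v ->
    ((-1) ^+ i * c u + (-1) ^+ j * c v = 0)%R.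
  split=> [bc i j u v uv E|H].
    have := boundary2E c (cc_faces2 HK) (cc_two HK) uv erefl (esym E).
    by rewrite bc ffunE.
  apply/ffunP => e; have [u eu] := cc_edge HK e.
  have [v [vu ev _]] := other_cell eu.
  have [[i iu] [j jv]] := (edge_ofP _ _ eu, edge_ofP _ _ ev).
  have uv : u != v by rewrite eq_sym.
  rewrite (boundary2E c (cc_faces2 HK) (cc_two HK) uv iu jv) [RHS]ffunE.
  by apply: H; rewrite ?iu ?jv.
have [u0 _] := cc_cell HK.
exists (fun a => [ffun u => a * o u]%R); split.
- by move=> a b; apply/ffunP => u; rewrite !ffunE mulrDl.
- move=> a b /ffunP/(_ u0); rewrite !ffunE => /(congr1 (fun z => z * o u0)%R).
  by rewrite -!mulrA !o1 !mulr1.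
move=> c; split=> [bc|[a ->]].
  (* The multiple of [o] is read off at [u0]: the difference [d] is then a cycle vanishing at [u0],
     hence everywhere by [cycle_norm]. *)
  exists (c u0 * o u0)%R.
  pose d := [ffun u => c u - c u0 * o u0 * o u]%R.
  have bd0 : boundary (d2 K) d = 0%R.
    apply/bE => i j u v uv E; rewrite !ffunE.
    have := (bE c).1 bc i j u v uv E; have := oE i j u v uv E.
    move: (c u) (c v) (o u) (o v) (c u0 * o u0)%R ((-1) ^+ i)%R ((-1) ^+ j)%R.
    move=> cu cv ou ov k a b h1 h2.
    have -> : (a * (cu - k * ou) + b * (cv - k * ov) =
      (a * cu + b * cv) - k * (a * ou + b * ov))%R by ring.
    by rewrite h1 h2 mulr0 subr0.
  apply/ffunP => u; rewrite [RHS]ffunE.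
  have := cycle_norm u u0 bd0; rewrite [d u0]ffunE -mulrA o1 mulr1 subrr normr0.
  by move/eqP; rewrite normr_eq0 ffunE subr_eq0 => /eqP.
apply/bE => i j u v uv E; rewrite !ffunE; have := oE i j u v uv E.
move: (o u) (o v) ((-1) ^+ i)%R ((-1) ^+ j)%R => ou ov x y h.
have -> : (x * (a * ou) + y * (a * ov) = a * (x * ou + y * ov))%R by ring.
by rewrite h mulr0.
Qed.

(** The two cells of an edge cancel if both lie in [C] and contribute nothing if neither does; if
    exactly one does, its signed coefficient remains. *)
Lemma chain_bd o (C : {set X}) : oriented K o ->
  let b := boundary (d2 K) [ffun u => if u \in C then o u else 0%R] in
  (forall e, (b e == 0%R) = ~~ bd C e) /\
  forall e (i : 'I_3) u, bd C e -> u \in C -> d2 K i u = e ->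
    b e = ((-1) ^+ i * o u)%R.
Proof.
move=> [o1 oE] b.
have nz (i : 'I_3) u : ((-1) ^+ i * o u != 0 :> int)%R.
  rewrite mulf_eq0 signr_eq0 /=; apply/eqP => h; have := o1 u.
  by rewrite h mul0r.
have bE e (i : 'I_3) u : d2 K i u = e -> u \in C -> bd C e -> b e = ((-1) ^+ i * o u)%R.
  move=> iu uC /bdP[a [v [aC vC ea ev]]].
  have uv : u != v by apply: contraNneq vC => <-.
  have [j jv] := edge_ofP _ _ ev.
  rewrite /b (boundary2E _ (cc_faces2 HK) (cc_two HK) uv iu jv) !ffunE uC.
  by rewrite (negPf vC) mulr0 addr0.
split=> [e|e i u h1 h2 h3]; last exact: bE.
case: (boolP (bd C e)) => h /=.
  have := h; case/bdP=> u [v [uC vC eu ev]]; have [i iu] := edge_ofP _ _ eu.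
  by rewrite (bE e i u iu uC h); exact/negbTE/nz.
have [u eu] := cc_edge HK e; have [v [vu ev _]] := other_cell eu.
have [[i iu] [j jv]] := (edge_ofP _ _ eu, edge_ofP _ _ ev).
have uv : u != v by rewrite eq_sym.
rewrite /b (boundary2E _ (cc_faces2 HK) (cc_two HK) uv iu jv) !ffunE.
case uC: (u \in C); case vC: (v \in C).
- by rewrite oE // iu jv.
- by case/bdP: h; exists u, v; rewrite vC.
- by case/bdP: h; exists v, u; rewrite uC.
- by rewrite !mulr0 addr0.
Qed.

End Closed.

(** * Triangles *)

Section Triangles.
Variables (X : finType) (K : dcomplex X).

(** A triangle given as a set of edges forgets their numbering; [e] and [v] restore it on the
    pattern of a 2-cell, [v j] being opposite to [e j]. *)
Definition tri_verts (e : 'I_3 -> c1 K) (v : 'I_3 -> c0 K) : Prop :=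
  forall i k, d1 k (e i) = v (co i k).

Definition rim (y : X) : {set c1 K} := [set d2 K i y | i : 'I_3].

Lemma rimP y e : (e \in rim y) = edge_of e y.
Proof.
apply/imsetP/edge_ofP; first by case=> i _ ->; exists i.
by case=> i <-; exists i.
Qed.

Lemma tri_rim y : tri_verts (fun i => d2 K i y) (fun j => vtx K j y).
Proof. by move=> i k; rewrite d1_d2. Qed.

Hypothesis f1 : forall (i j : 'I_2) (e : c1 K), i != j -> d1 i e != d1 j e.

Lemma tri_vinj e v : tri_verts e v -> injective v.
Proof.
move=> H.
have ne i : v (co i ord0) != v (co i ord_max) by rewrite -!H f1.
move: (ne i0) (ne i1) (ne i2); rewrite !coE /= => n0 n1 n2 i j.
case: (I3P i) => ->; case: (I3P j) => -> //= E; move: n0 n1 n2;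
  by rewrite E eqxx.
Qed.

Lemma tri_einj e v : tri_verts e v -> injective e.
Proof.
move=> H i j E.
have h k : co i k = co j k by apply: (tri_vinj H); rewrite -!H E.
move: (h ord0) (h ord_max); rewrite !coE /=.
by case: (I3P i) => ->; case: (I3P j) => ->.
Qed.

Lemma tri_end e v i j : tri_verts e v -> end_of (v j) (e i) = (i != j).
Proof.
move=> H; apply/end_ofP/idP => [[k]|/co_ex[k <-]].
  by rewrite H => /(tri_vinj H) <-; rewrite eq_sym co_neq.
by exists k.
Qed.

(** The direction of the edges makes the three vertices a transitive tournament, which has only one
    numbering. *)
Lemma tri_uniq e v e' v' : tri_verts e v -> tri_verts e' v' ->
  [set e i | i : 'I_3] = [set e' i | i : 'I_3] -> e =1 e'.
Proof.
move=> H H' E.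
have ex i : exists j, e j == e' i.
  have : e' i \in [set e i | i : 'I_3] by rewrite E; apply: imset_f.
  by case/imsetP=> j _ ->; exists j.
pose f i := xchoose (ex i).
have fE i : e (f i) = e' i by apply/eqP; exact: (xchooseP (ex i)).
have fi : injective f by move=> i j h; apply: (tri_einj H'); rewrite -!fE h.
have vE i k : v (co (f i) k) = v' (co i k) by rewrite -H fE H'.
(* Edges 1 and 2 start at the same vertex, edges 0 and 1 end at the same vertex. The first fact
   forces the permutation [f] to fix 0, the second to fix 2. *)
have c1 : co (f i1) ord_max = co (f i2) ord_max.
  by apply: (tri_vinj H); rewrite !vE !coE.
have c2 : co (f i0) ord0 = co (f i1) ord0.
  by apply: (tri_vinj H); rewrite !vE !coE.
have n1 : f i1 <> f i2 by move/fi.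
have n2 : f i0 <> f i1 by move/fi.
have n3 : f i0 <> f i2 by move/fi.
suff F i : f i = i by move=> i; rewrite -fE F.
move: c1 c2 n1 n2 n3; rewrite !coE.
case: (I3P (f i0)) => a; case: (I3P (f i1)) => b; case: (I3P (f i2)) => c;
 rewrite a b c //= => _ _ _ _ _; case: (I3P i) => ->; by rewrite ?a ?b ?c.
Qed.

Lemma boundary_triangle (x y z : c1 K) w :
  (boundary (@d1 X K) (cell x - cell y + cell z) w =
  ((d1 ord0 x == w)%:R - (d1 ord_max x == w)%:R)
  - ((d1 ord0 y == w)%:R - (d1 ord_max y == w)%:R)
  + ((d1 ord0 z == w)%:R - (d1 ord_max z == w)%:R) :> int)%R.
Proof.
rewrite ffunE.
have one (t : c1 K) : (\sum_(a : c1 K) \sum_(i < 2 | d1 i a == w) (-1) ^+ i * cell t a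
  = (d1 ord0 t == w)%:R - (d1 ord_max t == w)%:R :> int)%R.
  rewrite (bigD1 t) //= [X in (_ + X)%R]big1 => [|a /negPf at']; last first.
    by apply: big1 => i _; rewrite ffunE at' mulr0.
  rewrite addr0 big_mkcond !big_ord_recl big_ord0 !ffunE eqxx /=.
  have -> : lift ord0 ord0 = ord_max :> 'I_2 by exact: val_inj.
  by do 2 case: eqP => _.
rewrite -!one -sumrB -big_split; apply: eq_bigr => a _ /=.
rewrite -sumrB -big_split; apply: eq_bigr => i _ /=.
rewrite !ffunE; ring.
Qed.

Lemma tri_verts_of x y z (v : 'I_3 -> c0 K) :
  d1 ord_max x = v i1 -> d1 ord0 x = v i2 ->
  d1 ord_max y = v i0 -> d1 ord0 y = v i2 ->
  d1 ord_max z = v i0 -> d1 ord0 z = v i1 ->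
  tri_verts (fun i => if i == i0 then x else if i == i1 then y else z) v.
Proof.
move=> h1 h2 h3 h4 h5 h6 i k; rewrite coE.
by case: (I3P i) => ->; case: (I2P k) => -> /=.
Qed.

(** The chain equation is symmetric in the first and the third edge, so it yields a numbering with
    the face identities only up to exchanging these two. *)
Lemma triangleP (T : {set c1 K}) : triangle T <->
  exists e v, T = [set e i | i : 'I_3] /\ tri_verts e v.
Proof.
have imE (f : 'I_3 -> c1 K) : [set f i | i : 'I_3] = [set f i0; f i1; f i2].
  apply/setP => a; rewrite !inE; apply/imsetP/idP.
    by case=> i _ ->; case: (I3P i) => ->; rewrite eqxx ?orbT.
  by case/orP=> [/orP[]|] /eqP->; [exists i0|exists i1|exists i2].
split; last first.
  case=> e [v [-> H]]; exists (e i0), (e i1), (e i2); split; first exact: imE.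
  apply/ffunP => w; rewrite boundary_triangle [RHS]ffunE !H !coE /=.
  by ring.
case=> x [y [z [-> B]]].
have {}B w : (boundary (@d1 X K) (cell x - cell y + cell z) w = 0)%R by rewrite B ffunE.
pose tv (v0 v1 v2 : c0 K) i := if i == i0 then v0 else if i == i1 then v1 else v2.
have nx := @f1 ord0 ord_max x isT.
have ny := @f1 ord0 ord_max y isT.
have nz := @f1 ord0 ord_max z isT.
(* With the negative terms moved across, the coefficient at [w] becomes an equality of counts in
   [nat], which is then evaluated at well-chosen ends. *)
have {}B w : ((d1 ord0 x == w) + (d1 ord_max y == w) + (d1 ord0 z == w) =
  (d1 ord_max x == w) + (d1 ord0 y == w) + (d1 ord_max z == w))%N.
  move: (B w); rewrite boundary_triangle.
  by do 6 case: (_ == w).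
have := B (d1 ord0 x); rewrite eqxx (eq_sym (d1 ord_max x)) (negPf nx) /= add0n => E.
(* The edge [y] ends where [x] does or else where [z] does; in the second case [x] and [z] exchange
   their roles. *)
case: (eqVneq (d1 ord0 y) (d1 ord0 x)) => [yx|nyx].
  have fb : d1 ord0 z = d1 ord_max x.
    have := B (d1 ord_max x); rewrite eqxx yx (negPf nx) /=.
    have := B (d1 ord0 z); rewrite eqxx yx (eq_sym (d1 ord_max z)) (negPf nz) /=.
    rewrite !(eq_sym _ (d1 ord0 z)).
    case: (eqVneq (d1 ord0 z) (d1 ord_max x)) => //= _.
    by case: (eqVneq (d1 ord0 z) (d1 ord0 x)) => //= _; do ?case: (_ == _).
  have dg : d1 ord_max y = d1 ord_max z.
    have := B (d1 ord_max y); rewrite eqxx yx fb.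
    by case: (eqVneq (d1 ord_max z) (d1 ord_max y)) => //= _; do ?case: (_ == _).
  have H := @tri_verts_of x y z (tv (d1 ord_max z) (d1 ord_max x) (d1 ord0 x))
    erefl erefl dg yx erefl fb.
  by eexists _, _; split; last exact: H; rewrite imE.
have ga : d1 ord_max z = d1 ord0 x.
  by move: E; rewrite (negPf nyx); case: (eqVneq (d1 ord_max z) (d1 ord0 x)) => //= _; do ?case: (_ == _).
have db : d1 ord_max y = d1 ord_max x.
  have := B (d1 ord_max y); rewrite eqxx ga (negPf ny).
  case: (eqVneq (d1 ord_max x) (d1 ord_max y)) => [->//|] /=.
  by move=> _; case: (eqVneq (d1 ord0 x) (d1 ord_max y)) => /= _; do ?case: (_ == _).
have cf : d1 ord0 y = d1 ord0 z.
  have := B (d1 ord0 y); rewrite eqxx ga db (eq_sym (d1 ord0 x)) (negPf nyx).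
  case: (eqVneq (d1 ord0 z) (d1 ord0 y)) => [->//|] /=.
  by case: (eqVneq (d1 ord_max x) (d1 ord0 y)) => /= _; do ?case: (_ == _).
have H := @tri_verts_of z y x (tv (d1 ord_max x) (d1 ord0 x) (d1 ord0 z))
    ga erefl db cf erefl erefl.
eexists _, _; split; last exact: H; rewrite imE /=.
by apply/setP => a; rewrite !inE [RHS]orbC orbA [RHS]orbAC.
Qed.

End Triangles.

(** * Boundaries of sets of 2-cells *)

Section Boundaries.
Variables (X : finType) (K : dcomplex X).
Hypothesis HK : closed_complex K.

Lemma boundary1E (b : {ffun c1 K -> int}) w e e' (k k' : 'I_2) :
  e != e' -> d1 k e = w -> d1 k' e' = w ->
  (forall a, a != e -> a != e' -> end_of w a -> b a = 0%R) ->
  (boundary (@d1 X K) b w = (-1) ^+ k * b e + (-1) ^+ k' * b e')%R.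
Proof.
move=> ee' ke ke' H.
have one (l : 'I_2) a : d1 l a = w ->
    (\sum_(i < 2 | d1 i a == w) (-1) ^+ i * b a = (-1) ^+ l * b a)%R.
  move=> la; rewrite (bigD1 l) ?la //= big1 ?addr0 // => m /andP[/eqP ma ml].
  by move: (cc_faces1 HK a ml); rewrite ma la eqxx.
rewrite ffunE (bigD1 e) //= (bigD1 e') 1?eq_sym //= (one k) // (one k') //.
rewrite big1 ?addr0 // => a /andP[ae ae']; apply: big1 => l /eqP la.
by rewrite H ?mulr0 //; apply/end_ofP; exists l.
Qed.

Variable o : X -> int.
Hypothesis Ho : oriented K o.

(** At [w] the equation [d d = 0] for the chain carried by [C] has only the terms of [e] and [e'],
    so one coefficient cannot be nonzero without the other. *)
Lemma bd_pair (C : {set X}) w (e e' : c1 K) :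
  e != e' -> end_of w e -> end_of w e' ->
  (forall a, end_of w a -> bd C a -> a = e \/ a = e') -> bd C e -> bd C e'.
Proof.
move=> ee' /end_ofP[k ke] /end_ofP[k' ke'] H.
have [b0 _] := chain_bd HK C Ho; move: b0.
set b := boundary _ _ => b0.
have := boundary1E (b := b) ee' ke ke'.
rewrite boundary_boundary ffunE => E h; apply/negPn; rewrite -b0; apply/negP => /eqP z.
have /E : forall a, a != e -> a != e' -> end_of w a -> b a = 0%R.
  move=> a ae ae' wa; apply/eqP; rewrite b0; apply/negP => /(H _ wa)[] ?; subst a.
    by rewrite eqxx in ae.
  by rewrite eqxx in ae'.
rewrite z mulr0 addr0 => /esym/eqP; rewrite mulf_eq0 signr_eq0 /= b0.
by rewrite h.
Qed.

(** Any two edges of a triangle meet at a vertex which the third edge avoids; there [bd_pair] passes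
    from one to the other. *)
Lemma bd_triangle (C : {set X}) (e : 'I_3 -> c1 K) v (a : c1 K) : tri_verts e v ->
  (forall a : c1 K, bd C a -> a \in [set e i | i : 'I_3]) -> bd C a ->
  forall i, bd C (e i).
Proof.
move=> H sub ba; have [i _ aE] := imsetP (sub _ ba); subst a => j.
case: (eqVneq i j) => [<-//|ij]; have [l li lj] := third i j.
apply: (bd_pair (w := v l) _ _ _ _ ba).
- by apply: contra_neq ij; exact: (tri_einj (cc_faces1 HK) H).
- by rewrite (tri_end (cc_faces1 HK) _ _ H) eq_sym.
- by rewrite (tri_end (cc_faces1 HK) _ _ H) eq_sym.
move=> b wb /sub/imsetP[m _ mE]; subst b.
move: wb; rewrite (tri_end (cc_faces1 HK) _ _ H).
move: ij li lj; case: (I3P i) => ->; case: (I3P j) => ->; case: (I3P l) => ->;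
  case: (I3P m) => -> //= _ _ _ _; by [left|right].
Qed.

(** The same argument with signs: the boundary is a multiple of [e0 - e1 + e2]. The multiple
    determines the sign of a 2-cell that is to close the side [C]. *)
Lemma chain_triangle (C : {set X}) (e : 'I_3 -> c1 K) v : tri_verts e v ->
  (forall a : c1 K, bd C a -> a \in [set e i | i : 'I_3]) ->
  let b := boundary (d2 K) [ffun u => if u \in C then o u else 0%R] in
  forall i, b (e i) = ((-1) ^+ i * b (e i0))%R.
Proof.
move=> H sub b.
have [b0 _] := chain_bd HK C Ho.
have bb : boundary (@d1 X K) b = 0%R by exact: boundary_boundary.
have einj := tri_einj (cc_faces1 HK) H.
have sup (i j l m : 'I_3) : i != j -> i != l -> j != l -> end_of (v l) (e m) -> m = i \/ m = j.
  rewrite (tri_end (cc_faces1 HK) _ _ H).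
  case: (I3P i) => ->; case: (I3P j) => ->; case: (I3P l) => ->;
    case: (I3P m) => -> //= _ _ _ _; by [left|right].
have off l a i j : i != j -> i != l -> j != l -> a != e i -> a != e j -> end_of (v l) a -> b a = 0%R.
  move=> ij il jl ai aj va; apply/eqP; rewrite b0; apply/negP => /sub/imsetP[m _ mE].
  subst a; case: (sup _ _ _ _ ij il jl va) => E; subst m.
    by rewrite eqxx in ai.
  by rewrite eqxx in aj.
have neq i j : i != j -> e i != e j by move=> ij; apply: contra_neq ij; exact: einj.
have g i k := etrans (H i k) (congr1 v (coE i k)).
have h1 := boundary1E (w := v i2) (neq i0 i1 isT) (g i0 ord0) (g i1 ord0)
   (fun a => @off i2 a i0 i1 isT isT isT).
have h2 := boundary1E (w := v i1) (neq i0 i2 isT) (g i0 ord_max) (g i2 ord0)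
   (fun a => @off i1 a i0 i2 isT isT isT).
have z w : boundary (@d1 X K) b w = 0%R by rewrite bb ffunE.
move: h1 h2; rewrite !z /= !expr0 !expr1 => h1 h2 i.
have [s0 s1 s2] : [/\ (-1) ^+ i0 = 1 :> int, (-1) ^+ i1 = -1 :> int
  & (-1) ^+ i2 = 1 :> int]%R by split.
by case: (I3P i) => ->; rewrite ?s0 ?s1 ?s2; move: h1 h2;
  move: (b (e i0)) (b (e i1)) (b (e i2)) => p q r; lia.
Qed.

End Boundaries.

(** * Removing a 2-cell; cut-triangles described by one class *)

Section Proper.
Variables (X : finType) (K : dcomplex X).
Hypothesis MK : m_complex K.

Let HK := m_complex_closed MK.

(** Otherwise [b] and [y] have the same three edges, no edge leads out of the pair, and strong
    connectedness leaves no third 2-cell. *)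
Lemma free_edge b y : 2 < #|X| -> b != y -> exists e : c1 K, edge_of e b && (e \notin rim K y).
Proof.
move=> X3 ne; apply: NNPP => H.
have sub (e : c1 K) : edge_of e b -> edge_of e y.
  move=> eb; rewrite -rimP; apply/negPn/negP => ey; case: H; exists e.
  by rewrite eb ey.
have rE : rim K b = rim K y.
  apply/eqP; rewrite eqEcard; apply/andP; split.
    by apply/subsetP => e; rewrite !rimP; exact: sub.
  by rewrite !card_imset //; exact: d2_inj.
have [z zC] : exists z, z \notin [set b; y].
  apply: NNPP => nz; have : [set: X] \subset [set b; y].
    by apply/subsetP => z _; apply/negPn/negP => h; case: nz; exists z.
  move/subset_leq_card; rewrite cardsT cards2 ne => /(leq_trans X3).
  by [].
have bC : b \in [set b; y] by rewrite !inE eqxx.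
have [e /bdP[u [v [uC vC eu ev]]]] := bd_ex HK bC zC.
have [eb ey] : edge_of e b /\ edge_of e y.
  move: uC; rewrite !inE => /orP[] /eqP E; subst u; first by split=> //; exact: sub.
  by rewrite -!rimP rE rimP.
case: (cells_of HK ne eb ey ev) => E; move: vC; by rewrite E !inE eqxx ?orbT.
Qed.

Lemma tauP (T : {set c1 K}) u v :
  reflect (exists2 w, shares T u w & connect (shares T) w v) (tau T u v).
Proof. by apply: (iffP existsP) => -[w]; [case/andP|move=> h1 h2]; exists w => //; rewrite h1. Qed.

Lemma tau_trans (T : {set c1 K}) : transitive (tau T).
Proof.
move=> b a c /tauP[x ax xb] /tauP[y by' yc]; apply/tauP; exists x => //.
exact: connect_trans xb (connect_trans (connect1 by') yc).
Qed.

Lemma tau_connect (T : {set c1 K}) a b c : tau T a b -> connect (shares T) b c -> tau T a c.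
Proof. by case/tauP=> x ax xb bc; apply/tauP; exists x => //; exact: connect_trans xb bc. Qed.

Lemma shares_tau (T : {set c1 K}) a b : shares T a b -> tau T a b.
Proof. by move=> ab; apply/tauP; exists b => //; exact: connect0. Qed.

Lemma shares_connect_sym (T : {set c1 K}) : connect_sym (shares T).
Proof. by apply: sym_connect_sym => a b; exact: shares_sym. Qed.

Lemma tau_sym (T : {set c1 K}) : symmetric (tau T).
Proof.
suff H a b : tau T a b -> tau T b a by move=> a b; apply/idP/idP; exact: H.
case/tauP=> x ax xb.
have : tau T x a by apply: shares_tau; rewrite shares_sym.
move: xb; rewrite shares_connect_sym => /connectP[p].
elim: p x b {ax} => [|c p IH] x b /=; first by move=> _ ->.
case/andP=> bc pp lp xa; apply: tau_trans (shares_tau bc) _.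
by exact: (IH x c).
Qed.

(* The boundary, away from the triangle of y, of a component of X - {y} is
   either empty or the whole triangle. *)
Lemma tau_minus y b b' : 2 < #|X| -> b != y -> b' != y -> tau (rim K y) b b'.
Proof.
move=> X3; have [o Ho] := orientation_of_H2 HK MK.
pose C b := [set a | connect (shares (rim K y)) b a].
(* Every component thus contains a cell across edge 0 of [y]; there is only one such cell, so all
   components coincide. *)
have key c : c != y -> exists2 a, a \in C c & (a != y) && edge_of (d2 K i0 y) a.
  move=> cy; have cC : c \in C c by rewrite inE connect0.
  have nsh a z : a \in C c -> edge_of z a -> z \notin rim K y ->
      forall d, edge_of z d -> d \in C c.
    rewrite inE => ca za zy d zd; rewrite inE; apply: connect_trans ca _.
    by apply/connect1/sharesP; exists z.
  have nys a : shares (rim K y) a y = false.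
    by apply/negbTE/negP => /sharesP[z []]; rewrite rimP => /negPf->.
  have yC : y \notin C c.
    rewrite inE; apply/negP => h.
    have yN : y \notin [set~ y] by rewrite !inE eqxx.
    have cN : c \in [set~ y] by rewrite !inE.
    have [a [d [_]]] := connect_exit h cN yN.
    by rewrite !inE negbK => /eqP->; rewrite nys.
  have [z zb] := bd_ex HK cC yC.
  have sub a : bd (C c) a -> a \in rim K y.
    case/bdP=> p [q [pC qC ap aq]]; apply/negPn/negP => h.
    by rewrite (nsh _ _ pC ap h _ aq) in qC.
  have := bd_triangle HK Ho (tri_rim K y) sub zb i0.
  case/bdP=> p [q [pC qC ap aq]]; exists p => //; rewrite ap andbT.
  by apply: contraNneq yC => <-.
move=> bY b'Y; have [a aC /andP[ay ea]] := key b bY.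
have [a' a'C /andP[a'y ea']] := key b' b'Y.
have aa : a' = a.
  have ya : y != a by rewrite eq_sym.
  have [E|//] := cells_of HK ya (edge_of_d2 K i0 y) ea ea'.
  by rewrite E eqxx in a'y.
subst a'; have [e /andP[eb ey]] := free_edge X3 bY.
apply: tau_connect (shares_tau (b := b) _) _; first by apply/sharesP; exists e.
rewrite !inE in aC a'C; apply: connect_trans aC _.
by rewrite shares_connect_sym.
Qed.

(** At [w], a component of the link without [x] can be left only through the two edges of [x] ending
    at [w]. By [bd_pair] it borders both, so every component contains the single cell across a fixed
    one of them. *)
Lemma link_minus w x u v : vertex_of w x -> vertex_of w u -> vertex_of w v ->
  u != x -> v != x ->
  connect (fun a b => [&& @neighbours X K w a b, a != x & b != x]) u v.
Proof.
move=> wx; have [o Ho] := orientation_of_H2 HK MK.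
set r := fun a b => _.
have rs : connect_sym r.
  apply: sym_connect_sym => a b; rewrite /r; congr (_ && _); last exact: andbC.
  by apply: eq_existsb => e; rewrite andbCA.
have [j jw] := vertex_ofP _ _ wx.
have [i [l [ij lj il ilP]]] : exists i l : 'I_3, [/\ i != j, l != j, i != l &
    forall m, m != j -> m = i \/ m = l].
  case: (I3P j) => ->; [exists i1, i2|exists i0, i2|exists i0, i1]; split=> // m;
  case: (I3P m) => -> //; by [left|right].
pose C b := [set a | connect r b a].
have key c : vertex_of w c -> c != x -> exists2 a, a \in C c & (a != x) && edge_of (d2 K i x) a.
  move=> wc cx; have cC : c \in C c by rewrite inE connect0.
  have nx a b : a \in C c -> neighbours w a b -> a != x -> b != x -> b \in C c.
    rewrite !inE => ca ab ax bx; apply: connect_trans ca _; apply: connect1.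
    by rewrite /r ab ax.
  have Cx a : a \in C c -> a != x.
    rewrite inE => h; apply/negP => /eqP E; subst a.
    have cN : c \in [set~ x] by rewrite !inE.
    have xN : x \notin [set~ x] by rewrite !inE eqxx.
    have [a [d [_]]] := connect_exit h cN xN.
    by rewrite !inE negbK => /eqP->; rewrite /r eqxx !andbF.
  have xC : x \notin C c by apply/negP => /Cx; rewrite eqxx.
  have bx e : end_of w e -> bd (C c) e -> e = d2 K i x \/ e = d2 K l x.
    move=> we /bdP[a [b [aC bC ea eb]]].
    have ab : neighbours w a b by apply/existsP; exists e; rewrite ea eb.
    have bx : b = x.
      by apply/eqP/negPn/negP => h; rewrite (nx _ _ aC ab (Cx _ aC) h) in bC.
    subst b; have [m mE] := edge_ofP _ _ eb; subst e.
    move: we; rewrite -jw (end_vtx (cc_faces1 HK)) => /ilP.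
    by case=> ->; [left|right].
  have [a [b [aC bC /existsP[e /and3P[ea eb we]]]]] := connect_exit (cc_link HK wc wx) cC xC.
  have eC : bd (C c) e by apply/bdP; exists a, b.
  have iC : bd (C c) (d2 K i x).
    case: (bx e we eC) => E; subst e => //.
    apply: (bd_pair HK Ho _ we _ _ eC).
    - by apply: contra_neq il => /(d2_inj HK) ->.
    - by rewrite -jw vtx_end.
    by move=> e' h1 h2; case: (bx e' h1 h2); [right|left].
  have [p [q [pC qC ep eq]]] := bdP _ _ iC.
  by exists p => //; rewrite ep Cx.
move=> wu wv ux vx; have [a aC /andP[ax ea]] := key u wu ux.
have [a' a'C /andP[a'x ea']] := key v wv vx.
have aa : a' = a.
  have xa : x != a by rewrite eq_sym.
  have [E|//] := cells_of HK xa (edge_of_d2 K i x) ea ea'.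
  by rewrite E eqxx in a'x.
subst a'; rewrite !inE in aC a'C; apply: connect_trans aC _.
by rewrite rs.
Qed.

(** One class determines the partition into two, so [tau] becomes an equality of booleans. This
    equation also contains the reflexivity of [tau]. *)
Lemma cutP (T : {set c1 K}) : cut_triangle T <-> triangle T /\
  exists A : {set X}, [/\ exists u, u \in A, exists u, u \notin A &
     forall u v, tau T u v = ((u \in A) == (v \in A))].
Proof.
split.
  case=> tT [rT sT trT] c2; split=> //; set P := equivalence_partition _ _ in c2.
  have eR : {in [set: X] & &, equivalence_rel (tau T)}.
    move=> x y z _ _ _; split; first exact: rT.
    by move=> xy; apply/idP/idP; [apply: trT; rewrite sT|apply: trT].
  have pP := equivalence_partitionP eR.
  have pb := pblock_equivalence_partition eR.
  have /eqP/cards2P[A [B [AB PE]]] := c2.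
  have AP : A \in P by rewrite PE !inE eqxx.
  have BP : B \in P by rewrite PE !inE eqxx orbT.
  have [cP tP s0] := and3P pP.
  have An0 : A != set0 by apply: contraNneq s0 => <-.
  have Bn0 : B != set0 by apply: contraNneq s0 => <-.
  have dAB : [disjoint A & B] by exact: (trivIsetP tP).
  exists A; split.
  - exact/set0Pn.
  - have /set0Pn[u uB] := Bn0; exists u; apply/negP => uA.
    by have := disjointFr dAB uA; rewrite uB.
  have pE u : pblock P u = if u \in A then A else B.
    case: ifP => uA; first exact: def_pblock.
    apply: def_pblock => //; have : u \in cover P by rewrite (eqP cP) inE.
    by rewrite /cover PE bigcup_setU !big_set1 !inE uA.
  move=> u v; rewrite -pb ?inE // -/P pE.
  case: ifP => uA; first by case: (v \in A).
  case vA: (v \in A).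
    by rewrite (disjointFr dAB vA).
  have : v \in cover P by rewrite (eqP cP) inE.
  by rewrite /cover PE bigcup_setU !big_set1 !inE vA.
case=> tT [A [[a aA] [b bA] tE]]; split=> //.
  split; last exact: tau_trans; first by move=> u; rewrite tE.
  exact: tau_sym.
have -> : equivalence_partition (tau T) [set: X] = [set A; ~: A].
  have bl u : [set y in [set: X] | tau T u y] = if u \in A then A else ~: A.
    apply/setP => v; rewrite !inE tE.
    by case: (u \in A); rewrite ?inE; case: (v \in A).
  apply/setP => B; rewrite !inE; apply/imsetP/idP.
    by case=> u _ ->; rewrite bl; case: ifP; rewrite eqxx ?orbT.
  case/orP=> /eqP->; first by exists a; rewrite ?inE // bl aA.
  by exists b; rewrite ?inE // bl (negPf bA).
rewrite cards2; suff -> : A != ~: A by [].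
by apply/eqP => /setP/(_ a); rewrite !inE aA.
Qed.

Lemma disjointP (T1 T2 : {set c1 K}) (A : {set X}) :
  (exists u, u \in A) -> (exists u, u \notin A) ->
  (forall u v, tau T2 u v = ((u \in A) == (v \in A))) ->
  (disjoint_triangles T1 T2 <->
    T1 \subset side_edges K A \/ T1 \subset side_edges K (~: A)).
Proof.
move=> [a aA] [b bA] tE.
have bl u : [set y in [set: X] | tau T2 u y] = if u \in A then A else ~: A.
  apply/setP => v; rewrite !inE tE.
  by case: (u \in A); rewrite ?inE; case: (v \in A).
split=> [[B /imsetP[u _ ->]]|].
  by rewrite bl; case: ifP => _; [left|right].
case=> h.
  by exists A => //; apply/imsetP; exists a; rewrite ?inE // bl aA.
by exists (~: A) => //; apply/imsetP; exists b; rewrite ?inE // bl (negPf bA).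
Qed.

Lemma side_edgesP (A : {set X}) (e : c1 K) :
  reflect (exists2 u, u \in A & edge_of e u) (e \in side_edges K A).
Proof.
rewrite inE; apply: (iffP existsP) => [[u /andP[]]|[u h1 h2]]; exists u => //.
by rewrite h1.
Qed.

End Proper.

(** * Connected sums *)

(** Path lifting. It moves walks of 2-cells from a summand to the sum, where the fibre over the
    removed 2-cell is the whole other side. *)
Lemma connect_lift (S T : finType) (f : S -> T) (r : rel T) (q : rel S) z b :
  (forall z b, r (f z) b -> exists2 z', f z' = b & connect q z z') ->
  connect r (f z) b -> exists2 z', f z' = b & connect q z z'.
Proof.
move=> H /connectP[p]; elim: p z => [|a p IH] z /=; first by move=> _ ->; exists z.
case/andP=> /H[z' <- zz'] pp lp; have [z'' <- h] := IH z' pp lp.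
by exists z'' => //; exact: connect_trans zz' h.
Qed.

Lemma neighbours_sym (X : finType) (K : dcomplex X) (w : c0 K) :
  connect_sym (neighbours w).
Proof.
by apply: sym_connect_sym => a b; apply: eq_existsb => e; rewrite andbCA.
Qed.

Lemma other_not (X : finType) (K : dcomplex X) (HK : closed_complex K) (e : c1 K) x :
  exists2 u, u != x & edge_of e u.
Proof.
have [u eu] := cc_edge HK e; case: (eqVneq u x) => [E|]; last by exists u.
by subst u; have [v [vx ev _]] := other_cell HK eu; exists v.
Qed.

(* M is a connected sum of K and L at x and y.  The map pX sends the 2-cells
   of M coming from L to x, and symmetrically for pY. *)
Record summing (X Y Z : finType) (K : dcomplex X) (x : X) (L : dcomplex Y)
    (y : Y) (M : dcomplex Z) : Type := Summing {
  pX : Z -> X;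
  pY : Z -> Y;
  j0 : c0 K -> c0 M;
  j1 : c1 K -> c1 M;
  k0 : c0 L -> c0 M;
  k1 : c1 L -> c1 M;
  s_side : forall z, (pX z == x) = (pY z != y);
  s_injX : forall z z', pX z = pX z' -> pX z != x -> z = z';
  s_injY : forall z z', pY z = pY z' -> pY z != y -> z = z';
  s_ontoX : forall a, a != x -> exists z, pX z = a;
  s_ontoY : forall b, b != y -> exists z, pY z = b;
  s_d2X : forall i z, pX z != x -> d2 M i z = j1 (d2 K i (pX z));
  s_d2Y : forall i z, pY z != y -> d2 M i z = k1 (d2 L i (pY z));
  s_j0 : injective j0;
  s_j1 : injective j1;
  s_k0 : injective k0;
  s_k1 : injective k1;
  s_d1X : forall k e, d1 k (j1 e) = j0 (d1 k e);
  s_d1Y : forall k e, d1 k (k1 e) = k0 (d1 k e);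
  s_cov1 : forall e, (exists e', j1 e' = e) \/ (exists e', k1 e' = e);
  s_cov0 : forall w, (exists w', j0 w' = w) \/ (exists w', k0 w' = w);
  s_glue1 : forall e e', j1 e = k1 e' <->
    exists2 i, d2 K i x = e & d2 L i y = e';
  s_glue0 : forall w w', j0 w = k0 w' <->
    exists2 j, vtx K j x = w & vtx L j y = w'
}.

Arguments s_injX {X Y Z K x L y M} s [z z'] _ _.
Arguments s_injY {X Y Z K x L y M} s [z z'] _ _.
Arguments s_ontoX {X Y Z K x L y M} s [a] _.
Arguments s_ontoY {X Y Z K x L y M} s [b] _.
Arguments s_d2X {X Y Z K x L y M} s i [z] _.
Arguments s_d2Y {X Y Z K x L y M} s i [z] _.
Arguments s_j0 {X Y Z K x L y M} s [x1 x2] _ : rename.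
Arguments s_j1 {X Y Z K x L y M} s [x1 x2] _ : rename.
Arguments s_k0 {X Y Z K x L y M} s [x1 x2] _ : rename.
Arguments s_k1 {X Y Z K x L y M} s [x1 x2] _ : rename.

(** The conditions are symmetric in the summands, so each statement about the side of [K] is also
    available for the side of [L]. The definition is transparent so that the projections of the
    exchanged record compute. *)
Definition swap (X Y Z : finType) (K : dcomplex X) (x : X) (L : dcomplex Y)
    (y : Y) (M : dcomplex Z) (S : summing K x L y M) : summing L y K x M.
Proof.
apply: (@Summing _ _ _ L y K x M (pY S) (pX S) (k0 S) (k1 S) (j0 S) (j1 S));
  try by case: S.
- by move=> z; rewrite s_side negbK.
- by move=> e; case: (s_cov1 S e); [right|left].
- by move=> e; case: (s_cov0 S e); [right|left].
- move=> e e'; split=> [/esym/(s_glue1 S)|] [i h1 h2]; first by exists i.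
  by apply/esym/(s_glue1 S); exists i.
- move=> e e'; split=> [/esym/(s_glue0 S)|] [i h1 h2]; first by exists i.
  by apply/esym/(s_glue0 S); exists i.
Defined.

Section Sides.
Variables (X Y Z : finType) (K : dcomplex X) (x : X) (L : dcomplex Y) (y : Y)
  (M : dcomplex Z) (S : summing K x L y M).

Lemma glue_rim i : j1 S (d2 K i x) = k1 S (d2 L i y).
Proof. by apply/(s_glue1 S); exists i. Qed.

Lemma glue_vtx i : j0 S (vtx K i x) = k0 S (vtx L i y).
Proof. by apply/(s_glue0 S); exists i. Qed.

Lemma sideY z : pX S z = x -> pY S z != y.
Proof. by move=> E; rewrite -(s_side S) E eqxx. Qed.

Lemma sideX z : pX S z != x -> pY S z = y.
Proof. by rewrite (s_side S) negbK => /eqP. Qed.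

Lemma edge_jX e z : pX S z != x -> edge_of (j1 S e) z = edge_of e (pX S z).
Proof.
move=> h; apply/edge_ofP/edge_ofP => -[i].
  by rewrite (s_d2X S) // => /(s_j1 S) <-; exists i.
by move<-; exists i; rewrite (s_d2X S).
Qed.

Lemma edge_jY e z : pX S z = x -> edge_of (j1 S e) z ->
  exists2 i, d2 K i x = e & edge_of (d2 L i y) (pY S z).
Proof.
move=> /sideY h /edge_ofP[i]; rewrite (s_d2Y S) // => /esym/(s_glue1 S)[l le lE].
by exists l => //; rewrite lE edge_of_d2.
Qed.

Lemma edge_pX e z : edge_of (j1 S e) z -> edge_of e (pX S z).
Proof.
case: (eqVneq (pX S z) x) => h; last by rewrite edge_jX.
by case/(edge_jY h) => i <- _; rewrite h edge_of_d2.
Qed.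

Lemma vtx_jX j z : pX S z != x -> vtx M j z = j0 S (vtx K j (pX S z)).
Proof.
move=> h; have [i ij _] := third j j; have [k <-] := co_ex ij.
by rewrite -!d1_d2 (s_d2X S) // (s_d1X S).
Qed.

Lemma vertex_jX w z : pX S z != x -> vertex_of (j0 S w) z = vertex_of w (pX S z).
Proof.
move=> h; apply/vertex_ofP/vertex_ofP => -[j].
  by rewrite vtx_jX // => /(s_j0 S) <-; exists j.
by move<-; exists j; rewrite vtx_jX.
Qed.

Lemma end_j w e : end_of (j0 S w) (j1 S e) = end_of w e.
Proof.
apply/end_ofP/end_ofP => -[k]; rewrite ?(s_d1X S).
  by move/(s_j0 S); exists k.
by move=> <-; exists k; rewrite (s_d1X S).
Qed.

Lemma rim_edge e : (j1 S e \in j1 S @: rim K x) = edge_of e x.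
Proof.
rewrite -rimP; apply/imsetP/idP => [[e' h /(s_j1 S) ->]|h] //.
by exists e.
Qed.

Lemma neighbours_j w a b : pX S a != x -> pX S b != x ->
  neighbours w (pX S a) (pX S b) -> neighbours (j0 S w) a b.
Proof.
move=> ax bx /existsP[e /and3P[ea eb we]]; apply/existsP; exists (j1 S e).
by rewrite !edge_jX // ea eb end_j.
Qed.

End Sides.

Lemma swap_rim (X Y Z : finType) (K : dcomplex X) (x : X) (L : dcomplex Y)
    (y : Y) (M : dcomplex Z) (S : summing K x L y M) :
  k1 S @: rim L y = j1 S @: rim K x.
Proof.
apply/setP => e; apply/imsetP/imsetP => -[e' /imsetP[i _ ->] ->].
  by exists (d2 K i x); rewrite ?rimP ?edge_of_d2 ?glue_rim.
by exists (d2 L i y); rewrite ?rimP ?edge_of_d2 ?glue_rim.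
Qed.

Section SumClosed.
Variables (X Y Z : finType) (K : dcomplex X) (x : X) (L : dcomplex Y) (y : Y)
  (M : dcomplex Z) (S : summing K x L y M).
Hypotheses (MK : m_complex K) (ML : m_complex L).

Let HK := m_complex_closed MK.
Let HL := m_complex_closed ML.

(** A walk around [w] in [K] may pass through [x], which is absent from the sum; [link_minus]
    supplies one that does not. *)
Lemma sum_linkX (w : c0 K) z z' : pX S z != x -> pX S z' != x ->
  vertex_of (j0 S w) z -> vertex_of (j0 S w) z' ->
  connect (neighbours (j0 S w)) z z'.
Proof.
move=> zx z'x; rewrite !vertex_jX // => wz wz'.
pose r a b := [&& @neighbours X K w a b, a != x & b != x].
have : connect r (pX S z) (pX S z').
  case: (boolP (vertex_of w x)) => wx; first exact: link_minus.
  have nx a : vertex_of w a -> a != x by apply: contraTneq => ->.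
  apply: connect_sub (cc_link HK wz wz') => a b ab; apply: connect1.
  rewrite /r ab; case/existsP: ab => e /and3P[ea eb we].
  by rewrite !nx // (vertex_of_end _ we).
case/(connect_lift (q := neighbours (j0 S w))).
  move=> {wz zx}z b /and3P[zb zx bx]; have [z1 zE] := s_ontoX S bx; subst b.
  by exists z1 => //; apply/connect1/neighbours_j.
by move=> z1 E; rewrite (s_injX S E) // E.
Qed.

(** An edge of [x] loses [x] and gains the cell of [L] across the corresponding edge of [y]; any
    other edge keeps its two cells. *)
Lemma sum_twoX e : #|[set u | edge_of (j1 S e) u]| = 2.
Proof.
apply/eqP/cards2P; case: (boolP (edge_of e x)) => ex.
  have [i iE] := edge_ofP _ _ ex; subst e.
  have [a [ax ea aP]] := other_cell HK (edge_of_d2 K i x).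
  have [b [bx eb bP]] := other_cell HL (edge_of_d2 L i y).
  have [z1 z1E] := s_ontoX S ax; have [z2 z2E] := s_ontoY S bx; subst a b.
  have z2x : pX S z2 = x by apply/eqP; rewrite s_side.
  exists z1, z2; split; first by apply: contraNneq ax => ->; rewrite z2x.
  apply/setP => z; rewrite !inE; apply/idP/orP.
    case: (eqVneq (pX S z) x) => zx h.
      case/(edge_jY zx): h => l /(d2_inj HK) -> /bP.
      case=> E; first by have := sideY zx; rewrite E eqxx.
      by right; rewrite (s_injY S E) // E.
    move: h; rewrite edge_jX // => /aP[E|E]; first by rewrite E eqxx in zx.
    by left; rewrite (s_injX S E) // E.
  case=> /eqP->; first by rewrite edge_jX.
  by rewrite glue_rim (edge_jX (S := swap S)).
have [a ea] := cc_edge HK e; have [b [ba eb bP]] := other_cell HK ea.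
have ax : a != x by apply: contraNneq ex => <-.
have bx : b != x by apply: contraNneq ex => <-.
have [z1 z1E] := s_ontoX S ax; have [z2 z2E] := s_ontoX S bx; subst a b.
exists z1, z2; split; first by apply: contraNneq ba => ->.
apply/setP => z; rewrite !inE; apply/idP/orP.
  move=> /edge_pX h; case: (bP _ h) => E; [left|right].
    by rewrite (s_injX S E) // E.
  by rewrite (s_injX S E) // E.
by case=> /eqP->; rewrite edge_jX.
Qed.

(** The orientation of [L] is multiplied by [- o x * o' y] so that, across a glued edge, the cell
    coming from [L] contributes exactly what [x] contributed in [K]. *)
Lemma sum_orientX o o' z z' (i j : 'I_3) e :
  oriented K o -> oriented L o' ->
  z != z' -> d2 M i z = j1 S e -> d2 M j z' = j1 S e -> pX S z != x ->
  (let p t := if pX S t != x then o (pX S t)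
    else - o x * o' y * o' (pY S t) in
  (-1) ^+ i * p z + (-1) ^+ j * p z' = 0 :> int)%R.
Proof.
move=> [o1 oE] [o1' oE'] zz' iz jz' zx /=; rewrite zx.
have iE : d2 K i (pX S z) = e by apply: (s_j1 S); rewrite -(s_d2X S).
case: (eqVneq (pX S z') x) => z'x /=; last first.
  have jE : d2 K j (pX S z') = e by apply: (s_j1 S); rewrite -(s_d2X S).
  apply: oE; last by rewrite iE.
  by apply: contra_neq zz' => E; exact: (s_injX S E).
have [l lE ll] : exists2 l, d2 K l x = e & d2 L l y = d2 L j (pY S z').
  by apply/(s_glue1 S); rewrite -jz' (s_d2Y S) //; exact: sideY.
have h := oE i l _ _ zx (etrans iE (esym lE)).
have h' : ((-1) ^+ l * o' y + (-1) ^+ j * o' (pY S z') = 0)%R.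
  by apply: oE' => //; rewrite eq_sym sideY.
have hy := o1' y.
rewrite mulrCA.
have -> : ((-1) ^+ j * o' (pY S z') = - ((-1) ^+ l * o' y))%R.
  by apply/eqP; rewrite -addr_eq0 addrC h'.
have -> : (- o x * o' y * - ((-1) ^+ l * o' y) = (-1) ^+ l * o x * (o' y * o' y))%R.
  by ring.
by rewrite hy mulr1.
Qed.

End SumClosed.

Section SumM.
Variables (X Y Z : finType) (K : dcomplex X) (x : X) (L : dcomplex Y) (y : Y)
  (M : dcomplex Z) (S : summing K x L y M).
Hypotheses (MK : m_complex K) (ML : m_complex L).

Let HK := m_complex_closed MK.
Let HL := m_complex_closed ML.

(** A vertex lying on both sides is a glued one, and some glued edge ends at it; the walk changes
    sides across that edge. *)
Lemma sum_linkXY (w : c0 M) z z' : pX S z != x -> pX S z' = x ->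
  vertex_of w z -> vertex_of w z' -> connect (neighbours w) z z'.
Proof.
move=> zx z'x wz wz'.
have z'y := sideY z'x.
have [a aE] := vertex_ofP _ _ wz; rewrite (vtx_jX _ zx) in aE.
have [b bE] := vertex_ofP _ _ wz'; rewrite (vtx_jX (S := swap S) _ z'y) /= in bE.
have [j jx jy] : exists2 j, vtx K j x = vtx K a (pX S z) & vtx L j y = vtx L b (pY S z').
  by apply/(s_glue0 S); rewrite aE bE.
rewrite -{}jx in aE; rewrite -{}jy in bE.
have [i ij _] := third j j.
have [c [cx ec _]] := other_cell HK (edge_of_d2 K i x).
have [d [dy ed _]] := other_cell HL (edge_of_d2 L i y).
have [z1 z1E] := s_ontoX S cx; have [z2 z2E] := s_ontoY S dy; subst c d.
have we : end_of w (j1 S (d2 K i x)) by rewrite -aE end_j vtx_end.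
have e1 : edge_of (j1 S (d2 K i x)) z1 by rewrite edge_jX.
have e2 : edge_of (j1 S (d2 K i x)) z2 by rewrite glue_rim (edge_jX (S := swap S)).
have n12 : neighbours w z1 z2 by apply/existsP; exists (j1 S (d2 K i x)); rewrite e1 e2.
have w1 := vertex_of_end e1 we; have w2 := vertex_of_end e2 we.
apply: connect_trans (connect_trans (connect1 n12) _).
  by rewrite -aE; apply: sum_linkX => //; rewrite aE.
by rewrite -bE; apply: (sum_linkX (S := swap S)) => //; rewrite /= bE.
Qed.

Lemma sum_closed : closed_complex M.
Proof.
split.
- have [e [u eu]] : exists e : c1 K, exists u, edge_of e u.
    by exists (d2 K i0 x), x; exact: edge_of_d2.
  by have [v vx _] := other_not HK e x; have [z _] := s_ontoX S vx; exists z.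
- have jc a b : connect (@adjacent _ M) (j0 S a) (j0 S b).
    apply: connect_mono (cc_connected HK a b) => c d /existsP[e H].
    apply/connect1/existsP; exists (j1 S e); rewrite !(s_d1X S).
    by rewrite !(inj_eq (s_j0 S)).
  have kc a b : connect (@adjacent _ M) (k0 S a) (k0 S b).
    apply: connect_mono (cc_connected HL a b) => c d /existsP[e H].
    apply/connect1/existsP; exists (k1 S e); rewrite !(s_d1Y S).
    by rewrite !(inj_eq (s_k0 S)).
  have g := glue_vtx S i0.
  move=> a b; case: (s_cov0 S a) => -[a' <-]; case: (s_cov0 S b) => -[b' <-] //.
    by apply: connect_trans (jc _ (vtx K i0 x)) _; rewrite g.
  by apply: connect_trans (kc _ (vtx L i0 y)) _; rewrite -g.
- move=> w; case: (s_cov0 S w) => -[w' <-].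
    by have [e we] := cc_end HK w'; exists (j1 S e); rewrite end_j.
  by have [e we] := cc_end HL w'; exists (k1 S e); rewrite (end_j (swap S)).
- move=> e; case: (s_cov1 S e) => -[e' <-].
    have [u ux eu] := other_not HK e' x; have [z zE] := s_ontoX S ux; subst u.
    by exists z; rewrite edge_jX.
  have [u ux eu] := other_not HL e' y; have [z zE] := s_ontoY S ux; subst u.
  by exists z; rewrite (edge_jX (S := swap S)).
- move=> i j z ij; case: (eqVneq (pX S z) x) => zx.
    rewrite !(s_d2Y S) ?sideY // (inj_eq (s_k1 S)).
    exact: cc_faces2.
  by rewrite !(s_d2X S) // (inj_eq (s_j1 S)); exact: cc_faces2.
- move=> i j e ij; case: (s_cov1 S e) => -[e' <-].
    by rewrite !(s_d1X S) (inj_eq (s_j0 S)); exact: cc_faces1.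
  by rewrite !(s_d1Y S) (inj_eq (s_k0 S)); exact: cc_faces1.
- move=> e; case: (s_cov1 S e) => -[e' <-]; first exact: sum_twoX.
  exact: (sum_twoX (swap S)).
move=> w u v wu wv.
case: (eqVneq (pX S u) x) => ux; case: (eqVneq (pX S v) x) => vx.
- have [j jE] := vertex_ofP _ _ wu; rewrite (vtx_jX (S := swap S) _ (sideY ux)) /= in jE.
  by rewrite -jE in wu wv *; apply: (sum_linkX (S := swap S)); rewrite /= ?sideY.
- by rewrite neighbours_sym; exact: sum_linkXY.
- exact: sum_linkXY.
- have [j jE] := vertex_ofP _ _ wu; rewrite (vtx_jX _ ux) in jE.
  by rewrite -jE in wu wv *; exact: sum_linkX.
Qed.

Lemma sum_m_complex : m_complex M.
Proof.
have [o Ho] := orientation_of_H2 HK MK; have [o' Ho'] := orientation_of_H2 HL ML.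
pose p t := (if pX S t != x then o (pX S t) else - o x * o' y * o' (pY S t))%R.
apply: (H2_of_orientation sum_closed (o := p)); split.
  have [o1 _] := Ho; have [o1' _] := Ho'.
  move=> z; rewrite /p; case: ifP => _; first exact: o1.
  have -> : (- o x * o' y * o' (pY S z) * (- o x * o' y * o' (pY S z)) =
    (o x * o x) * (o' y * o' y) * (o' (pY S z) * o' (pY S z)))%R by ring.
  by rewrite o1 !o1' !mulr1.
move=> i j z z' zz' E.
case: (eqVneq (pX S z) x) => zx; last first.
  by apply: (sum_orientX (S := S) (e := d2 K i (pX S z)) Ho Ho' zz' _ _ zx);
    [|rewrite -E]; exact: s_d2X.
case: (eqVneq (pX S z') x) => z'x; last first.
  rewrite addrC; have zz : z' != z by rewrite eq_sym.
  by apply: (sum_orientX (S := S) (e := d2 K j (pX S z')) Ho Ho' zz _ _ z'x);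
    [|rewrite E]; exact: s_d2X.
have zy := sideY zx; have z'y := sideY z'x.
rewrite /p zx z'x eqxx /=.
move: E; rewrite !(s_d2Y S) // => /(s_k1 S) E.
have [_ oE'] := Ho'.
have h : pY S z != pY S z' by apply: contra_neq zz' => h; exact: (s_injY S h zy).
have := oE' i j _ _ h E.
move: ((-1) ^+ i)%R ((-1) ^+ j)%R (o' (pY S z)) (o' (pY S z')) => a b c d e.
have -> : (a * (- o x * o' y * c) + b * (- o x * o' y * d) =
 - o x * o' y * (a * c + b * d))%R by ring.
by rewrite e mulr0.
Qed.

End SumM.

(** * Cut-triangles of a sum and of its summands *)

Section Transfer.
Variables (X Y Z : finType) (K : dcomplex X) (x : X) (L : dcomplex Y) (y : Y)
  (M : dcomplex Z) (S : summing K x L y M).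
Hypotheses (MK : m_complex K) (ML : m_complex L) (L3 : 2 < #|Y|).

Let HK := m_complex_closed MK.
Let HL := m_complex_closed ML.
Let MM := sum_m_complex S MK ML.

Lemma pX_onto a : exists z, pX S z = a.
Proof.
case: (eqVneq a x) => [->|]; last exact: s_ontoX.
have [b [by' _ _]] := other_cell HL (edge_of_d2 L i0 y).
by have [z zb] := s_ontoY S by'; exists z; apply/eqP; rewrite (s_side S) zb.
Qed.

Lemma shares_kY (T : {set c1 K}) z b : shares (rim L y) (pY S z) b ->
  exists2 z', pY S z' = b & connect (shares (j1 S @: T)) z z'.
Proof.
case/sharesP=> e [ey ez eb].
have ne b' : edge_of e b' -> b' != y by apply: contraTneq => ->; rewrite -rimP.
have [z' zE] := s_ontoY S (ne _ eb); exists z' => //; subst b.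
apply/connect1/sharesP; exists (k1 S e).
rewrite !(edge_jX (S := swap S)) /= ?ne //; split=> //.
apply/negP => /imsetP[e' _ /esym/(s_glue1 S)[i _ iE]].
by move: ey; rewrite rimP -iE edge_of_d2.
Qed.

(** The walk in [L] given by [tau_minus] avoids the triangle of [y], so none of its edges comes from
    [K], whatever the set [T] of edges of [K]. *)
Lemma tau_sideY (T : {set c1 K}) z z' :
  pX S z = x -> pX S z' = x -> tau (j1 S @: T) z z'.
Proof.
move=> zx z'x; have zy := sideY zx; have z'y := sideY z'x.
have [e /andP[ez ey]] := free_edge ML L3 zy.
apply: tau_connect (shares_tau (b := z) _) _.
  apply/sharesP; exists (k1 S e); rewrite (edge_jX (S := swap S)) //=; split=> //.
  apply/negP => /imsetP[e' _ /esym/(s_glue1 S)[i _ iE]].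
  by move: ey; rewrite rimP -iE edge_of_d2.
have /tauP[w h1 h2] := tau_minus ML L3 zy z'y.
have := connect_trans (connect1 h1) h2.
case/(connect_lift (q := shares (j1 S @: T)) (fun z b => @shares_kY T z b)).
by move=> z1 E; rewrite (s_injY S E) // E.
Qed.

Lemma tau_glued z z' : 2 < #|X| ->
  pX S z != x -> pX S z' != x -> tau (j1 S @: rim K x) z z'.
Proof.
move=> K3 zx z'x; have zy := sideX zx; have z'y := sideX z'x.
have [e /andP[ez ey]] := free_edge MK K3 zx.
have step a b : shares (rim K x) (pX S a) b ->
  exists2 c, pX S c = b & connect (shares (j1 S @: rim K x)) a c.
  case/sharesP=> f [fx fa fb].
  have ne c : edge_of f c -> c != x by apply: contraTneq => ->; rewrite -rimP.
  have [c cE] := s_ontoX S (ne _ fb); exists c => //; subst b.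
  apply/connect1/sharesP; exists (j1 S f).
  by rewrite !edge_jX ?ne // rim_edge -rimP.
apply: tau_connect (shares_tau (b := z) _) _.
  by apply/sharesP; exists (j1 S e); rewrite edge_jX // rim_edge -rimP.
have /tauP[w h1 h2] := tau_minus MK K3 zx z'x.
have := connect_trans (connect1 h1) h2.
case/(connect_lift step) => z1 E.
by rewrite (s_injX S E) // E.
Qed.

Lemma shares_glued z z' : shares (j1 S @: rim K x) z z' ->
  (pX S z == x) = (pX S z' == x).
Proof.
case/sharesP=> e [eG]; case: (s_cov1 S e) => -[e' eE]; subst e.
  move: eG; rewrite rim_edge => ex.
  have nx t : edge_of (j1 S e') t -> (pX S t == x) = false.
    move=> h; apply/eqP => /edge_jY/(_ h)[i iE _].
    by move: ex; rewrite -iE edge_of_d2.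
  by move=> /nx-> /nx->.
move: eG; rewrite -swap_rim (rim_edge (swap S)) => ey.
have nx t : edge_of (k1 S e') t -> (pX S t == x) = true.
  move=> h; rewrite (s_side S); apply/eqP => E.
  by have := edge_pX (S := swap S) h; rewrite /= E (negPf ey).
by move=> /nx-> /nx->.
Qed.

Lemma tau_gluedE z z' : 2 < #|X| ->
  tau (j1 S @: rim K x) z z' = ((pX S z == x) == (pX S z' == x)).
Proof.
move=> K3; apply/idP/eqP => [/tauP[w /shares_glued -> /connectP[p]]|].
  elim: p w => [|a p IH] w /=; first by move=> _ ->.
  by case/andP=> /shares_glued->; exact: IH.
case: (eqVneq (pX S z) x) => zx; case: (eqVneq (pX S z') x) => z'x //= _.
  exact: tau_sideY.
exact: tau_glued.
Qed.

Lemma tri_jX (T : {set c1 K}) : triangle (j1 S @: T) <-> triangle T.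
Proof.
have fK := cc_faces1 HK; have fM := cc_faces1 (m_complex_closed MM).
split=> /triangleP; last first.
  case=> // e [v [-> H]]; apply/triangleP => //.
  exists (fun i => j1 S (e i)), (fun i => j0 S (v i)); split.
    by rewrite -imset_comp.
  by move=> i k; rewrite (s_d1X S) H.
case=> // e [v [TE H]]; apply/triangleP => //.
have : forall i, exists a, a \in T /\ j1 S a = e i.
  move=> i; have : e i \in j1 S @: T by rewrite TE imset_f.
  by case/imsetP=> a aT ->; exists a.
case/fin_all_exists=> e' e'P.
have : forall j, exists w, j0 S w = v j.
  move=> j; have [i ij _] := third j j; have [k <-] := co_ex ij.
  by exists (d1 k (e' i)); rewrite -(s_d1X S) (e'P i).2 H.
case/fin_all_exists=> v' v'P.
exists e', v'; split; last first.
  by move=> i k; apply: (s_j0 S); rewrite -(s_d1X S) (e'P i).2 H v'P.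
apply/setP => a; apply/idP/imsetP => [aT|[i _ ->]]; last exact: (e'P i).1.
have : j1 S a \in [set e i | i : 'I_3] by rewrite -TE imset_f.
by case/imsetP=> i _ E; exists i => //; apply: (s_j1 S); rewrite (e'P i).2.
Qed.

Lemma cut_glued : 2 < #|X| -> cut_triangle (j1 S @: rim K x).
Proof.
move=> K3; apply/cutP; split.
  apply/tri_jX/(triangleP (cc_faces1 HK)).
  by exists (fun i => d2 K i x), (fun j => vtx K j x); split=> //; exact: tri_rim.
exists [set z | pX S z == x]; split.
- by have [z zx] := pX_onto x; exists z; rewrite inE zx.
- have [a [ax _ _]] := other_cell HK (edge_of_d2 K i0 x).
  by have [z za] := s_ontoX S ax; exists z; rewrite inE za.
by move=> u v; rewrite tau_gluedE // !inE.
Qed.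

Section Free.
Variables (T : {set c1 K}) (l : 'I_3).
Hypothesis lT : d2 K l x \notin T.

Lemma shares_down z z' :
  shares (j1 S @: T) z z' -> shares T (pX S z) (pX S z').
Proof.
case/sharesP=> e [eT ez ez'].
have [[e' eE]|[zx z'x]] :
    (exists e', j1 S e' = e) \/ (pX S z = x /\ pX S z' = x).
  case: (s_cov1 S e) => -[e' eE]; first by left; exists e'.
  subst e; have k t : edge_of (k1 S e') t -> pX S t != x ->
      exists e1, j1 S e1 = k1 S e'.
    move=> h tx; have [i iE _] := edge_jY (S := swap S) (sideX tx) h.
    by exists (d2 K i x); rewrite -iE glue_rim.
  case: (eqVneq (pX S z) x) => zx; last by left; exact: k zx.
  by case: (eqVneq (pX S z') x) => z'x; [right|left; exact: k z'x].
- subst e; apply/sharesP; exists e'; split; try exact: edge_pX.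
  by apply: contra eT; exact: imset_f.
by rewrite zx z'x; apply/sharesP; exists (d2 K l x); rewrite edge_of_d2.
Qed.

Lemma shares_up z z' : shares T (pX S z) (pX S z') -> tau (j1 S @: T) z z'.
Proof.
case/sharesP=> e [eT ez ez'].
have near t : edge_of e (pX S t) ->
    exists2 t', edge_of (j1 S e) t' & connect (shares (j1 S @: T)) t t'.
  case: (eqVneq (pX S t) x) => tx; last by exists t => //; rewrite edge_jX.
  rewrite tx => /edge_ofP[i iE].
  have [b [by' eb _]] := other_cell HL (edge_of_d2 L i y).
  have [t' t'E] := s_ontoY S by'; subst b; exists t'.
    by rewrite -iE glue_rim (edge_jX (S := swap S)).
  have t'x : pX S t' = x by apply/eqP; rewrite (s_side S).
  have /tauP[w h1 h2] := tau_sideY T tx t'x.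
  exact: connect_trans (connect1 h1) h2.
have [t t1 t2] := near z ez; have [t' t1' t2'] := near z' ez'.
have tt' : shares (j1 S @: T) t t'.
  apply/sharesP; exists (j1 S e); split=> //.
  by apply/imsetP => -[e' h /(s_j1 S) E]; rewrite E h in eT.
rewrite tau_sym; apply: tau_connect _ (_ : connect _ t z); last first.
  by rewrite shares_connect_sym.
rewrite tau_sym; apply: tau_connect (shares_tau tt') _.
by rewrite shares_connect_sym.
Qed.

(** The whole side of [L] stands for the single cell [x]: it is connected by [tau_sideY], and since
    [x] has an edge outside [T], a step within that side projects to a step from [x] to itself. *)
Lemma tau_pX z z' : tau T (pX S z) (pX S z') = tau (j1 S @: T) z z'.
Proof.
apply/idP/idP; last first.
  case/tauP=> w /shares_down h1 h2; apply/tauP; exists (pX S w) => //.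
  by apply: connect_mono h2 => a b /shares_down h; exact: connect1.
case/tauP=> a; have [w <-] := pX_onto a => /shares_up zw.
case/(connect_lift (q := shares (j1 S @: T))).
  move=> {zw} t b; have [t' <-] := pX_onto b => /shares_up/tauP[c h1 h2].
  by exists t' => //; exact: connect_trans (connect1 h1) h2.
move=> t E wt; case: (eqVneq (pX S z') x) => z'x.
  by apply: tau_trans (tau_connect zw wt) (tau_sideY T _ z'x); rewrite E.
by rewrite (s_injX S E) ?E // in wt; exact: tau_connect zw wt.
Qed.

(** By [tau_pX] a class of the sum is a union of fibres of [pX S], so its image is a class of
    [K]. *)
Lemma cut_jX : cut_triangle (j1 S @: T) -> cut_triangle T.
Proof.
case/cutP=> /tri_jX tT [A [[a aA] [b bA] tE]]; apply/cutP; split=> //.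
pose B := [set pX S z | z in A].
have BE z : (pX S z \in B) = (z \in A).
  apply/imsetP/idP => [[z' z'A E]|h]; last by exists z.
  have : tau (j1 S @: T) z' z by rewrite -tau_pX E tau_pX tE eqxx.
  by rewrite tE z'A => /eqP.
exists B; split; first by exists (pX S a); rewrite BE.
  by exists (pX S b); rewrite BE.
move=> u v; have [z <-] := pX_onto u; have [z' <-] := pX_onto v.
by rewrite tau_pX tE !BE.
Qed.

Lemma disjoint_jX (T' : {set c1 K}) : cut_triangle T ->
  disjoint_triangles (j1 S @: T') (j1 S @: T) -> disjoint_triangles T' T.
Proof.
case/cutP=> tT [A [A0 A1 tE]] D; apply/(disjointP _ A0 A1 tE).
have sub (B : {set X}) : j1 S @: T' \subset side_edges M [set z | pX S z \in B] ->
    T' \subset side_edges K B.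
  move=> /subsetP h; apply/subsetP => e eT'.
  have /side_edgesP[z] := h _ (imset_f (j1 S) eT').
  by rewrite inE => zB /edge_pX ez; apply/side_edgesP; exists (pX S z).
pose B := [set z | pX S z \in A].
have B0 : exists u, u \in B.
  by case: A0 => a aA; have [z zE] := pX_onto a; exists z; rewrite inE zE.
have B1 : exists u, u \notin B.
  by case: A1 => a aA; have [z zE] := pX_onto a; exists z; rewrite inE zE.
have tB u v : tau (j1 S @: T) u v = ((u \in B) == (v \in B)).
  by rewrite -tau_pX tE !inE.
case/(disjointP _ B0 B1 tB): D => h; [left|right]; apply: sub => //.
by apply: subset_trans h _; apply/subsetP => e /side_edgesP[z];
   rewrite !inE => zB ez; apply/existsP; exists z; rewrite !inE zB.
Qed.

End Free.

Lemma side_image (T : {set c1 M}) :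
  T \subset side_edges M [set z | pX S z != x] ->
  exists T' : {set c1 K}, T = j1 S @: T'.
Proof.
move=> /subsetP h; exists [set e | j1 S e \in T]; apply/setP => e.
apply/idP/imsetP => [eT|[e' + ->]]; last by rewrite inE.
have /side_edgesP[z] := h _ eT; rewrite inE => zx /edge_ofP[i].
by rewrite (s_d2X S) // => E; exists (d2 K i (pX S z)); rewrite ?inE E.
Qed.

End Transfer.

(** The classes of the glued triangle are the two sides, and all edges of the cells on one side come
    from one summand. This starts every descent into a tree. *)
Lemma disjoint_glued (X Y Z : finType) (K : dcomplex X) (x : X)
    (L : dcomplex Y) (y : Y) (M : dcomplex Z) (S : summing K x L y M)
    (T : {set c1 M}) :
  m_complex K -> m_complex L -> 2 < #|X| -> 2 < #|Y| ->
  disjoint_triangles T (j1 S @: rim K x) ->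
  (exists T' : {set c1 K}, T = j1 S @: T') \/
  (exists T' : {set c1 L}, T = k1 S @: T').
Proof.
move=> MK ML X3 Y3; pose A := [set z | pX S z != x].
have HK := m_complex_closed MK.
have tE u v : tau (j1 S @: rim K x) u v = ((u \in A) == (v \in A)).
  by rewrite (tau_gluedE S MK ML) // !inE; do 2 case: (_ == x).
have A0 : exists u, u \in A.
  have [a [ax _ _]] := other_cell HK (edge_of_d2 K i0 x).
  by have [z za] := s_ontoX S ax; exists z; rewrite inE za.
have A1 : exists u, u \notin A.
  by have [z zx] := pX_onto S ML x; exists z; rewrite inE zx eqxx.
case/(disjointP _ A0 A1 tE) => h; [left|right]; first exact: side_image h.
apply: (side_image (S := swap S)); apply: subset_trans h _.
apply/subsetP => e /side_edgesP[z zA ez]; apply/side_edgesP; exists z => //.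
by move: zA; rewrite !inE negbK (s_side S).
Qed.

(** * Isomorphisms and uniqueness of connected sums *)

Section Isos.
Variables (X : finType).
Implicit Types K L M : dcomplex X.

Lemma is_lt2iso_id K : is_lt2iso (K := K) (L := K) id id.
Proof. by split=> //; exists id. Qed.

Lemma is_lt2iso_comp K L M f0 f1 g0 g1 :
  @is_lt2iso X K L f0 f1 -> @is_lt2iso X L M g0 g1 ->
  is_lt2iso (K := K) (L := M) (g0 \o f0) (g1 \o f1).
Proof.
case=> b0 b1 h1 h2 [c0 c1 l1 l2]; split; try exact: bij_comp.
  by move=> i e /=; rewrite h1 l1.
by move=> i u /=; rewrite h2 l2.
Qed.

Lemma is_lt2iso_inv K L f0 f1 : @is_lt2iso X K L f0 f1 ->
  exists g0 g1, [/\ @is_lt2iso X L K g0 g1, cancel f1 g1, cancel g1 f1,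
    cancel f0 g0 & cancel g0 f0].
Proof.
case=> [[g0 fK0 gK0] [g1 fK1 gK1] h1 h2]; exists g0, g1; split=> //; split.
- by exists f0.
- by exists f1.
- by move=> i e; apply: (can_inj fK0); rewrite gK0 h1 gK1.
- by move=> i u; apply: (can_inj fK1); rewrite gK1 h2.
Qed.

Lemma lt2iso_refl K : lt2iso K K.
Proof. by exists id, id; exact: is_lt2iso_id. Qed.

Lemma lt2iso_sym K L : lt2iso K L -> lt2iso L K.
Proof. by case=> f0 [f1 /is_lt2iso_inv[g0 [g1 [h _ _ _ _]]]]; exists g0, g1. Qed.

Lemma lt2iso_trans K L M : lt2iso K L -> lt2iso L M -> lt2iso K M.
Proof.
move=> [f0 [f1 h]] [g0 [g1 l]]; exists (g0 \o f0), (g1 \o f1).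
exact: is_lt2iso_comp h l.
Qed.

Lemma iso_inj0 K L f0 f1 : @is_lt2iso X K L f0 f1 -> injective f0.
Proof. by case=> /bij_inj. Qed.

Lemma iso_inj1 K L f0 f1 : @is_lt2iso X K L f0 f1 -> injective f1.
Proof. by case=> _ /bij_inj. Qed.

Lemma vtx_iso K L f0 f1 j u : @is_lt2iso X K L f0 f1 ->
  f0 (vtx K j u) = vtx L j u.
Proof.
case=> _ _ h1 h2; have [i ij _] := third j j; have [k <-] := co_ex ij.
by rewrite -!d1_d2 h1 h2.
Qed.

End Isos.

Definition sum_pX (X Y : finType) (x : X) (y : Y) (z : comp_arity x y) : X :=
  match z with inl a => val a | inr _ => x end.

Definition sum_pY (X Y : finType) (x : X) (y : Y) (z : comp_arity x y) : Y :=
  match z with inl _ => y | inr b => val b end.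

Lemma sum_side (X Y : finType) (x : X) (y : Y) (z : comp_arity x y) :
  (sum_pX z == x) = (sum_pY z != y).
Proof. by case: z => -[a h] /=; rewrite ?eqxx ?(negPf h). Qed.

(** As [f] and [g] are injective, the identifications form a partial matching: they do not chain up,
    and a class has at most two members. *)
Lemma class_matching (I A B : finType) (r : rel (A + B)) (f : I -> A) (g : I -> B) :
  (forall a b, reflect (exists i, a = inl (f i) /\ b = inr (g i)) (r a b)) ->
  injective f -> injective g -> forall a b,
  class_of r a = class_of r b <-> a = b \/ symr r a b.
Proof.
move=> rP fi gi a b; rewrite class_of_eq connect_eq_or.
  by split=> [/orP[/eqP|]|[->|->]]; rewrite ?eqxx ?orbT; [left|right| |].
move=> {}a {}b c /orP[] /rP[i [-> ->]] /orP[] /rP[j [E F]] //;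
  case: E F => E F; subst.
  by case: F => E; rewrite (gi _ _ E).
by rewrite (fi _ _ E).
Qed.

(** * The quotient construction as a presentation of the sum *)

Section CSum.
Variables (X Y : finType) (K : dcomplex X) (x : X) (L : dcomplex Y) (y : Y).
Hypotheses (HK : closed_complex K) (HL : closed_complex L).

Lemma glue1P (a b : c1 K + c1 L) : reflect
  (exists i, a = inl (d2 K i x) /\ b = inr (d2 L i y)) (glue1 x y a b).
Proof.
apply: (iffP existsP) => -[i]; first by case/andP=> /eqP-> /eqP->; exists i.
by case=> -> ->; exists i; rewrite !eqxx.
Qed.

Lemma glue0P (a b : c0 K + c0 L) : reflect
  (exists j, a = inl (vtx K j x) /\ b = inr (vtx L j y)) (glue0 x y a b).
Proof.
apply: (iffP idP).
  by case/or3P=> /andP[/eqP-> /eqP->]; [exists i0|exists i1|exists i2].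
by case=> j [-> ->]; rewrite /glue0; case: (I3P j) => ->;
  rewrite /vtx /= !eqxx ?orbT.
Qed.

Lemma class1 a b : class_of (glue1 (K := K) (L := L) x y) a = class_of (glue1 x y) b <->
  a = b \/ symr (glue1 x y) a b.
Proof.
exact: (class_matching (f := fun i => d2 K i x) (g := fun i => d2 L i y) glue1P
  (@d2_inj _ _ HK x) (@d2_inj _ _ HL y)).
Qed.

Lemma class0 a b : class_of (glue0 (K := K) (L := L) x y) a = class_of (glue0 x y) b <->
  a = b \/ symr (glue0 x y) a b.
Proof.
exact: (class_matching (f := fun j => vtx K j x) (g := fun j => vtx L j y) glue0P
  (@vtx_injK _ _ HK x) (@vtx_injK _ _ HL y)).
Qed.

Definition csum_summing : summing K x L y (csum K L x y).
Proof.
apply: (@Summing _ _ _ K x L y (csum K L x y) (@sum_pX _ _ x y) (@sum_pY _ _ x y)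
  (fun w => class_of (glue0 x y) (inl w)) (fun e => class_of (glue1 x y) (inl e))
  (fun w => class_of (glue0 x y) (inr w)) (fun e => class_of (glue1 x y) (inr e))).
- exact: sum_side.
- move=> [[a ha]|[b hb]] [[a' ha']|[b' hb']] //= E h.
  + by congr inl; apply: val_inj.
  + by rewrite E eqxx in h.
  + by rewrite eqxx in h.
  + by rewrite eqxx in h.
- move=> [[a ha]|[b hb]] [[a' ha']|[b' hb']] //= E h.
  + by rewrite eqxx in h.
  + by rewrite eqxx in h.
  + by rewrite E eqxx in h.
  + by congr inr; apply: val_inj.
- by move=> a ax; exists (inl (exist _ a ax)).
- by move=> b bY; exists (inr (exist _ b bY)).
- by move=> i [a|b] //=; rewrite eqxx.
- by move=> i [a|b] //=; rewrite eqxx.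
- by move=> w w' /class0[[]//|/orP[]/glue0P[j []]].
- by move=> w w' /class1[[]//|/orP[]/glue1P[j []]].
- by move=> w w' /class0[[]//|/orP[]/glue0P[j []]].
- by move=> w w' /class1[[]//|/orP[]/glue1P[j []]].
- by move=> k e; rewrite [LHS]class_end.
- by move=> k e; rewrite [LHS]class_end.
- move=> e; have [[a|b] <-] := class_of_onto e; first by left; exists a.
  by right; exists b.
- move=> e; have [[a|b] <-] := class_of_onto e; first by left; exists a.
  by right; exists b.
- move=> e e'; rewrite class1; split.
    by case=> // /orP[] /glue1P[i [E F]] //; case: E => ->; case: F => ->; exists i.
  by case=> i <- <-; right; apply/orP; left; apply/glue1P; exists i.
- move=> e e'; rewrite class0; split.
    by case=> // /orP[] /glue0P[i [E F]] //; case: E => ->; case: F => ->; exists i.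
  by case=> i <- <-; right; apply/orP; left; apply/glue0P; exists i.
Defined.

End CSum.

(** In dimensions 0 and 1 both complexes are quotients of the disjoint union of the cells of [K] and
    [L], with the kernel prescribed by the gluing conditions of [summing]. *)
Lemma summing_iso (X Y Z : finType) (K : dcomplex X) (x : X) (L : dcomplex Y)
    (y : Y) (M M' : dcomplex Z) (S : summing K x L y M) (S' : summing K x L y M') :
  pX S =1 pX S' -> pY S =1 pY S' ->
  exists f0 f1, [/\ is_lt2iso (K := M) (L := M') f0 f1,
    forall e, f1 (j1 S e) = j1 S' e & forall e, f1 (k1 S e) = k1 S' e].
Proof.
move=> EX EY.
pose s1 (N : dcomplex Z) (T : summing K x L y N) e := match e with inl e => j1 T e | inr e => k1 T e end.
pose s0 (N : dcomplex Z) (T : summing K x L y N) e := match e with inl e => j0 T e | inr e => k0 T e end.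
have on1 (N : dcomplex Z) (T : summing K x L y N) e : exists a, s1 N T a = e.
  by case: (s_cov1 T e) => -[a <-]; [exists (inl a)|exists (inr a)].
have on0 (N : dcomplex Z) (T : summing K x L y N) e : exists a, s0 N T a = e.
  by case: (s_cov0 T e) => -[a <-]; [exists (inl a)|exists (inr a)].
have [f1 b1 E1] : exists2 f : c1 M -> c1 M', bijective f & forall a, f (s1 M S a) = s1 M' S' a.
  apply: same_kernel_bij => // -[a|a] [b|b] /=.
  - by split=> [/(s_j1 S)|/(s_j1 S')] ->.
  - by rewrite (s_glue1 S) (s_glue1 S').
  - by split=> /esym E; apply/esym; move: E; rewrite (s_glue1 S) (s_glue1 S').
  - by split=> [/(s_k1 S)|/(s_k1 S')] ->.
have [f0 b0 E0] : exists2 f : c0 M -> c0 M', bijective f & forall a, f (s0 M S a) = s0 M' S' a.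
  apply: same_kernel_bij => // -[a|a] [b|b] /=.
  - by split=> [/(s_j0 S)|/(s_j0 S')] ->.
  - by rewrite (s_glue0 S) (s_glue0 S').
  - by split=> /esym E; apply/esym; move: E; rewrite (s_glue0 S) (s_glue0 S').
  - by split=> [/(s_k0 S)|/(s_k0 S')] ->.
exists f0, f1; split; last first.
- by move=> e; exact: (E1 (inr e)).
- by move=> e; exact: (E1 (inl e)).
split=> // [k e|i z].
  have [[a|a] <-] := on1 _ S e; rewrite E1 /= ?(s_d1X S) ?(s_d1X S') ?(s_d1Y S) ?(s_d1Y S').
    exact: (E0 (inl _)).
  exact: (E0 (inr _)).
case: (eqVneq (pX S z) x) => h.
  have h' := sideY h; rewrite (s_d2Y S) // (s_d2Y S') -?EY //.
  exact: (E1 (inr _)).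
rewrite (s_d2X S) // (s_d2X S') -?EX //; exact: (E1 (inl _)).
Qed.

Definition summing_to (X Y Z Z' : finType) (K : dcomplex X) (x : X)
    (L : dcomplex Y) (y : Y) (M : dcomplex Z) (M' : dcomplex Z') (s : Z' -> Z) f0 f1
    (bs : bijective s) (F : @is_lt2iso Z' (crename s M) M' f0 f1)
    (S : summing K x L y M) : summing K x L y M'.
Proof.
apply: (@Summing _ _ _ K x L y M' (pX S \o s) (pY S \o s) (f0 \o j0 S) (f1 \o j1 S)
  (f0 \o k0 S) (f1 \o k1 S)).
- by move=> z; exact: s_side.
- by move=> z z' /(s_injX S) h /h /(bij_inj bs).
- by move=> z z' /(s_injY S) h /h /(bij_inj bs).
- by move=> a /(s_ontoX S)[z <-]; have [t <-] := bij_surj bs z; exists t.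
- by move=> a /(s_ontoY S)[z <-]; have [t <-] := bij_surj bs z; exists t.
- by move=> i z h; case: F => _ _ _ <-; congr f1; exact: (s_d2X S).
- by move=> i z h; case: F => _ _ _ <-; congr f1; exact: (s_d2Y S).
- by apply: inj_comp; [exact: (iso_inj0 F)|exact: (s_j0 S)].
- by apply: inj_comp; [exact: (iso_inj1 F)|exact: (s_j1 S)].
- by apply: inj_comp; [exact: (iso_inj0 F)|exact: (s_k0 S)].
- by apply: inj_comp; [exact: (iso_inj1 F)|exact: (s_k1 S)].
- by move=> k e; case: F => _ _ <- _; congr f0; exact: (s_d1X S).
- by move=> k e; case: F => _ _ <- _; congr f0; exact: (s_d1Y S).
- move=> e; case: F => _ /bij_surj/(_ e)[a <-] _ _.
  by case: (s_cov1 S a) => -[b <-]; [left|right]; exists b.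
- move=> e; case: F => /bij_surj/(_ e)[a <-] _ _ _.
  by case: (s_cov0 S a) => -[b <-]; [left|right]; exists b.
- by move=> e e'; rewrite -(s_glue1 S); split=> [/(iso_inj1 F)|/= ->].
- by move=> e e'; rewrite -(s_glue0 S); split=> [/(iso_inj0 F)|/= ->].
Defined.

Definition summing_from (X Y Z : finType) (K K' : dcomplex X) (x : X)
    (L : dcomplex Y) (y : Y) (M : dcomplex Z) f0 f1
    (F : @is_lt2iso X K' K f0 f1) (S : summing K x L y M) : summing K' x L y M.
Proof.
apply: (@Summing _ _ _ K' x L y M (pX S) (pY S) (j0 S \o f0) (j1 S \o f1)
  (k0 S) (k1 S)); try by case: S.
- by move=> i z h; rewrite (s_d2X S) //=; case: F => _ _ _ ->.
- by apply: inj_comp; [exact: (s_j0 S)|exact: (iso_inj0 F)].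
- by apply: inj_comp; [exact: (s_j1 S)|exact: (iso_inj1 F)].
- by move=> k e; rewrite /= (s_d1X S); case: F => _ _ -> _.
- move=> e; case: (s_cov1 S e) => -[a <-]; last by right; exists a.
  by left; case: F => _ /bij_surj/(_ a)[b <-] _ _; exists b.
- move=> e; case: (s_cov0 S e) => -[a <-]; last by right; exists a.
  by left; case: F => /bij_surj/(_ a)[b <-] _ _ _; exists b.
- move=> e e'; rewrite /= (s_glue1 S).
  by split=> -[i h1 h2]; exists i => //; [apply: (iso_inj1 F)|rewrite -h1];
    case: F => _ _ _ ->.
- move=> e e'; rewrite /= (s_glue0 S).
  by split=> -[i h1 h2]; exists i => //; [apply: (iso_inj0 F)|rewrite -h1];
    rewrite (vtx_iso _ _ F).
Defined.

Lemma summing_arity (X Y Z : finType) (K : dcomplex X) (x : X) (L : dcomplex Y)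
    (y : Y) (M : dcomplex Z) (S : summing K x L y M) :
  exists2 s : Z -> comp_arity x y, bijective s &
    (forall z, sum_pX (s z) = pX S z) /\ (forall z, sum_pY (s z) = pY S z).
Proof.
have : forall z, exists t : comp_arity x y, sum_pX t = pX S z /\ sum_pY t = pY S z.
  move=> z; case: (eqVneq (pX S z) x) => h.
    by exists (inr (exist (fun b => b != y) _ (sideY h))).
  by exists (inl (exist (fun a => a != x) _ h)); rewrite /= (sideX h).
case/fin_all_exists=> s sE; exists s; last by split=> z; case: (sE z).
apply: bij_onto => [z z' E|].
  have EX : pX S z = pX S z' by rewrite -!(sE _).1 E.
  have EY : pY S z = pY S z' by rewrite -!(sE _).2 E.
  case: (eqVneq (pX S z) x) => h; last exact: s_injX EX h.
  exact: s_injY EY (sideY h).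
case=> -[a h].
  have [z zE] := s_ontoX S h; exists z; case: (sE z); rewrite zE.
  case: (s z) => [[b hb]|[b hb]] /= E; first by move=> _; congr inl; exact: val_inj.
  by case/eqP: (h).
have [z zE] := s_ontoY S h; exists z; case: (sE z) => _; rewrite zE.
case: (s z) => [[b hb]|[b hb]] /= E; last by congr inr; exact: val_inj.
by case/eqP: (h).
Qed.

Lemma summing_csum (X Y Z : finType) (K : dcomplex X) (x : X) (L : dcomplex Y)
    (y : Y) (M : dcomplex Z) (S : summing K x L y M) (s : Z -> comp_arity x y) :
  closed_complex K -> closed_complex L -> bijective s ->
  (forall z, sum_pX (s z) = pX S z) -> (forall z, sum_pY (s z) = pY S z) ->
  exists p0 p1, is_lt2iso (K := crename s (csum K L x y)) (L := M) p0 p1 /\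
    forall e, p1 (class_of (glue1 x y) (inl e)) = j1 S e.
Proof.
move=> HK HL bs EX EY.
have [f0 [f1 [h1 h2 _]]] :=
  summing_iso (S := summing_to bs (is_lt2iso_id _) (csum_summing x y HK HL)) (S' := S) EX EY.
by exists f0, f1.
Qed.

(** * Units *)

Lemma co_face_law (j k : 'I_2) : j <= k -> co (lift ord0 k) j = co (lift ord_max j) k.
Proof. by case: (I2P j) => ->; case: (I2P k) => -> // _; apply: val_inj. Qed.

(** All 2-cells are glued along one standard triangle; for two of them this is the sphere, a model
    of the unit. *)
Definition unit_on (X : finType) : dcomplex X :=
  @DComplex X 'I_3 'I_3 (fun k i => co i k) (fun i _ => i)
    (fun j k _ => @co_face_law j k).

Lemma vtx_unit (X : finType) j (u : X) : vtx (unit_on X) j u = j.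
Proof.
have [i ij _] := third j j; have [k kE] := co_ex ij.
by rewrite -{1}kE -d1_d2 /= kE.
Qed.

Lemma card2_other (X : finType) (a b b' : X) :
  #|X| = 2 -> b != a -> b' != a -> b = b'.
Proof.
move=> X2 h h'; have : #|[set~ a]| = 1 by rewrite cardsC1 X2.
move/eqP/cards1P=> [c cE].
have : b \in [set~ a] by rewrite !inE.
have : b' \in [set~ a] by rewrite !inE.
by rewrite cE !inE => /eqP-> /eqP->.
Qed.

(** The unit law: the cell of the unit other than [y] takes the place of [x]. The maps [p] and [q]
    are arbitrary, so that any renaming can be seen as such a sum. *)
Definition summing_unit (X Y Z : finType) (K : dcomplex X) (x : X) (y : Y)
    (p : Z -> X) (q : Z -> Y) (HK : closed_complex K) (bp : bijective p)
    (Y2 : #|Y| = 2) (pq : forall z, (p z == x) = (q z != y)) :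
  summing K x (unit_on Y) y (crename p K).
Proof.
apply: (@Summing _ _ _ K x (unit_on Y) y (crename p K) p q id id
  (fun j => vtx K j x) (fun i => d2 K i x)) => //.
- by move=> z z' /(bij_inj bp).
- move=> z z' E h; apply: (bij_inj bp); have h' := h; rewrite E in h'.
  by move: h h'; rewrite -!pq => /eqP-> /eqP->.
- by move=> a _; exact: bij_surj bp a.
- move=> b bY; have [z zE] := bij_surj bp x; exists z; apply: (card2_other Y2) bY.
  by rewrite -pq zE.
- by move=> i z; rewrite -pq /= => /eqP->.
- exact: (@vtx_injK _ _ HK x).
- exact: (@d2_inj _ _ HK x).
- by move=> k e /=; rewrite d1_d2.
- by move=> e; left; exists e.
- by move=> e; left; exists e.
- by move=> e e'; split=> [->|[i <- <-]] //; exists e'.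
- move=> e e'; split=> [->|[i <- <-]]; last by rewrite vtx_unit.
  by exists e'; rewrite ?vtx_unit.
Defined.

Lemma unit_on_unit (X : finType) : #|X| = 2 -> unit_complex (unit_on X).
Proof.
move=> X2; split=> //.
have eE e (u : X) : edge_of (K := unit_on X) e u by apply/edge_ofP; exists e.
have adj (a b : 'I_3) : connect (@adjacent X (unit_on X)) a b.
  case: (eqVneq a b) => [->|ab]; first exact: connect0.
  apply: connect1; apply/existsP; have [e ea eb] := third a b; exists e => /=.
  move: ab ea eb; rewrite !coE.
  by case: (I3P a) => ->; case: (I3P b) => ->; case: (I3P e) => ->.
have cE : closed_complex (unit_on X).
  split=> //.
  - have : 0 < #|X| by rewrite X2.
    by case/card_gt0P=> u _; exists u.
  - move=> w; have [e ew _] := third w w; have [k kE] := co_ex ew.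
    by exists e; apply/end_ofP; exists k.
  - move=> e; have : 0 < #|X| by rewrite X2.
    by case/card_gt0P=> u _; exists u.
  - by move=> i j e ij /=; rewrite /co; apply: contra_neq ij => /lift_inj/rev_ord_inj.
  - move=> e; rewrite -X2 -cardsT; congr #|pred_of_set _|.
    by apply/setP => u; rewrite !inE eE.
  move=> w u v _ _; apply/connect1/existsP.
  have [e ew _] := third w w; exists e; rewrite !eE.
  by have [k kE] := co_ex ew; apply/end_ofP; exists k.
have : 0 < #|X| by rewrite X2.
case/card_gt0P=> a _.
apply: (H2_of_orientation cE (o := fun u => if u == a then 1%R else (-1)%R)).
split=> [u|i j u v uv /= ->]; first by case: eqP.
case: (eqVneq u a) => [E|ua]; case: (eqVneq v a) => [F|va].
- by rewrite E F eqxx in uv.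
- by ring.
- by ring.
- by rewrite (card2_other X2 ua va) eqxx in uv.
Qed.

(** Instead of transporting the conditions one by one, [L] is presented as a sum of [K] with the
    unit on [bool], to which [sum_m_complex] applies. *)
Lemma m_complex_ren_iso (X Z : finType) (s : Z -> X) (K : dcomplex X) (L : dcomplex Z) :
  bijective s -> lt2iso (crename s K) L -> m_complex K -> m_complex L.
Proof.
move=> bs [f0 [f1 F]] MK; have HK := m_complex_closed MK; have [x _] := cc_cell HK.
have B2 : #|{: bool}| = 2 by exact: card_bool.
have pq z : (s z == x) = ((s z == x) != false) by case: (s z == x).
have bi : bijective (id : Z -> Z) by exists id.
have S := summing_to (s := id) bi F (summing_unit HK bs B2 pq).
by apply: (sum_m_complex S MK); have [] := unit_on_unit B2.
Qed.

Lemma m_complex_iso (X : finType) (K L : dcomplex X) :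
  lt2iso K L -> m_complex K -> m_complex L.
Proof. by move=> KL; apply: (m_complex_ren_iso (s := id)); first by exists id. Qed.

Lemma m_complex_ren (X Z : finType) (s : Z -> X) (K : dcomplex X) :
  bijective s -> m_complex K -> m_complex (crename s K).
Proof. by move=> bs; apply: m_complex_ren_iso bs (lt2iso_refl _). Qed.

(* A transitive tournament on the three vertices of a triangle determines the
   numbering of its edges, so two 2-cells with the same edges have the same
   faces. *)
Lemma unit_of_card (X : finType) (K : dcomplex X) :
  m_complex K -> #|X| <= 2 -> unit_complex K.
Proof.
move=> MK X2; have HK := m_complex_closed MK.
have sub (e : c1 K) : [set u | edge_of e u] = [set: X].
  by apply/eqP; rewrite eqEcard subsetT cardsT (cc_two HK).
split=> //.
  apply/eqP; rewrite eqn_leq X2; have [u _] := cc_cell HK.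
  by rewrite -(cc_two HK (d2 K i0 u)) max_card.
move=> i u v.
apply: (tri_uniq (cc_faces1 HK) (tri_rim K u) (tri_rim K v)).
apply/setP => e; have := rimP (K := K) u e; have := rimP (K := K) v e.
rewrite /rim => -> ->.
by have := sub e; move/setP => h; have := h u; have := h v; rewrite !inE => -> ->.
Qed.

Lemma unit_iso (X : finType) (K : dcomplex X) : unit_complex K -> lt2iso (unit_on X) K.
Proof.
case=> MK X2 uE; have HK := m_complex_closed MK; have [u _] := cc_cell HK.
have c1E (e : c1 K) : exists i, d2 K i u = e.
  by have [v /edge_ofP[i <-]] := cc_edge HK e; exists i; exact: uE.
exists (fun j => vtx K j u), (fun i => d2 K i u); split.
- apply: bij_onto; first exact: vtx_injK.
  move=> w; have [e /end_ofP[k <-]] := cc_end HK w; have [i <-] := c1E e.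
  by exists (co i k); rewrite d1_d2.
- by apply: bij_onto; first exact: d2_inj.
- by move=> k i; rewrite d1_d2.
- by move=> i v; exact: uE.
Qed.

Lemma unit_complex_iso (X : finType) (K L : dcomplex X) :
  lt2iso K L -> unit_complex K -> unit_complex L.
Proof.
move=> KL [MK X2 uE]; split=> //; first exact: m_complex_iso KL MK.
by case: KL => f0 [f1 [_ _ _ h]] i u v; rewrite -!h (uE i u v).
Qed.

(** Properness becomes a count of 2-cells, which is easily followed through sums and cuts. *)
Lemma not_unit_card (X : finType) (K : dcomplex X) :
  m_complex K -> ~ unit_complex K <-> 2 < #|X|.
Proof.
move=> MK; split=> [nU|X3 [_ X2 _]]; last by rewrite X2 in X3.
by rewrite ltnNge; apply/negP => h; apply: nU; exact: unit_of_card.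
Qed.

(** * Trees *)

(** A map between total spaces lying over [f] is a family of maps between fibres; the transport
    along the equality of tags is hidden in [etagged]. *)
Lemma sig_factor (I J : eqType) (A : I -> Type) (B : J -> Type) (f : I -> J)
    (G : {i : I & A i} -> {j : J & B j}) :
  (forall x, tag (G x) = f (tag x)) ->
  exists g : forall i, A i -> B (f i),
    forall x, G x = existT (fun j => B j) (f (tag x)) (g (tag x) (tagged x)).
Proof.
move=> H; exists (fun i a => etagged (H (existT (fun i => A i) i a))).
case=> i a /=; rewrite /etagged; move: (H _) => /=.
by case: (G _) => j b /= E; case: _ / E.
Qed.

Lemma sig_bij (I J : finType) (A : I -> finType) (B : J -> finType) (f : I -> J)
    (g : forall i, A i -> B (f i)) :
  bijective f -> (forall i, bijective (g i)) ->
  bijective (fun x : {i : I & A i} =>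
    existT (fun j => B j : Type) (f (tag x)) (g (tag x) (tagged x))).
Proof.
move=> bf bg; apply: bij_onto => [[i a] [i' a'] /= E|[j b]].
  have ii : i = i' by apply: (bij_inj bf); exact: (congr1 tag E).
  by subst i'; rewrite (bij_inj (bg i) (Tagged_inj E)).
have [i iE] := bij_surj bf j; subst j; have [a aE] := bij_surj (bg i) b.
by exists (existT _ i a); rewrite /= aE.
Qed.

Lemma bij_sig (I J : finType) (A : I -> finType) (B : J -> finType) (f : I -> J)
    (g : forall i, A i -> B (f i)) (G : {i : I & A i} -> {j : J & B j}) :
  (forall x, G x = existT (fun j => B j : Type) (f (tag x)) (g (tag x) (tagged x))) ->
  bijective f -> bijective G -> forall i, bijective (g i).
Proof.
move=> GE bf bG i; apply: bij_onto => [a a' E|b].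
  have : G (existT _ i a) = G (existT _ i a') by rewrite !GE /= E.
  by move/(bij_inj bG)/Tagged_inj.
have [[i' a] aE] := bij_surj bG (existT _ (f i) b).
rewrite GE /= in aE.
have ii : i' = i by apply: (bij_inj bf); exact: (congr1 tag aE).
by subst i'; exists a; exact: Tagged_inj aE.
Qed.

Definition tot_inl (I J : finType) (A : I + J -> finType) (x : {i : I & A (inl i)}) :=
  existT (fun k => A k : Type) (inl (tag x)) (tagged x).

Definition tot_inr (I J : finType) (A : I + J -> finType) (x : {j : J & A (inr j)}) :=
  existT (fun k => A k : Type) (inr (tag x)) (tagged x).

Lemma tot_inl_inj (I J : finType) (A : I + J -> finType) : injective (@tot_inl I J A).
Proof.
move=> [n a] [n' a'] E; have nn : n = n' by case: (congr1 tag E).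
by subst n'; congr (existT _ _ _); exact: Tagged_inj E.
Qed.

Lemma tot_inr_inj (I J : finType) (A : I + J -> finType) : injective (@tot_inr I J A).
Proof.
move=> [n a] [n' a'] E; have nn : n = n' by case: (congr1 tag E).
by subst n'; congr (existT _ _ _); exact: Tagged_inj E.
Qed.

Section SumTotals.
Variables (I J I' J' : finType) (A : I + J -> finType) (B : I' + J' -> finType)
  (F : {i : I & A (inl i)} -> {i : I' & B (inl i)})
  (G : {j : J & A (inr j)} -> {j : J' & B (inr j)}).

Definition tot_sum (k : {k : (I + J)%type & A k}) : {k : (I' + J')%type & B k} :=
  match k with
  | existT (inl i) a => tot_inl (F (existT (fun i => A (inl i) : Type) i a))
  | existT (inr j) a => tot_inr (G (existT (fun j => A (inr j) : Type) j a))
  end.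

Lemma tot_sum_bij : bijective F -> bijective G -> bijective tot_sum.
Proof.
move=> bF bG; apply: bij_onto.
  move=> [[i|j] a] [[i'|j'] a'] /= E.
  - have := bij_inj bF (tot_inl_inj E).
    exact: (congr1 (@tot_inl I J A)).
  - by have := congr1 tag E.
  - by have := congr1 tag E.
  - have := bij_inj bG (tot_inr_inj E).
    exact: (congr1 (@tot_inr I J A)).
case=> -[i|j] b.
  have [[m a] E] := bij_surj bF (existT (fun i => B (inl i) : Type) i b).
  by exists (existT _ (inl m) a); rewrite /= E.
have [[m a] E] := bij_surj bG (existT (fun j => B (inr j) : Type) j b).
by exists (existT _ (inr m) a); rewrite /= E.
Qed.

End SumTotals.

(** * Complexes assembled from trees *)

Section Totals.
Variables (X : finType) (t : tree X).

Definition tot1 : finType := {n : node t & c1 (dec n)}.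
Definition tot0 : finType := {n : node t & c0 (dec n)}.

Definition D2 (i : 'I_3) (h : half t) : tot1 :=
  existT (fun n => c1 (dec n) : Type) (tag h) (d2 (dec (tag h)) i (tagged h)).
Definition D1 (k : 'I_2) (a : tot1) : tot0 :=
  existT (fun n => c0 (dec n) : Type) (tag a) (d1 k (tagged a)).
Definition V (j : 'I_3) (h : half t) : tot0 :=
  existT (fun n => c0 (dec n) : Type) (tag h) (vtx (dec (tag h)) j (tagged h)).

Lemma D1_D2 k i h : D1 k (D2 i h) = V (co i k) h.
Proof. by rewrite /D1 /D2 /= d1_d2. Qed.

(** At an open half-edge [mate h] is [h], which contributes only trivial identifications, so the
    quantifier may range over all half-edges. *)
Definition gl1 : rel tot1 := fun a b =>
  [exists h, exists i, (a == D2 i h) && (b == D2 i (mate h))].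
Definition gl0 : rel tot0 := fun a b =>
  [exists h, exists j, (a == V j h) && (b == V j (mate h))].

Lemma gl1P a b : reflect (exists h i, a = D2 i h /\ b = D2 i (mate h)) (gl1 a b).
Proof.
apply: (iffP existsP) => -[h].
  by case/existsP=> i /andP[/eqP-> /eqP->]; exists h, i.
by case=> i [-> ->]; exists h; apply/existsP; exists i; rewrite !eqxx.
Qed.

Lemma gl0P a b : reflect (exists h j, a = V j h /\ b = V j (mate h)) (gl0 a b).
Proof.
apply: (iffP existsP) => -[h].
  by case/existsP=> i /andP[/eqP-> /eqP->]; exists h, i.
by case=> i [-> ->]; exists h; apply/existsP; exists i; rewrite !eqxx.
Qed.

Lemma gl1_gl0 k a b : gl1 a b -> gl0 (D1 k a) (D1 k b).
Proof. by case/gl1P=> h [i [-> ->]]; apply/gl0P; exists h, (co i k); rewrite !D1_D2. Qed.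

Lemma D1_connect k a b : connect (symr gl1) a b -> connect (symr gl0) (D1 k a) (D1 k b).
Proof.
apply: connect_mono => {}a {}b ab; apply: connect1.
by case/orP: ab => /(gl1_gl0 k) h; rewrite /symr h ?orbT.
Qed.

Definition glued_d1 (k : 'I_2) (e : gluing gl1) : gluing gl0 :=
  class_of gl0 (D1 k (val e)).

Lemma glued_d1E k a : glued_d1 k (class_of gl1 a) = class_of gl0 (D1 k a).
Proof. by apply/class_of_eq/D1_connect/class_of_eq; exact: class_of_val. Qed.

Lemma glued_law (j k : 'I_2) (x : X) : j <= k ->
  glued_d1 j (class_of gl1 (D2 (lift ord0 k) (leaf t x))) =
  glued_d1 k (class_of gl1 (D2 (lift ord_max j) (leaf t x))).
Proof. by move=> jk; rewrite !glued_d1E !D1_D2 co_face_law. Qed.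

(* All the decorations, glued along the edges of the tree at once. *)
Definition glued : dcomplex X :=
  @DComplex X (gluing gl0) (gluing gl1) glued_d1
    (fun i x => class_of gl1 (D2 i (leaf t x))) glued_law.

(* A presentation of K as the result of that gluing. *)
Record assembly (K : dcomplex X) : Type := Assembly {
  a0 : tot0 -> c0 K;
  a1 : tot1 -> c1 K;
  a0_onto : forall w, exists a, a0 a = w;
  a1_onto : forall e, exists a, a1 a = e;
  a0_ker : forall a b, a0 a = a0 b <-> connect (symr gl0) a b;
  a1_ker : forall a b, a1 a = a1 b <-> connect (symr gl1) a b;
  a_d1 : forall k a, d1 k (a1 a) = a0 (D1 k a);
  a_d2 : forall i x, d2 K i x = a1 (D2 i (leaf t x))
}.

Definition glued_assembly : assembly glued.
Proof.
apply: (@Assembly glued (class_of gl0) (class_of gl1)).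
- exact: class_of_onto.
- exact: class_of_onto.
- exact: class_of_eq.
- exact: class_of_eq.
- exact: glued_d1E.
- by [].
Defined.

(** For an internal half-edge, the triangle of [K] associated with the edge of the tree through [h];
    at a leaf, the triangle bounding a 2-cell. *)
Definition tri (K : dcomplex X) (A : assembly K) (h : half t) : {set c1 K} :=
  [set a1 A (D2 i h) | i : 'I_3].

Lemma tri_mate (K : dcomplex X) (A : assembly K) h : tri A (mate h) = tri A h.
Proof.
apply/eq_imset => i; apply/(a1_ker A); apply: connect1; apply/orP; right.
by apply/gl1P; exists h, i.
Qed.

End Totals.

Arguments D2 {X} t i h.
Arguments D1 {X} t k a.
Arguments V {X} t j h.

Lemma assembly_vtx (X : finType) (t : tree X) (K : dcomplex X) (A : assembly t K) j x :
  vtx K j x = a0 A (V t j (leaf t x)).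
Proof.
have [i ij _] := third j j; have [k <-] := co_ex ij.
by rewrite -d1_d2 (a_d2 A) a_d1 D1_D2.
Qed.

Lemma assembly_uniq (X : finType) (t : tree X) (K L : dcomplex X)
    (A : assembly t K) (B : assembly t L) :
  exists f0 f1, @is_lt2iso X K L f0 f1 /\ forall a, f1 (a1 A a) = a1 B a.
Proof.
have [f0 b0 E0] : exists2 f : c0 K -> c0 L, bijective f & forall a, f (a0 A a) = a0 B a.
  apply: same_kernel_bij; try exact: a0_onto.
  by move=> a b; rewrite (a0_ker A) (a0_ker B).
have [f1 b1 E1] : exists2 f : c1 K -> c1 L, bijective f & forall a, f (a1 A a) = a1 B a.
  apply: same_kernel_bij; try exact: a1_onto.
  by move=> a b; rewrite (a1_ker A) (a1_ker B).
exists f0, f1; split=> //; split=> // [k e|i x].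
  by have [a <-] := a1_onto A e; rewrite E1 !a_d1 E0.
by rewrite (a_d2 A) E1 (a_d2 B).
Qed.

Definition assembly_to (X : finType) (t : tree X) (K L : dcomplex X) f0 f1
  (F : @is_lt2iso X K L f0 f1) (A : assembly t K) : assembly t L.
Proof.
apply: (@Assembly X t L (f0 \o a0 A) (f1 \o a1 A)).
- move=> w; case: F => /bij_surj/(_ w)[v <-] _ _ _.
  by have [a <-] := a0_onto A v; exists a.
- move=> w; case: F => _ /bij_surj/(_ w)[v <-] _ _.
  by have [a <-] := a1_onto A v; exists a.
- by move=> a b; rewrite -(a0_ker A); split=> [/(iso_inj0 F)|/= ->].
- by move=> a b; rewrite -(a1_ker A); split=> [/(iso_inj1 F)|/= ->].
- by move=> k a /=; rewrite -a_d1; case: F => _ _ ->.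
- by move=> i x /=; rewrite -a_d2; case: F => _ _ _ ->.
Defined.

Lemma lt2iso_assembly (X : finType) (t : tree X) (K : dcomplex X) (A : assembly t K) :
  lt2iso (glued t) K.
Proof. by have [f0 [f1 [h _]]] := assembly_uniq (glued_assembly t) A; exists f0, f1. Qed.

Definition assembly_ren (X Z : finType) (s : Z -> X) (t : tree X) (K : dcomplex X)
  (A : assembly t K) : assembly (trename s t) (crename s K).
Proof.
apply: (@Assembly Z (trename s t) (crename s K) (a0 A) (a1 A)).
- exact: (a0_onto A).
- exact: (a1_onto A).
- exact: (a0_ker A).
- exact: (a1_ker A).
- exact: (a_d1 A).
- by move=> i z; exact: (a_d2 A i (s z)).
Defined.

(** * Isomorphisms of trees *)

(* An isomorphism of trees, given by its effect on all the cells of all the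
   decorations together; this avoids the transports along equalities of nodes
   that composing and inverting the families of [tree_iso] would require. *)
Record tiso (X : finType) (t t' : tree X) : Type := Tiso {
  tn : node t -> node t';
  th : half t -> half t';
  te : tot1 t -> tot1 t';
  tv : tot0 t -> tot0 t';
  tn_bij : bijective tn;
  th_bij : bijective th;
  te_bij : bijective te;
  tv_bij : bijective tv;
  th_tag : forall h, tag (th h) = tn (tag h);
  te_tag : forall a, tag (te a) = tn (tag a);
  tv_tag : forall a, tag (tv a) = tn (tag a);
  te_D2 : forall i h, te (D2 t i h) = D2 t' i (th h);
  tv_D1 : forall k a, tv (D1 t k a) = D1 t' k (te a);
  th_mate : forall h, th (mate h) = mate (th h);
  th_leaf : forall x, th (leaf t x) = leaf t' x
}.

Lemma tree_iso_tiso (X : finType) (t t' : tree X) :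
  tree_iso t t' -> inhabited (tiso t t').
Proof.
case=> f [g [bf bg iso hm hl]].
case/fin_all_exists: iso => p0 /fin_all_exists[p1 pP].
constructor; apply: (@Tiso _ t t' f
  (fun h => existT (fun n => har n : Type) (f (tag h)) (g (tag h) (tagged h)))
  (fun a => existT (fun n => c1 (dec n) : Type) (f (tag a)) (p1 (tag a) (tagged a)))
  (fun a => existT (fun n => c0 (dec n) : Type) (f (tag a)) (p0 (tag a) (tagged a)))) => //.
- exact: sig_bij.
- by apply: (sig_bij (A := fun n => c1 (dec n)) (B := fun n => c1 (dec n))) => // n; case: (pP n).
- by apply: (sig_bij (A := fun n => c0 (dec n)) (B := fun n => c0 (dec n))) => // n; case: (pP n).
- by move=> i [n h] /=; rewrite /D2 /=; case: (pP n) => _ _ _ ->.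
- by move=> k [n a] /=; rewrite /D1 /=; case: (pP n) => _ _ ->.
Qed.

Lemma tiso_tree_iso (X : finType) (t t' : tree X) : tiso t t' -> tree_iso t t'.
Proof.
move=> F; have [g gE] := sig_factor (th_tag F).
have [p1 p1E] := sig_factor (te_tag F); have [p0 p0E] := sig_factor (tv_tag F).
have bn := tn_bij F; exists (tn F), g; split=> //.
- exact: (bij_sig gE bn (th_bij F)).
- move=> n; exists (p0 n), (p1 n); split.
  + exact: (bij_sig (A := fun n => c0 (dec n)) p0E bn (tv_bij F)).
  + exact: (bij_sig (A := fun n => c1 (dec n)) p1E bn (te_bij F)).
  + move=> k e; have := tv_D1 F k (existT _ n e); rewrite p0E p1E.
    exact: (Tagged_inj (T := fun n => c0 (dec n))).
  + move=> i h; have := te_D2 F i (existT _ n h); rewrite p1E gE.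
    exact: (Tagged_inj (T := fun n => c1 (dec n))).
- by move=> h; rewrite -!gE th_mate.
- by move=> x; rewrite -gE th_leaf.
Qed.

Definition tiso_refl (X : finType) (t : tree X) : tiso t t.
Proof. by apply: (@Tiso X t t id id id id) => //; exists id. Defined.

Definition tiso_trans (X : finType) (t t' t'' : tree X) (F : tiso t t')
  (G : tiso t' t'') : tiso t t''.
Proof.
apply: (@Tiso X t t'' (tn G \o tn F) (th G \o th F) (te G \o te F) (tv G \o tv F)).
- exact: bij_comp (tn_bij G) (tn_bij F).
- exact: bij_comp (th_bij G) (th_bij F).
- exact: bij_comp (te_bij G) (te_bij F).
- exact: bij_comp (tv_bij G) (tv_bij F).
- by move=> h /=; rewrite !th_tag.
- by move=> h /=; rewrite !te_tag.
- by move=> h /=; rewrite !tv_tag.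
- by move=> i h /=; rewrite !te_D2.
- by move=> i h /=; rewrite !tv_D1.
- by move=> h /=; rewrite !th_mate.
- by move=> x /=; rewrite !th_leaf.
Defined.

Lemma tiso_sym (X : finType) (t t' : tree X) : tiso t t' -> inhabited (tiso t' t).
Proof.
move=> F.
case: (tn_bij F) => gn nK nK'; case: (th_bij F) => gh hK hK'.
case: (te_bij F) => g1 K1 K1'; case: (tv_bij F) => g0 K0 K0'.
constructor; apply: (@Tiso X t' t gn gh g1 g0).
- by exists (tn F).
- by exists (th F).
- by exists (te F).
- by exists (tv F).
- by move=> h; apply: (can_inj nK); rewrite -th_tag hK' nK'.
- by move=> h; apply: (can_inj nK); rewrite -te_tag K1' nK'.
- by move=> h; apply: (can_inj nK); rewrite -tv_tag K0' nK'.
- by move=> i h; apply: (can_inj K1); rewrite te_D2 K1' hK'.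
- by move=> i h; apply: (can_inj K0); rewrite tv_D1 K0' K1'.
- by move=> h; apply: (can_inj hK); rewrite th_mate !hK'.
- by move=> x; apply: (can_inj hK); rewrite th_leaf hK'.
Qed.

Lemma connect_bij (A B : finType) (f : A -> B) (r : rel A) (q : rel B) a b :
  bijective f -> (forall a b, r a b = q (f a) (f b)) ->
  connect (symr r) a b <-> connect (symr q) (f a) (f b).
Proof.
move=> [g fK gK] H; have S x y : symr r x y = symr q (f x) (f y) by rewrite /symr !H.
split=> h.
  by apply: connect_mono h => x y; rewrite S; exact: connect1.
rewrite -(fK a) -(fK b); apply: connect_mono h => x y.
by rewrite -{1}(gK x) -{1}(gK y) -S; exact: connect1.
Qed.

Lemma V_tiso (X : finType) (t t' : tree X) (F : tiso t t') j h :
  tv F (V t j h) = V t' j (th F h).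
Proof.
have [i ij _] := third j j; have [k <-] := co_ex ij.
by rewrite -!D1_D2 tv_D1 te_D2.
Qed.

Definition assembly_tiso (X : finType) (t t' : tree X) (K : dcomplex X)
  (F : tiso t t') (A : assembly t' K) : assembly t K.
Proof.
apply: (@Assembly X t K (a0 A \o tv F) (a1 A \o te F)).
- move=> w; have [a <-] := a0_onto A w.
  by have [b <-] := bij_surj (tv_bij F) a; exists b.
- move=> w; have [a <-] := a1_onto A w.
  by have [b <-] := bij_surj (te_bij F) a; exists b.
- move=> a b; rewrite /= (a0_ker A); apply: iff_sym; apply: connect_bij (tv_bij F) _.
  move=> {}a {}b; apply/gl0P/gl0P => -[h [j [E E']]].
    by exists (th F h), j; rewrite E E' !V_tiso th_mate.
  have [h' hE] := bij_surj (th_bij F) h; subst h; exists h', j.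
  by split; apply: (bij_inj (tv_bij F)); rewrite V_tiso ?th_mate.
- move=> a b; rewrite /= (a1_ker A); apply: iff_sym; apply: connect_bij (te_bij F) _.
  move=> {}a {}b; apply/gl1P/gl1P => -[h [j [E E']]].
    by exists (th F h), j; rewrite E E' !te_D2 th_mate.
  have [h' hE] := bij_surj (th_bij F) h; subst h; exists h', j.
  by split; apply: (bij_inj (te_bij F)); rewrite te_D2 ?th_mate.
- by move=> k a /=; rewrite a_d1 tv_D1.
- by move=> i x /=; rewrite (a_d2 A) te_D2 th_leaf.
Defined.

Lemma glued_iso (X : finType) (t t' : tree X) : tree_iso t t' -> lt2iso (glued t) (glued t').
Proof.
case/tree_iso_tiso=> F.
exact: lt2iso_assembly (assembly_tiso F (glued_assembly t')).
Qed.

Definition assembly_corolla (X : finType) (G : dcomplex X) : assembly (corolla G) G.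
Proof.
apply: (@Assembly X (corolla G) G (fun a => tagged a) (fun a => tagged a)).
- by move=> w; exists (existT (fun n : node (corolla G) => c0 (dec n) : Type) tt w).
- by move=> w; exists (existT (fun n : node (corolla G) => c1 (dec n) : Type) tt w).
- move=> a b; split=> [|h]; first by case: a b => -[] a [[] b] /= ->; exact: connect0.
  by apply: symr_const h => {}a {}b /gl0P[h [j [-> ->]]].
- move=> a b; split=> [|h]; first by case: a b => -[] a [[] b] /= ->; exact: connect0.
  by apply: symr_const h => {}a {}b /gl1P[h [j [-> ->]]].
- by move=> k [[] a].
- by [].
Defined.

(** * Grafting *)

Section GraftAssembly.
Variables (X Y Z : finType) (s1 : tree X) (u : X) (s2 : tree Y) (v : Y).

Definition inl1 (a : tot1 s1) : tot1 (graft s1 u s2 v) :=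
  existT (fun n : node (graft s1 u s2 v) => c1 (dec n) : Type) (inl (tag a)) (tagged a).
Definition inr1 (a : tot1 s2) : tot1 (graft s1 u s2 v) :=
  existT (fun n : node (graft s1 u s2 v) => c1 (dec n) : Type) (inr (tag a)) (tagged a).
Definition inl0 (a : tot0 s1) : tot0 (graft s1 u s2 v) :=
  existT (fun n : node (graft s1 u s2 v) => c0 (dec n) : Type) (inl (tag a)) (tagged a).
Definition inr0 (a : tot0 s2) : tot0 (graft s1 u s2 v) :=
  existT (fun n : node (graft s1 u s2 v) => c0 (dec n) : Type) (inr (tag a)) (tagged a).

Lemma graft_half (h : half (graft s1 u s2 v)) :
  (exists h1, h = injl s2 h1) \/ (exists h2, h = injr s1 h2).
Proof. by case: h => -[n|n] a; [left|right]; exists (existT _ n a). Qed.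

Lemma mate_injl (h : half s1) : @mate _ (graft s1 u s2 v) (injl s2 h) =
  if h == leaf s1 u then injr s1 (leaf s2 v) else injl s2 (mate h).
Proof. by case: h. Qed.

Lemma mate_injr (h : half s2) : @mate _ (graft s1 u s2 v) (injr s1 h) =
  if h == leaf s2 v then injl s2 (leaf s1 u) else injr s1 (mate h).
Proof. by case: h. Qed.

Lemma D2_injl i h : D2 (graft s1 u s2 v) i (injl s2 h) = inl1 (D2 s1 i h).
Proof. by []. Qed.

Lemma D2_injr i h : D2 (graft s1 u s2 v) i (injr s1 h) = inr1 (D2 s2 i h).
Proof. by []. Qed.

Lemma V_injl i h : V (graft s1 u s2 v) i (injl s2 h) = inl0 (V s1 i h).
Proof. by []. Qed.

Lemma V_injr i h : V (graft s1 u s2 v) i (injr s1 h) = inr0 (V s2 i h).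
Proof. by []. Qed.

Hypotheses (lf1 : forall x, mate (leaf s1 x) = leaf s1 x)
  (lf2 : forall y, mate (leaf s2 y) = leaf s2 y).

Variables (K : dcomplex X) (L : dcomplex Y) (M : dcomplex Z)
  (A : assembly s1 K) (B : assembly s2 L) (S : summing K u L v M)
  (s : Z -> comp_arity u v).
Hypotheses (sX : forall z, sum_pX (s z) = pX S z)
  (sY : forall z, sum_pY (s z) = pY S z).

Definition graft_a1 (a : tot1 (graft s1 u s2 v)) : c1 M :=
  match a with
  | existT (inl n) e => j1 S (a1 A (existT _ n e))
  | existT (inr n) e => k1 S (a1 B (existT _ n e))
  end.

Definition graft_a0 (a : tot0 (graft s1 u s2 v)) : c0 M :=
  match a with
  | existT (inl n) e => j0 S (a0 A (existT _ n e))
  | existT (inr n) e => k0 S (a0 B (existT _ n e))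
  end.

Lemma graft_a1l a : graft_a1 (inl1 a) = j1 S (a1 A a). Proof. by case: a. Qed.
Lemma graft_a1r a : graft_a1 (inr1 a) = k1 S (a1 B a). Proof. by case: a. Qed.
Lemma graft_a0l a : graft_a0 (inl0 a) = j0 S (a0 A a). Proof. by case: a. Qed.
Lemma graft_a0r a : graft_a0 (inr0 a) = k0 S (a0 B a). Proof. by case: a. Qed.

Lemma tot1_case (a : tot1 (graft s1 u s2 v)) :
  (exists b, a = inl1 b) \/ (exists b, a = inr1 b).
Proof. by case: a => -[n|n] e; [left|right]; exists (existT _ n e). Qed.

Lemma tot0_case (a : tot0 (graft s1 u s2 v)) :
  (exists b, a = inl0 b) \/ (exists b, a = inr0 b).
Proof. by case: a => -[n|n] e; [left|right]; exists (existT _ n e). Qed.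

(** Grafting changes the mate of [leaf s1 u] only, and that leaf used to identify each cell with
    itself, so no identification is lost. *)
Lemma gl1_inl a b : connect (symr (gl1 (t := s1))) a b ->
  connect (symr (gl1 (t := graft s1 u s2 v))) (inl1 a) (inl1 b).
Proof.
apply: symr_mono => c d /gl1P[h [i [-> ->]]]; case: (eqVneq h (leaf s1 u)) => [->|hu].
  by left; rewrite lf1.
by right; apply/gl1P; exists (injl s2 h), i; rewrite mate_injl (negPf hu).
Qed.

Lemma gl1_inr a b : connect (symr (gl1 (t := s2))) a b ->
  connect (symr (gl1 (t := graft s1 u s2 v))) (inr1 a) (inr1 b).
Proof.
apply: symr_mono => c d /gl1P[h [i [-> ->]]]; case: (eqVneq h (leaf s2 v)) => [->|hu].
  by left; rewrite lf2.
by right; apply/gl1P; exists (injr s1 h), i; rewrite mate_injr (negPf hu).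
Qed.

Lemma gl0_inl a b : connect (symr (gl0 (t := s1))) a b ->
  connect (symr (gl0 (t := graft s1 u s2 v))) (inl0 a) (inl0 b).
Proof.
apply: symr_mono => c d /gl0P[h [i [-> ->]]]; case: (eqVneq h (leaf s1 u)) => [->|hu].
  by left; rewrite lf1.
by right; apply/gl0P; exists (injl s2 h), i; rewrite mate_injl (negPf hu).
Qed.

Lemma gl0_inr a b : connect (symr (gl0 (t := s2))) a b ->
  connect (symr (gl0 (t := graft s1 u s2 v))) (inr0 a) (inr0 b).
Proof.
apply: symr_mono => c d /gl0P[h [i [-> ->]]]; case: (eqVneq h (leaf s2 v)) => [->|hu].
  by left; rewrite lf2.
by right; apply/gl0P; exists (injr s1 h), i; rewrite mate_injr (negPf hu).
Qed.

Lemma graft_a1_gl a b : gl1 a b -> graft_a1 a = graft_a1 b.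
Proof.
case/gl1P=> h [i [-> ->]]; case: (graft_half h) => -[h' ->].
  rewrite mate_injl; case: eqP => [->|_].
    by rewrite D2_injl D2_injr graft_a1l graft_a1r -!a_d2 glue_rim.
  rewrite !D2_injl !graft_a1l; congr (j1 S _); apply/(a1_ker A)/connect1.
  by apply/orP; left; apply/gl1P; exists h', i.
rewrite mate_injr; case: eqP => [->|_].
  by rewrite D2_injl D2_injr graft_a1l graft_a1r -!a_d2 glue_rim.
rewrite !D2_injr !graft_a1r; congr (k1 S _); apply/(a1_ker B)/connect1.
by apply/orP; left; apply/gl1P; exists h', i.
Qed.

Lemma graft_a0_gl a b : gl0 a b -> graft_a0 a = graft_a0 b.
Proof.
case/gl0P=> h [i [-> ->]]; case: (graft_half h) => -[h' ->].
  rewrite mate_injl; case: eqP => [->|_].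
    by rewrite V_injl V_injr graft_a0l graft_a0r -!assembly_vtx glue_vtx.
  rewrite !V_injl !graft_a0l; congr (j0 S _); apply/(a0_ker A)/connect1.
  by apply/orP; left; apply/gl0P; exists h', i.
rewrite mate_injr; case: eqP => [->|_].
  by rewrite V_injl V_injr graft_a0l graft_a0r -!assembly_vtx glue_vtx.
rewrite !V_injr !graft_a0r; congr (k0 S _); apply/(a0_ker B)/connect1.
by apply/orP; left; apply/gl0P; exists h', i.
Qed.

(** Cells from different sides coincide in [M] only along the glued triangle. Each is joined to it
    by identifications of its own side, and the new edge of the tree joins the two copies. *)
Lemma graft_a1_ker a b :
  graft_a1 a = graft_a1 b <-> connect (symr (gl1 (t := graft s1 u s2 v))) a b.
Proof.
have LR c d : j1 S (a1 A c) = k1 S (a1 B d) ->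
    connect (symr (gl1 (t := graft s1 u s2 v))) (inl1 c) (inr1 d).
  case/(s_glue1 S)=> i; rewrite (a_d2 A) (a_d2 B) => /esym/(a1_ker A) h1 /(a1_ker B) h2.
  apply: connect_trans (gl1_inl h1) (connect_trans _ (gl1_inr h2)).
  apply: connect1; apply/orP; left; apply/gl1P; exists (injl s2 (leaf s1 u)), i.
  by rewrite mate_injl eqxx.
split; last first.
  by apply: symr_const => c d; exact: graft_a1_gl.
case: (tot1_case a) => -[a' ->]; case: (tot1_case b) => -[b' ->];
  rewrite ?graft_a1l ?graft_a1r.
- by move=> /(s_j1 S)/(a1_ker A)/gl1_inl.
- exact: LR.
- by rewrite (symr_sym _ _) => /esym/LR.
- by move=> /(s_k1 S)/(a1_ker B)/gl1_inr.
Qed.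

Lemma graft_a0_ker a b :
  graft_a0 a = graft_a0 b <-> connect (symr (gl0 (t := graft s1 u s2 v))) a b.
Proof.
have LR c d : j0 S (a0 A c) = k0 S (a0 B d) ->
    connect (symr (gl0 (t := graft s1 u s2 v))) (inl0 c) (inr0 d).
  case/(s_glue0 S)=> i; rewrite (assembly_vtx A) (assembly_vtx B) => /esym/(a0_ker A) h1 /(a0_ker B) h2.
  apply: connect_trans (gl0_inl h1) (connect_trans _ (gl0_inr h2)).
  apply: connect1; apply/orP; left; apply/gl0P; exists (injl s2 (leaf s1 u)), i.
  by rewrite mate_injl eqxx.
split; last first.
  by apply: symr_const => c d; exact: graft_a0_gl.
case: (tot0_case a) => -[a' ->]; case: (tot0_case b) => -[b' ->];
  rewrite ?graft_a0l ?graft_a0r.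
- by move=> /(s_j0 S)/(a0_ker A)/gl0_inl.
- exact: LR.
- by rewrite (symr_sym _ _) => /esym/LR.
- by move=> /(s_k0 S)/(a0_ker B)/gl0_inr.
Qed.

(** The bridge between gluing at once and iterated sums. On the trees it asks that leaves be open
    half-edges, a property that can be carried through an induction on [evaluates], which does not
    presuppose [is_tree]. *)
Definition assembly_graft : assembly (trename s (graft s1 u s2 v)) M.
Proof.
apply: (@Assembly Z (trename s (graft s1 u s2 v)) M graft_a0 graft_a1).
- move=> w; case: (s_cov0 S w) => -[w' <-].
    by have [a <-] := a0_onto A w'; exists (inl0 a); exact: graft_a0l.
  by have [a <-] := a0_onto B w'; exists (inr0 a); exact: graft_a0r.
- move=> w; case: (s_cov1 S w) => -[w' <-].
    by have [a <-] := a1_onto A w'; exists (inl1 a); exact: graft_a1l.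
  by have [a <-] := a1_onto B w'; exists (inr1 a); exact: graft_a1r.
- exact: graft_a0_ker.
- exact: graft_a1_ker.
- move=> k a; case: (tot1_case a) => -[a' ->].
    by rewrite graft_a1l (s_d1X S) a_d1 -graft_a0l.
  by rewrite graft_a1r (s_d1Y S) a_d1 -graft_a0r.
- move=> i z.
  change (d2 M i z = graft_a1 (D2 (graft s1 u s2 v) i (graft_leaf s1 s2 (s z)))).
  case E : (s z) => [a|b].
    have h : pX S z != u by rewrite -sX E; exact: valP a.
    by rewrite [graft_leaf _ _ _]/= D2_injl graft_a1l -(a_d2 A) (s_d2X S) // -sX E.
  have h : pY S z != v by rewrite -sY E; exact: valP b.
  by rewrite [graft_leaf _ _ _]/= D2_injr graft_a1r -(a_d2 B) (s_d2Y S) // -sY E.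
Defined.

End GraftAssembly.

(** * Grafting preserves trees *)

Section GraftTree.
Variables (X Y : finType) (s1 : tree X) (u : X) (s2 : tree Y) (v : Y).
Let G := graft s1 u s2 v.

Lemma injl_inj : injective (injl s2 (t1 := s1)).
Proof. exact: (@tot_inl_inj _ _ (@graft_har X Y s1 s2)). Qed.

Lemma injr_inj : injective (injr s1 (t2 := s2)).
Proof. exact: (@tot_inr_inj _ _ (@graft_har X Y s1 s2)). Qed.

Lemma injlr h k : injl s2 (t1 := s1) h <> injr s1 (t2 := s2) k.
Proof. by move/(congr1 tag). Qed.

Hypotheses (T1 : is_tree s1) (T2 : is_tree s2).

Lemma leaf_mate (Z : finType) (t : tree Z) : is_tree t -> forall x, mate (leaf t x) = leaf t x.
Proof. by move=> T x; apply/(tree_leaf T); exists x. Qed.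

(** A retraction of the graft onto one half, collapsing the other half to the node that carries the
    grafting leaf. It sends walks to walks and thereby transfers acyclicity. *)
Definition graft_pl (n : node G) : node s1 :=
  match n with inl n => n | inr _ => tag (leaf s1 u) end.
Definition graft_pr (n : node G) : node s2 :=
  match n with inl _ => tag (leaf s2 v) | inr n => n end.

Lemma graft_linked_l (E : pred (half G)) (E1 : pred (half s1)) n m :
  (forall k, E (injl s2 k) -> k != leaf s1 u -> E1 k) ->
  connect (linked E) n m -> connect (linked E1) (graft_pl n) (graft_pl m).
Proof.
move=> H; apply: connect_mono => {}n {}m /existsP[h /and3P[Eh /eqP<- /eqP<-]].
case: (graft_half h) Eh => -[k ->] Ek; rewrite ?mate_injl ?mate_injr /=.
  case: eqP => [->|/eqP hu] /=; first exact: connect0.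
  by apply/connect1/existsP; exists k; rewrite H // !eqxx.
by case: eqP => _ /=; exact: connect0.
Qed.

Lemma graft_linked_r (E : pred (half G)) (E2 : pred (half s2)) n m :
  (forall k, E (injr s1 k) -> k != leaf s2 v -> E2 k) ->
  connect (linked E) n m -> connect (linked E2) (graft_pr n) (graft_pr m).
Proof.
move=> H; apply: connect_mono => {}n {}m /existsP[h /and3P[Eh /eqP<- /eqP<-]].
case: (graft_half h) Eh => -[k ->] Ek; rewrite ?mate_injl ?mate_injr /=.
  by case: eqP => _ /=; exact: connect0.
case: eqP => [->|/eqP hu] /=; first exact: connect0.
by apply/connect1/existsP; exists k; rewrite H // !eqxx.
Qed.

Lemma graft_is_tree : is_tree G.
Proof.
have ml : mate (t := G) (injl s2 (leaf s1 u)) = injr s1 (leaf s2 v).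
  by rewrite mate_injl eqxx.
have mr : mate (t := G) (injr s1 (leaf s2 v)) = injl s2 (leaf s1 u).
  by rewrite mate_injr eqxx.
have gl : graft_mate u v (injl s2 (leaf s1 u)) = injr s1 (leaf s2 v) by exact: ml.
have gr : graft_mate u v (injr s1 (leaf s2 v)) = injl s2 (leaf s1 u) by exact: mr.
have lf1 := leaf_mate T1; have lf2 := leaf_mate T2.
have Cl a b : connect (linked (t := G) predT) (inl a) (inl b).
  apply: connect_mono (tree_connected T1 a b) => c d /existsP[h /and3P[_ /eqP<- /eqP<-]].
  case: (eqVneq h (leaf s1 u)) => [->|hu]; first by rewrite lf1 connect0.
  apply/connect1/existsP; exists (injl s2 h).
  by rewrite mate_injl (negPf hu) /= !eqxx.
have Cr a b : connect (linked (t := G) predT) (inr a) (inr b).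
  apply: connect_mono (tree_connected T2 a b) => c d /existsP[h /and3P[_ /eqP<- /eqP<-]].
  case: (eqVneq h (leaf s2 v)) => [->|hu]; first by rewrite lf2 connect0.
  apply/connect1/existsP; exists (injr s1 h).
  by rewrite mate_injr (negPf hu) /= !eqxx.
split.
- by case=> n; [exact: (tree_dec T1)|exact: (tree_dec T2)].
- move=> h; case: (graft_half h) => -[k ->].
    rewrite mate_injl; case: eqP => [->|/eqP ku]; first exact: mr.
    rewrite mate_injl; case: eqP => [E|_].
      by case/eqP: ku; rewrite -(tree_mate T1 k) E lf1.
    by rewrite tree_mate.
  rewrite mate_injr; case: eqP => [->|/eqP ku]; first exact: ml.
  rewrite mate_injr; case: eqP => [E|_].
    by case/eqP: ku; rewrite -(tree_mate T2 k) E lf2.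
  by rewrite tree_mate.
- move=> [a|b] [a'|b'] /= E.
  + by congr inl; apply/val_inj/(tree_leaf_inj T1)/injl_inj.
  + by have := injlr E.
  + by have := injlr (esym E).
  + by congr inr; apply/val_inj/(tree_leaf_inj T2)/injr_inj.
- move=> h; case: (graft_half h) => -[k ->].
    rewrite mate_injl; case: eqP => [->|/eqP ku].
      split=> [/esym/injlr//|[[a|b] /= E]]; last by have := injlr (esym E).
      by have /= := valP a; rewrite (tree_leaf_inj T1 (injl_inj E)) eqxx.
    split=> [/injl_inj/(tree_leaf T1)[x xE]|[[a|b] /= E]].
    + have xu : x != u by apply: contraNneq ku => <-; rewrite xE.
      by exists (inl (exist _ x xu)); rewrite /= xE.
    + by rewrite -(injl_inj E) lf1.
    + by have := injlr (esym E).
  rewrite mate_injr; case: eqP => [->|/eqP ku].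
    split=> [/injlr//|[[a|b] /= E]]; first by have := injlr E.
    by have /= := valP b; rewrite (tree_leaf_inj T2 (injr_inj E)) eqxx.
  split=> [/injr_inj/(tree_leaf T2)[x xE]|[[a|b] /= E]].
  + have xu : x != v by apply: contraNneq ku => <-; rewrite xE.
    by exists (inr (exist _ x xu)); rewrite /= xE.
  + by have := injlr E.
  + by rewrite -(injr_inj E) lf2.
- have [n _] := card_gt0P (tree_inhabited T1).
  by apply/card_gt0P; exists (inl n).
- have LR : connect (linked (t := G) predT) (inl (tag (leaf s1 u))) (inr (tag (leaf s2 v))).
    by apply/connect1/existsP; exists (injl s2 (leaf s1 u)); rewrite ml /= !eqxx.
  have RL : connect (linked (t := G) predT) (inr (tag (leaf s2 v))) (inl (tag (leaf s1 u))).
    by apply/connect1/existsP; exists (injr s1 (leaf s2 v)); rewrite mr /= !eqxx.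
  move=> [a|a] [b|b].
  + exact: Cl.
  + exact: connect_trans (Cl _ _) (connect_trans LR (Cr _ _)).
  + exact: connect_trans (Cr _ _) (connect_trans RL (Cl _ _)).
  + exact: Cr.
(* The new edge is a bridge: a walk that avoids it never changes sides. *)
have sep (h : half G) : h = injl s2 (leaf s1 u) \/ h = injr s1 (leaf s2 v) ->
    ~~ connect (linked [pred k | (k != h) && (k != mate h)]) (tag h) (tag (mate h)).
  move=> hE; apply/negP.
  pose side (n : node G) := if n is inl _ then true else false.
  have inv a b : connect (linked [pred k | (k != h) && (k != mate h)]) a b ->
      side a = side b.
    case/connectP=> p; elim: p a => [|c p IH] a /=; first by move=> _ ->.
    case/andP=> /existsP[k /and3P[/andP[kh kh'] /eqP<- /eqP<-]] pp lp.
    rewrite -(IH _ pp lp).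
    have [nl nr] : k != injl s2 (leaf s1 u) /\ k != injr s1 (leaf s2 v).
      by case: hE kh kh' => ->; rewrite ?ml ?mr ?gl ?gr => a1 a2; split.
    case: (graft_half k) nl nr => -[k' ->] nl nr.
      by rewrite mate_injl; case: eqP => // E; move: nl; rewrite E eqxx.
    by rewrite mate_injr; case: eqP => // E; move: nr; rewrite E eqxx.
  by move/inv; case: hE => ->; rewrite ?ml ?mr.
move=> h hm.
case: (graft_half h) => -[k kE]; subst h.
  case: (eqVneq k (leaf s1 u)) => [->|ku]; first by apply: sep; left.
  have mE : mate (t := G) (injl s2 k) = injl s2 (mate k) by rewrite mate_injl (negPf ku).
  move: hm; rewrite mE (inj_eq injl_inj) => km; apply: contra (tree_acyclic T1 km).
  apply: (@graft_linked_l _ _ (inl _) (inl _)) => k' /= /andP[].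
  by rewrite !(inj_eq injl_inj) => -> ->.
case: (eqVneq k (leaf s2 v)) => [->|ku]; first by apply: sep; right.
have mE : mate (t := G) (injr s1 k) = injr s1 (mate k) by rewrite mate_injr (negPf ku).
move: hm; rewrite mE (inj_eq injr_inj) => km; apply: contra (tree_acyclic T2 km).
apply: (@graft_linked_r _ _ (inr _) (inr _)) => k' /= /andP[].
by rewrite !(inj_eq injr_inj) => -> ->.
Qed.

End GraftTree.

Lemma trename_is_tree (X Z : finType) (s : Z -> X) (t : tree X) :
  bijective s -> is_tree t -> is_tree (trename s t).
Proof.
move=> bs [h1 h2 h3 h4 h5 h6 h7]; split=> //.
  by move=> z z' /h3/(bij_inj bs).
move=> h; apply: iff_trans (h4 h) _; split=> -[x <-].
  by have [z <-] := bij_surj bs x; exists z.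
by exists (s x).
Qed.

Lemma corolla_is_tree (X : finType) (G : dcomplex X) : irreducible G -> is_tree (corolla G).
Proof.
move=> iG; split=> //.
- by move=> x y E; exact: (Tagged_inj (T := fun n : node (corolla G) => har n) E).
- by case=> -[] a; split=> // _; exists a.
- by rewrite card_unit.
- by case=> -[]; exact: connect0.
- by move=> h; rewrite eqxx.
Qed.

(** * Cutting a tree along an edge *)

Lemma linked_sym (X : finType) (t : tree X) (E : pred (half t)) :
  involutive (mate (t := t)) -> (forall h, E (mate h) = E h) ->
  connect_sym (linked E).
Proof.
move=> mK EE; apply: sym_connect_sym => n m.
suff H a b : linked E a b -> linked E b a by apply/idP/idP; exact: H.
case/existsP=> h /and3P[Eh ta tb]; apply/existsP; exists (mate h).
by rewrite EE Eh mK ta tb.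
Qed.

Section Branch.
Variables (X : finType) (t : tree X) (h0 : half t).

Definition cutlink : rel (node t) :=
  linked (t := t) [pred k | (k != h0) && (k != mate h0)].

(** The half of the tree that carries [h0], its own node included; by acyclicity the node of
    [mate h0] is not in it. *)
Definition beyond (n : node t) : bool := connect cutlink (tag h0) n.

Definition bnode : finType := {n : node t | beyond n}.
Definition bhar (n : bnode) : finType := har (val n).
Definition bdec (n : bnode) : dcomplex (bhar n) := dec (val n).
Definition bhalf : finType := {n : bnode & bhar n}.

Definition up (h : half t) (p : beyond (tag h)) : bhalf :=
  existT (fun n => bhar n : Type) (exist (fun n => beyond n) (tag h) p) (tagged h).
Definition down (k : bhalf) : half t :=
  existT (fun n => har n : Type) (val (tag k)) (tagged k).

(** The mate of a half-edge of the branch lies outside only for [h0] ([down_out]); the default value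
    [k] turns [h0] into an open half-edge. The [sumbool] supplies the proof that [up] takes. *)
Definition bmate (k : bhalf) : bhalf :=
  match Sumbool.sumbool_of_bool (beyond (tag (mate (down k)))) with
  | left p => up p
  | right _ => k
  end.

(* [None] is the leaf h0 created by cutting. *)
Definition bleafs : finType := option {x : X | beyond (tag (leaf t x))}.

Definition bleaf (x : bleafs) : bhalf :=
  match x with
  | Some x => up (valP x)
  | None => up (connect0 cutlink (tag h0))
  end.

Definition branch : tree bleafs := @Tree bleafs bnode bhar bdec bmate bleaf.

Lemma down_up h (p : beyond (tag h)) : down (up p) = h.
Proof. by case: h p. Qed.

Lemma down_inj : injective down.
Proof.
move=> [[n p] a] [[n' p'] a'] E; have nn : n = n' by exact: (congr1 tag E).
subst n'; have aa : a = a' by exact: (Tagged_inj (T := fun n => har n) E).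
by subst a'; rewrite (bool_irrelevance p p').
Qed.

Lemma beyond_down k : beyond (tag (down k)).
Proof. by case: k => -[n p] a. Qed.

Lemma down_bmate k : down (bmate k) =
  if beyond (tag (mate (down k))) then mate (down k) else down k.
Proof. by rewrite /bmate; case: Sumbool.sumbool_of_bool => p; rewrite ?down_up p. Qed.

Hypotheses (T : is_tree t) (hi : mate h0 != h0).

Lemma beyond_h0 : beyond (tag h0).
Proof. exact: connect0. Qed.

Lemma beyond_mate0 : ~~ beyond (tag (mate h0)).
Proof. exact: tree_acyclic T _ hi. Qed.

Lemma cutlink_sym : connect_sym cutlink.
Proof.
apply: linked_sym; first exact: tree_mate T.
by move=> h; rewrite /= (inv_eq (tree_mate T)) (can_eq (tree_mate T)) andbC.
Qed.

Lemma beyond_mate k : k != h0 -> k != mate h0 ->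
  beyond (tag (mate k)) = beyond (tag k).
Proof.
have H l : l != h0 -> l != mate h0 -> beyond (tag l) -> beyond (tag (mate l)).
  move=> l0 l1 b; apply: connect_trans b _; apply/connect1/existsP; exists l.
  by rewrite /= l0 l1 !eqxx.
move=> k0 k1; apply/idP/idP; last exact: H.
rewrite -{2}(tree_mate T k); apply: H.
  by rewrite (inv_eq (tree_mate T)).
by rewrite (can_eq (tree_mate T)).
Qed.

Lemma down_out k : ~~ beyond (tag (mate (down k))) -> down k = h0.
Proof.
move=> nb; apply/eqP/negPn/negP => k0; have bk := beyond_down k.
case: (eqVneq (down k) (mate h0)) => k1; first by rewrite k1 (negPf beyond_mate0) in bk.
by rewrite beyond_mate ?bk in nb.
Qed.

Lemma branch_is_tree : is_tree branch.
Proof.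
have mK := tree_mate T; have lf := leaf_mate T.
have bmK : involutive bmate.
  move=> k; apply: down_inj; rewrite !down_bmate.
  case b: (beyond (tag (mate (down k)))); last by rewrite b.
  by rewrite mK beyond_down.
split=> //.
- by move=> n; exact: (tree_dec T).
- move=> x y /(congr1 down).
  case: x y => [x|] [y|] //=; rewrite !down_up.
  + by move=> /(tree_leaf_inj T) E; congr Some; exact: val_inj.
  + by move=> E; move: hi; rewrite -E lf eqxx.
  + by move=> E; move: hi; rewrite E lf eqxx.
- move=> k; split=> [E|].
    have : down (bmate k) = down k := congr1 down E.
    rewrite down_bmate; case: ifP => [_|/negbT/down_out {}E _].
      move/(tree_leaf T)=> [x xE]; have b := beyond_down k; rewrite -xE in b.
      exists (Some (exist (fun x => beyond (tag (leaf t x))) x b)).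
      by apply: down_inj; rewrite down_up /= xE.
    by exists None; apply: down_inj; rewrite down_up E.
  case=> -[x|] <-; apply: down_inj; rewrite [LHS]down_bmate down_up.
    by rewrite lf if_same.
  by rewrite (negPf beyond_mate0).
- apply/card_gt0P; exists (exist (fun n => beyond n) _ beyond_h0); by [].
- have step a b (p : beyond a) (q : beyond b) : connect cutlink a b ->
      connect (linked (t := branch) predT) (exist _ a p) (exist _ b q).
    case/connectP=> l; elim: l a p => [|c l IH] a p /=.
      by move=> _ ba; subst b; rewrite (bool_irrelevance p q) connect0.
    case/andP=> ac lc lb.
    have pc : beyond c by apply: connect_trans p _; exact: connect1.
    apply: connect_trans (IH c pc lc lb); apply/connect1/existsP.
    case/existsP: ac => k /and3P[/andP[k0 k1] /eqP ka /eqP kc]; subst a c.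
    exists (up p : half branch); apply/and3P; split=> //.
    apply/eqP/val_inj => /=.
    have := congr1 tag (down_bmate (up p)); rewrite down_up pc => <-.
    by [].
  move=> [n p] [m q]; apply: step; apply: connect_trans q.
  by rewrite cutlink_sym.
move=> k km; have : down (bmate k) != down k by rewrite (inj_eq down_inj).
rewrite down_bmate; case b: (beyond _); last by rewrite eqxx.
move/(tree_acyclic T); apply: contra.
have -> : tag (down k) = val (tag k) by [].
have -> : tag (mate (down k)) = val (tag (mate (t := branch) k)).
  have := down_bmate k; rewrite b => <-; by [].
apply: connect_mono => n m /existsP[l /and3P[/andP[lk lk'] /eqP<- /eqP<-]].
case bl: (beyond (tag (mate (down l)))); last first.
  have -> : mate (t := branch) l = l by apply: down_inj; rewrite down_bmate bl.
  exact: connect0.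
apply/connect1/existsP; exists (down l); rewrite /= eqxx /=.
have dl := down_bmate l; rewrite bl in dl.
have dk := down_bmate k; rewrite b in dk.
rewrite -dl -dk !(inj_eq down_inj) lk; apply/andP; split; first exact: lk'.
exact: eqxx.
Qed.

(** The node of [mate h0] is missing from the branch; this is the measure for all recursions on
    trees. *)
Lemma branch_card : #|node branch| < #|node t|.
Proof.
rewrite card_sig; apply: (leq_trans (n := #|[predD1 node t & tag (mate h0)]|.+1)).
  rewrite ltnS; apply/subset_leq_card/subsetP => n; rewrite !inE => b.
  by rewrite andbT; apply: contraTneq b => ->; exact: beyond_mate0.
by rewrite [X in _ <= X](cardD1 (tag (mate h0))) inE.
Qed.

End Branch.

Section Cut.
Variables (X : finType) (t : tree X) (h : half t).
Hypotheses (T : is_tree t) (hi : mate h != h).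

Let hi' : mate (mate h) != mate h.
Proof. by rewrite (can_eq (tree_mate T)). Qed.

Lemma cutlink_mate : cutlink (mate h) =2 cutlink h.
Proof.
by move=> n m; apply: eq_existsb => k /=; rewrite (tree_mate T) [(k != mate h) && _]andbC.
Qed.

(** Removing one edge from a connected graph leaves at most two components, those of the ends of the
    edge; they are distinct because the edge is a bridge. *)
Lemma beyond_other n : beyond (mate h) n = ~~ beyond h n.
Proof.
have sym := cutlink_sym h T.
have E : beyond (mate h) n = connect (cutlink h) (tag (mate h)) n.
  by rewrite /beyond (eq_connect cutlink_mate).
rewrite E; apply/idP/idP => [b|nb].
  apply: contra (beyond_mate0 T hi) => b'; apply: connect_trans b' _.
  by rewrite sym.
have closed a b : (beyond h a || connect (cutlink h) (tag (mate h)) a) ->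
    connect (linked (t := t) predT) a b ->
    (beyond h b || connect (cutlink h) (tag (mate h)) b).
  move=> + /connectP[p]; elim: p a => [|c p IH] a /=; first by move=> ? _ ->.
  move=> ab /andP[/existsP[k /and3P[_ /eqP ka /eqP kc]] pp lp].
  apply: (IH c _ pp lp); subst a c.
  case: (eqVneq k h) => [->|kh]; first by rewrite connect0 orbT.
  case: (eqVneq k (mate h)) => [->|kh']; first by rewrite (tree_mate T) beyond_h0.
  have st : cutlink h (tag k) (tag (mate k)).
    by apply/existsP; exists k; rewrite /= kh kh' !eqxx.
  case/orP: ab => l; apply/orP; [left|right];
    exact: connect_trans l (connect1 st).
have := closed (tag h) n _ (tree_connected T _ _).
by rewrite beyond_h0 (negPf nb) /= => ->.
Qed.

Definition cut_arity (x : X) : comp_arity (None : bleafs h) (None : bleafs (mate h)) :=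
  match Sumbool.sumbool_of_bool (beyond h (tag (leaf t x))) with
  | left p => inl (exist (fun a : bleafs h => a != None)
      (Some (exist (fun x => beyond h (tag (leaf t x))) x p)) isT)
  | right p => inr (exist (fun a : bleafs (mate h) => a != None)
      (Some (exist (fun x => beyond (mate h) (tag (leaf t x))) x
        (etrans (beyond_other _) (congr1 negb p)))) isT)
  end.

Lemma cut_arity_bij : bijective cut_arity.
Proof.
apply: bij_onto.
  move=> x y; rewrite /cut_arity.
  by case: Sumbool.sumbool_of_bool => p; case: Sumbool.sumbool_of_bool => q // [].
case=> -[[[x p]|] i] //; exists x; rewrite /cut_arity;
  case: Sumbool.sumbool_of_bool => q.
- by congr inl; apply: val_inj; congr Some; exact: val_inj.
- by exfalso; have := p; rewrite q.
- by exfalso; have := p; rewrite beyond_other q.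
- by congr inr; apply: val_inj; congr Some; exact: val_inj.
Qed.

Lemma cut_aritylP x : (sum_pX (cut_arity x) != None) = beyond h (tag (leaf t x)).
Proof. by rewrite /cut_arity; case: Sumbool.sumbool_of_bool => p; apply: esym. Qed.

Let GB := graft (branch h) None (branch (mate h)) None.

Definition cut_n (n : node GB) : node t :=
  match n with inl n => val n | inr n => val n end.
(** The identity in both cases; the match on the node only makes the types agree. The same holds for
    [cut_1] and [cut_0]. *)
Definition cut_h (n : node GB) : har n -> har (cut_n n) :=
  match n return har (t := GB) n -> har (cut_n n) with inl _ => id | inr _ => id end.
Definition cut_1 (n : node GB) : c1 (dec n) -> c1 (dec (cut_n n)) :=
  match n return c1 (dec (t := GB) n) -> c1 (dec (cut_n n)) with
  | inl _ => id | inr _ => id end.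
Definition cut_0 (n : node GB) : c0 (dec n) -> c0 (dec (cut_n n)) :=
  match n return c0 (dec (t := GB) n) -> c0 (dec (cut_n n)) with
  | inl _ => id | inr _ => id end.

Lemma cut_sides (n : bnode h) (m : bnode (mate h)) : val n <> val m.
Proof. by case: n m => [n p] [m q] /= E; subst m; rewrite beyond_other p in q. Qed.

Lemma cut_n_bij : bijective cut_n.
Proof.
apply: bij_onto.
  move=> [n|n] [m|m] /= E; try by case: (cut_sides E) || case: (cut_sides (esym E)).
    by congr inl; exact: val_inj.
  by congr inr; exact: val_inj.
move=> n; case b : (beyond h n); first by exists (inl (exist (fun n => beyond h n) n b)).
have b' : beyond (mate h) n by rewrite beyond_other b.
by exists (inr (exist (fun n => beyond (mate h) n) n b')).
Qed.

Definition cut_half (k : half GB) : half t :=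
  existT (fun n => har n : Type) (cut_n (tag k)) (cut_h (tagged k)).

Lemma cut_mate k : cut_half (mate k) = mate (cut_half k).
Proof.
have cl k' : cut_half (injl (branch (mate h)) k') = down k' by [].
have cr k' : cut_half (injr (branch h) k') = down k' by [].
case: (graft_half k) => -[k' ->].
  rewrite mate_injl cl; case: eqP => [->|/eqP nl]; first by rewrite cr !down_up.
  rewrite cl [LHS]down_bmate; case: ifP => // /negbT/(down_out T hi) E.
  by case/eqP: nl; apply: down_inj; rewrite E down_up.
rewrite mate_injr cr; case: eqP => [->|/eqP nl].
  by rewrite cl !down_up (tree_mate T).
rewrite cr [LHS]down_bmate; case: ifP => // /negbT/(down_out T hi') E.
by case/eqP: nl; apply: down_inj; rewrite E down_up.
Qed.

Definition cut_tiso : tiso (trename cut_arity GB) t.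
Proof.
apply: (@Tiso X (trename cut_arity GB) t cut_n
  cut_half
  (fun a => existT (fun n => c1 (dec n) : Type) (cut_n (tag a)) (cut_1 (tagged a)))
  (fun a => existT (fun n => c0 (dec n) : Type) (cut_n (tag a)) (cut_0 (tagged a)))) => //.
- exact: cut_n_bij.
- apply: (sig_bij (A := har (t := GB)) (B := har (t := t)) (g := cut_h)).
    exact: cut_n_bij.
  by case=> n; exists id.
- apply: (sig_bij (A := fun n : node GB => c1 (dec n))
    (B := fun n : node t => c1 (dec n)) (g := cut_1)).
    exact: cut_n_bij.
  by case=> n; exists id.
- apply: (sig_bij (A := fun n : node GB => c0 (dec n))
    (B := fun n : node t => c0 (dec n)) (g := cut_0)).
    exact: cut_n_bij.
  by case=> n; exists id.
- by move=> i [[n|n] a].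
- by move=> k [[n|n] a].
- exact: cut_mate.
- move=> x.
  change (cut_half (graft_leaf (branch h) (branch (mate h)) (cut_arity x)) = leaf t x).
  by rewrite /cut_arity; case: Sumbool.sumbool_of_bool => p; exact: down_up.
Defined.

Lemma cut_tiso_h : th cut_tiso (injl (branch (mate h)) (leaf (branch h) None)) = h.
Proof. exact: down_up. Qed.

End Cut.

(** * Renaming and transporting cut-triangles *)

Section CutRen.
Variables (X Z : finType) (s : Z -> X) (K : dcomplex X).
Hypothesis bs : bijective s.

Lemma tau_ren (T : {set c1 K}) a b :
  tau (K := crename s K) T a b = tau T (s a) (s b).
Proof.
apply/tauP/tauP => -[w h1 h2].
  by exists (s w) => //; apply: connect_mono h2 => x y h; exact: connect1.
have [w' wE] := bij_surj bs w; subst w; exists w' => //.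
case/(connect_lift (q := shares (K := crename s K) T)): h2 => [z c|c].
  by have [b' <-] := bij_surj bs c => h; exists b' => //; exact: connect1.
by move/(bij_inj bs) => ->.
Qed.

Lemma cut_ren (T : {set c1 K}) : cut_triangle (K := crename s K) T <-> cut_triangle T.
Proof.
split=> /cutP[tT [A [[a aA] [b bA] tE]]]; apply/cutP; split=> //.
  have sA z : (s z \in [set s z | z in A]) = (z \in A).
    by rewrite mem_imset //; exact: bij_inj.
  exists [set s z | z in A]; split.
  - by exists (s a); rewrite sA.
  - by exists (s b); rewrite sA.
  move=> u v; have [u' <-] := bij_surj bs u; have [v' <-] := bij_surj bs v.
  by rewrite -tau_ren tE !sA.
have [a' aE] := bij_surj bs a; have [b' bE] := bij_surj bs b; subst a b.
exists [set z | s z \in A]; split.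
- by exists a'; rewrite inE.
- by exists b'; rewrite inE.
by move=> u v; rewrite tau_ren tE !inE.
Qed.

Lemma disjoint_ren (T T' : {set c1 K}) : cut_triangle T ->
  disjoint_triangles T' T -> disjoint_triangles (K := crename s K) T' T.
Proof.
case/cutP=> _ [A [[a aA] [b bA] tE]].
have A0 : exists u, u \in A by exists a.
have A1 : exists u, u \notin A by exists b.
have [a' aE] := bij_surj bs a; have [b' bE] := bij_surj bs b; subst a b.
have B0 : exists u, u \in [set z | s z \in A] by exists a'; rewrite inE.
have B1 : exists u, u \notin [set z | s z \in A] by exists b'; rewrite inE.
have tB u v : tau (K := crename s K) T u v =
    ((u \in [set z | s z \in A]) == (v \in [set z | s z \in A])).
  by rewrite tau_ren tE !inE.
move/(disjointP _ A0 A1 tE) => D; apply/(disjointP _ B0 B1 tB).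
case: D => /subsetP D; [left|right]; apply/subsetP => e /D/side_edgesP[u uA eu];
  have [z zE] := bij_surj bs u; subst u; apply/side_edgesP; exists z => //;
  by move: uA; rewrite !inE.
Qed.

End CutRen.

Lemma cut_iso (X : finType) (K L : dcomplex X) f0 f1 (T : {set c1 K}) :
  @is_lt2iso X K L f0 f1 -> m_complex K -> cut_triangle T -> cut_triangle (f1 @: T).
Proof.
move=> F MK; have ML : m_complex L by apply: m_complex_iso MK; exists f0, f1.
have fK := cc_faces1 (m_complex_closed MK); have fL := cc_faces1 (m_complex_closed ML).
have i1 := iso_inj1 F; have [_ b1 h1 h2] := F.
case/cutP=> tT [A [A0 A1 tE]]; apply/cutP; split.
  have [e [v [-> H]]] := (triangleP fK T).1 tT; apply/(triangleP fL).
  exists (f1 \o e), (f0 \o v); split; first by rewrite -imset_comp.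
  by move=> i k /=; rewrite -h1 H.
exists A; split=> // u v; rewrite -tE.
have eE e z : edge_of (f1 e) z = edge_of e z.
  apply/edge_ofP/edge_ofP => -[i]; first by rewrite -h2 => /i1 <-; exists i.
  by move<-; exists i.
have sE : shares (f1 @: T) =2 shares T.
  move=> a b; apply/sharesP/sharesP => -[e [eT ea eb]].
    have [e' e'E] := bij_surj b1 e; subst e; exists e'; rewrite -!eE; split=> //.
    by apply: contra eT; exact: imset_f.
  by exists (f1 e); rewrite !eE mem_imset.
by apply: eq_existsb => w; rewrite sE (eq_connect sE).
Qed.

Lemma irreducible_ren (X Z : finType) (s : Z -> X) (K : dcomplex X) :
  bijective s -> irreducible K -> irreducible (crename s K).
Proof.
move=> bs [MK pK iK]; split; first exact: m_complex_ren.
  apply: (not_unit_card (m_complex_ren bs MK)).2.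
  by rewrite (bij_eq_card bs); exact: (not_unit_card MK).1.
by move=> T /(cut_ren bs); exact: iK.
Qed.

Lemma irreducible_iso (X : finType) (K L : dcomplex X) :
  lt2iso K L -> irreducible L -> irreducible K.
Proof.
move=> KL [ML pL iL]; have MK := m_complex_iso (lt2iso_sym KL) ML; split=> //.
  by apply: (not_unit_card MK).2; exact: (not_unit_card ML).1.
by case: KL => f0 [f1 F] T /(cut_iso F MK) /iL.
Qed.

(** * The complex of a tree *)

(** Without edges connectedness leaves a single node, and [leaf] is a bijection onto its half-edges,
    along which the decoration is renamed. *)
Lemma tree_corolla (X : finType) (t : tree X) : is_tree t ->
  (forall h, mate (t := t) h = h) ->
  exists2 G, irreducible G & inhabited (tiso (corolla G) t).
Proof.
move=> T fix_; have [n0 _] := card_gt0P (tree_inhabited T).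
have n1 n : n = n0.
  case/connectP: (tree_connected T n0 n) => p; elim: p (n0) => [|a p IH] m //=.
  by case/andP=> /existsP[h /and3P[_ /eqP<- /eqP<-]]; rewrite fix_; exact: IH.
have : forall x, exists a, leaf t x = existT (fun n => har n : Type) n0 a.
  move=> x; case: (leaf t x) => n a; move: a; rewrite (n1 n) => a.
  by exists a.
case/fin_all_exists=> g gE.
have bg : bijective g.
  apply: bij_onto => [x y E|a].
    by apply: (tree_leaf_inj T); rewrite !gE E.
  have [x xE] := (tree_leaf T (existT (fun n => har n : Type) n0 a)).1 (fix_ _).
  by exists x; apply: (Tagged_inj (T := fun n => har n)); rewrite -gE.
exists (crename g (dec n0)); first by apply: irreducible_ren bg (tree_dec T _).
constructor.
have tot (A : node t -> finType) : bijective (fun x : {n : unit & A n0} =>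
    existT (fun n => A n : Type) n0 (tagged x)).
  apply: bij_onto => [[[] a] [[] b] /= E|[n a]]; first by rewrite (Tagged_inj E).
  by move: a; rewrite (n1 n) => a; exists (existT _ tt a).
apply: (@Tiso X (corolla (crename g (dec n0))) t (fun _ => n0)
  (fun h => leaf t (tagged h))
  (fun a => existT (fun n => c1 (dec n) : Type) n0 (tagged a))
  (fun a => existT (fun n => c0 (dec n) : Type) n0 (tagged a))) => //.
- apply: bij_onto => [[] []|n]; last by exists tt; rewrite (n1 n).
  by [].
- apply: bij_onto => [[[] x] [[] y] /= /(tree_leaf_inj T) ->|h] //.
  by have [x xE] := (tree_leaf T h).1 (fix_ _); exists (existT _ tt x).
- exact: (tot (fun n => c1 (dec n))).
- exact: (tot (fun n => c0 (dec n))).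
- by move=> i [[] x] /=; rewrite gE.
Qed.

(** * Reading a sum off a grafted tree *)

Section Merge.
Variables (X X1 X2 : finType) (t : tree X) (t1 : tree X1) (u : X1) (t2 : tree X2)
  (v : X2) (s : X -> comp_arity u v).
Hypotheses (T1 : is_tree t1) (T2 : is_tree t2) (bs : bijective s).
Variable F : tiso (trename s (graft t1 u t2 v)) t.
Hypotheses (H1 : closed_complex (glued t1)) (H2 : closed_complex (glued t2)).

(** The connected sum and [K] are assembled along the same tree, hence isomorphic. The last two
    clauses follow the 1-cells, so that triangles of the branches can be located in [K]. *)
Lemma merge_summing (K : dcomplex X) (A : assembly t K) :
  exists S : summing (glued t1) u (glued t2) v K,
  [/\ forall z, sum_pX (s z) = pX S z, forall z, sum_pY (s z) = pY S z,
      forall a, a1 A (te F (inl1 u t2 v a)) = j1 S (class_of _ a)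
    & forall a, a1 A (te F (inr1 t1 u v a)) = k1 S (class_of _ a)].
Proof.
pose S0 := summing_to bs (is_lt2iso_id _) (csum_summing u v H1 H2).
have sX z : sum_pX (s z) = pX S0 z by [].
have sY z : sum_pY (s z) = pY S0 z by [].
pose B := assembly_graft (leaf_mate T1) (leaf_mate T2)
  (glued_assembly t1) (glued_assembly t2) sX sY.
have [f0 [f1 [I E]]] := assembly_uniq B (assembly_tiso F A).
exists (summing_to bs I (csum_summing u v H1 H2)); split=> //.
  move=> a; rewrite -[LHS]/(a1 (assembly_tiso F A) (inl1 u t2 v a)) -E.
  by congr f1; exact: (graft_a1l (glued_assembly t1) (glued_assembly t2) S0 a).
move=> a; rewrite -[LHS]/(a1 (assembly_tiso F A) (inr1 t1 u v a)) -E.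
by congr f1; exact: (graft_a1r (glued_assembly t1) (glued_assembly t2) S0 a).
Qed.

Lemma internal_injl h : mate h != h -> mate (th F (injl t2 h)) != th F (injl t2 h).
Proof.
move=> hi; rewrite -th_mate (inj_eq (bij_inj (th_bij F))).
have := mate_injl u t2 v h; case: eqP => [E|_ mE].
  by rewrite E (leaf_mate T1) eqxx in hi.
change (mate (t := graft t1 u t2 v) (injl t2 h) != injl t2 h).
by rewrite mE (inj_eq (@injl_inj _ _ _ _)).
Qed.

Lemma internal_injr h : mate h != h -> mate (th F (injr t1 h)) != th F (injr t1 h).
Proof.
move=> hi; rewrite -th_mate (inj_eq (bij_inj (th_bij F))).
have := mate_injr t1 u v h; case: eqP => [E|_ mE].
  by rewrite E (leaf_mate T2) eqxx in hi.
change (mate (t := graft t1 u t2 v) (injr t1 h) != injr t1 h).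
by rewrite mE (inj_eq (@injr_inj _ _ _ _)).
Qed.

End Merge.

Lemma comp_arity_card (X Y : finType) (x : X) (y : Y) :
  2 < #|X| -> 2 < #|Y| -> 2 < #|{: comp_arity x y}|.
Proof.
move=> X3 Y3; rewrite card_sum !card_sig.
have -> : #|[pred a | a != x]| = #|X|.-1 by rewrite -(cardC1 x); apply: eq_card.
have -> : #|[pred b | b != y]| = #|Y|.-1 by rewrite -(cardC1 y); apply: eq_card.
by lia.
Qed.

(** Irreducible complexes have more than two 2-cells, and this is preserved by sums. The count must
    go through the induction together with the first claim, since later arguments on sums depend on
    it. *)
Lemma tree_proper (X : finType) (t : tree X) : is_tree t ->
  m_complex (glued t) /\ 2 < #|X|.
Proof.
have [n] := ubnP #|node t|; elim: n X t => // n IH X t tn T.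
case: (pickP (fun h : half t => mate h != h)) => [h hi|fix_]; last first.
  have [|G [MG pG _] [F]] := tree_corolla T.
    by move=> h; have := fix_ h; move/negbFE/eqP.
  split; last exact: (not_unit_card MG).1.
  have [F'] := tiso_sym F.
  apply: m_complex_iso MG.
  by apply: lt2iso_sym; exact: lt2iso_assembly (assembly_tiso F' (assembly_corolla G)).
have hi' : mate (mate h) != mate h by rewrite (can_eq (tree_mate T)).
have T1 := branch_is_tree T hi; have T2 := branch_is_tree T hi'.
have [M1 X1] := IH _ _ (leq_trans (branch_card T hi) tn) T1.
have [M2 X2] := IH _ _ (leq_trans (branch_card T hi') tn) T2.
have bs := cut_arity_bij T hi.
have [S _] := merge_summing T1 T2 bs (cut_tiso T hi) (m_complex_closed M1)
  (m_complex_closed M2) (glued_assembly t).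
split; first exact: sum_m_complex S M1 M2.
by rewrite (bij_eq_card bs); exact: comp_arity_card.
Qed.

(** The induction step of the later arguments on trees. Besides the two branches it gives the
    partition of the leaves, the triangle of the edge that is cut, and the place in [K] of every
    triangle of a branch. *)
Lemma tree_cut (X : finType) (t : tree X) (K : dcomplex X) (A : assembly t K)
    (h : half t) : is_tree t -> mate h != h ->
  exists (X1 X2 : finType) (u : X1) (v : X2) (t1 : tree X1) (t2 : tree X2)
    (s : X -> comp_arity u v) (S : summing (glued t1) u (glued t2) v K),
  [/\ [/\ is_tree t1, is_tree t2, #|node t1| < #|node t|, #|node t2| < #|node t|
       & bijective s],
      inhabited (tiso (trename s (graft t1 u t2 v)) t),
      (forall z, sum_pX (s z) = pX S z) /\ (forall z, sum_pY (s z) = pY S z),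
      forall z, (pX S z != u) = beyond h (tag (leaf t z))
    & [/\ tri A h = j1 S @: rim (glued t1) u,
       forall h1, mate h1 != h1 -> exists2 h', mate h' != h' &
         tri A h' = j1 S @: tri (glued_assembly t1) h1
     & forall h2, mate h2 != h2 -> exists2 h', mate h' != h' &
         tri A h' = k1 S @: tri (glued_assembly t2) h2]].
Proof.
move=> T hi.
have hi' : mate (mate h) != mate h by rewrite (can_eq (tree_mate T)).
have T1 := branch_is_tree T hi; have T2 := branch_is_tree T hi'.
have [M1 _] := tree_proper T1; have [M2 _] := tree_proper T2.
have bs := cut_arity_bij T hi; pose F := cut_tiso T hi.
have [S [sX sY EX EY]] := merge_summing T1 T2 bs F (m_complex_closed M1)
  (m_complex_closed M2) A.
have tX h1 : tri A (th F (injl (branch (mate h)) h1)) = j1 S @: tri (glued_assembly (branch h)) h1.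
  rewrite /tri -imset_comp; apply: eq_imset => i /=.
  rewrite -EX; congr (a1 A _); exact: esym (te_D2 F i (injl (branch (mate h)) h1)).
have tY h2 : tri A (th F (injr (branch h) h2)) = k1 S @: tri (glued_assembly (branch (mate h))) h2.
  rewrite /tri -imset_comp; apply: eq_imset => i /=.
  rewrite -EY; congr (a1 A _); exact: esym (te_D2 F i (injr (branch h) h2)).
exists _, _, None, None, (branch h), (branch (mate h)), (cut_arity T hi), S.
have c1 := branch_card T hi; have c2 := branch_card T hi'.
split=> //.
  by move=> z; rewrite -sX (cut_aritylP T hi z).
split.
- by rewrite -{1}(cut_tiso_h T hi) -/F tX.
- move=> h1 h1i; exists (th F (injl (branch (mate h)) h1)) => //.
  exact: internal_injl.
move=> h2 h2i; exists (th F (injr (branch h) h2)) => //.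
exact: internal_injr.
Qed.

Lemma tri_cut (X : finType) (t : tree X) (K : dcomplex X) (A : assembly t K) h :
  is_tree t -> mate h != h -> cut_triangle (tri A h).
Proof.
move=> T hi.
have [X1 [X2 [u [v [t1 [t2 [s [S [[T1 T2 _ _ _] _ _ _ [-> _ _]]]]]]]]]] := tree_cut A T hi.
have [M1 c1] := tree_proper T1; have [M2 c2] := tree_proper T2.
exact: cut_glued.
Qed.

Lemma tree_m (X : finType) (t : tree X) (K : dcomplex X) (A : assembly t K) :
  is_tree t -> m_complex K.
Proof. by case/tree_proper=> M _; exact: m_complex_iso (lt2iso_assembly A) M. Qed.

(** * Evaluation *)

(** As [is_tree] is not assumed, the facts about leaves on which [assembly_graft] relies are proved
    along the same induction. *)
Lemma evaluates_glued (X : finType) (t : tree X) (K : dcomplex X) :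
  evaluates t K -> [/\ lt2iso (glued t) K, m_complex K, 2 < #|X|,
    forall x, mate (leaf t x) = leaf t x & injective (leaf t)].
Proof.
elim=> {X t K} [Z t K G iG tG KG|
  Z t K X Y u v s t1 t2 K1 K2 bs _ [I1 M1 X3 lf1 li1] _ [I2 M2 Y3 lf2 li2] tI KI].
  have [MG pG _] := iG; have [F] := tree_iso_tiso tG.
  split.
  - apply: lt2iso_trans (lt2iso_sym KG).
    exact: lt2iso_assembly (assembly_tiso F (assembly_corolla G)).
  - exact: m_complex_iso (lt2iso_sym KG) MG.
  - exact: (not_unit_card MG).1.
  - by move=> x; apply: (bij_inj (th_bij F)); rewrite th_mate th_leaf.
  move=> x y /(congr1 (th F)); rewrite !th_leaf.
  exact: (Tagged_inj (T := fun n : node (corolla G) => har n)).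
have [F] := tree_iso_tiso tI.
have [[f0 [f1 E1]] [g0 [g1 E2]]] := (I1, I2).
have H1 := m_complex_closed M1; have H2 := m_complex_closed M2.
pose S := summing_to bs (is_lt2iso_id _) (csum_summing u v H1 H2).
pose B := assembly_graft (s := s) lf1 lf2 (assembly_to E1 (glued_assembly t1))
   (assembly_to E2 (glued_assembly t2)) (S := S) (fun _ => erefl) (fun _ => erefl).
split.
- apply: lt2iso_trans (lt2iso_sym KI).
  exact: lt2iso_assembly (assembly_tiso F B).
- apply: m_complex_iso (lt2iso_sym KI) _.
  exact: sum_m_complex S M1 M2.
- by rewrite (bij_eq_card bs); exact: comp_arity_card.
- move=> x; apply: (bij_inj (th_bij F)); rewrite th_mate th_leaf.
  change (mate (t := graft t1 u t2 v) (graft_leaf t1 t2 (s x)) = graft_leaf t1 t2 (s x)).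
  case: (s x) => -[a au]; rewrite [graft_leaf _ _ _]/=.
    by rewrite mate_injl (inj_eq li1) (negPf au) lf1.
  by rewrite mate_injr (inj_eq li2) (negPf au) lf2.
move=> x y /(congr1 (th F)); rewrite !th_leaf => E; apply: (bij_inj bs).
have {E} : graft_leaf t1 t2 (s x) = graft_leaf t1 t2 (s y) := E.
case: (s x) (s y) => [a|a] [b|b] /= E.
- by congr inl; apply: val_inj; apply: li1; exact: injl_inj E.
- by have := injlr E.
- by have := injlr (esym E).
- by congr inr; apply: val_inj; apply: li2; exact: injr_inj E.
Qed.

Lemma evaluates_iso (X : finType) (t : tree X) (K L : dcomplex X) :
  lt2iso L K -> evaluates t K -> evaluates t L.
Proof.
move=> LK; case=> [G iG tG KG|Y Y' u v s t1 t2 K1 K2 bs e1 e2 tI KI].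
  by apply: EvCorolla iG tG _; exact: lt2iso_trans LK KG.
by apply: EvGraft bs e1 e2 tI _; exact: lt2iso_trans LK KI.
Qed.

Lemma glued_evaluates (X : finType) (t : tree X) : is_tree t -> evaluates t (glued t).
Proof.
have [n] := ubnP #|node t|; elim: n X t => // n IH X t tn T.
case: (pickP (fun h : half t => mate h != h)) => [h hi|fix_]; last first.
  have [|G iG [F]] := tree_corolla T.
    by move=> h; have := fix_ h; move/negbFE/eqP.
  have [F'] := tiso_sym F.
  apply: EvCorolla iG (tiso_tree_iso F') _.
  exact: lt2iso_assembly (assembly_tiso F' (assembly_corolla G)).
have [X1 [X2 [u [v [t1 [t2 [s [S [[T1 T2 c1 c2 bs] [F] [sX sY] _ _]]]]]]]]] :=
  tree_cut (glued_assembly t) T hi.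
have [F'] := tiso_sym F.
have [M1 _] := tree_proper T1; have [M2 _] := tree_proper T2.
have e1 := IH _ _ (leq_trans c1 tn) T1; have e2 := IH _ _ (leq_trans c2 tn) T2.
apply: (EvGraft bs e1 e2 (tiso_tree_iso F')); apply: lt2iso_sym.
have [p0 [p1 [I _]]] := summing_csum (m_complex_closed M1) (m_complex_closed M2) bs sX sY.
by exists p0, p1.
Qed.

(** * Uniqueness of the tree *)

(** Here the reflexivity required of [tau] acts: to be related to itself in at least one step, a
    2-cell must have an edge outside [T]. *)
Lemma cut_free (X : finType) (K : dcomplex X) (T : {set c1 K}) x :
  cut_triangle T -> exists l, d2 K l x \notin T.
Proof.
case=> _ [rT _ _] _; have /tauP[w /sharesP[e [eT /edge_ofP[l lE] _]] _] := rT x.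
by exists l; rewrite lE.
Qed.

(** Both sets have three edges, so an inclusion would be an equality. *)
Lemma triangle_free (X : finType) (K : dcomplex X) (T : {set c1 K}) x :
  closed_complex K -> triangle T -> T <> rim K x -> exists l, d2 K l x \notin T.
Proof.
move=> HK /(triangleP (cc_faces1 HK))[e [v [TE H]]] ne; apply: NNPP => nl.
case: ne; apply/esym/eqP; rewrite eqEcard; apply/andP; split.
  apply/subsetP => a /imsetP[l _ ->]; apply/negPn/negP => h; case: nl.
  by exists l.
rewrite TE !card_imset //; first exact: (d2_inj HK).
by move=> i j /(tri_einj (cc_faces1 HK) H).
Qed.

(** Going down to a branch requires an edge of [u] outside the triangle considered. For [T'] it
    comes from [T'] not being the triangle of [u], for the triangles of the branch from
    [cut_free]. *)
Lemma cut_descend (X X1 X2 : finType) (t : tree X) (K : dcomplex X)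
    (A : assembly t K) (u : X1) (v : X2) (t1 : tree X1) (L : dcomplex X2)
    (S : summing (glued t1) u L v K) (T' : {set c1 (glued t1)}) :
  is_tree t1 -> m_complex L -> 2 < #|X2| ->
  (forall h1, mate h1 != h1 -> exists2 h', mate h' != h' &
     tri A h' = j1 S @: tri (glued_assembly t1) h1) ->
  cut_triangle (j1 S @: T') -> j1 S @: T' <> j1 S @: rim (glued t1) u ->
  (forall h, mate h != h -> disjoint_triangles (j1 S @: T') (tri A h)) ->
  cut_triangle T' /\
  forall h1, mate h1 != h1 -> disjoint_triangles T' (tri (glued_assembly t1) h1).
Proof.
move=> T1 ML X3 sub cT ne D; have [M1 _] := tree_proper T1.
have [tT _ _] := cT.
have nT : T' <> rim (glued t1) u by move=> E; apply: ne; rewrite E.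
have [l lT] := triangle_free (m_complex_closed M1) ((tri_jX S M1 ML T').1 tT) nT.
split; first exact: cut_jX lT cT.
move=> h1 hi; have ct := tri_cut (glued_assembly t1) T1 hi.
have [l' lT'] := cut_free u ct; have [h' h'i E] := sub h1 hi.
by apply: (disjoint_jX (S := S) ML X3 lT' ct); rewrite -E; exact: D.
Qed.

Lemma cut_iso_irreducible (X : finType) (t : tree X) (K : dcomplex X)
    (A : assembly t K) : is_tree t -> (forall h, mate (t := t) h = h) ->
  exists2 G, irreducible G & inhabited (tiso (corolla G) t) /\ lt2iso G K.
Proof.
move=> T fix_; have [G iG [F]] := tree_corolla T fix_; exists G => //.
split; first by constructor.
apply: lt2iso_trans (lt2iso_assembly A); apply: lt2iso_sym.
have [F'] := tiso_sym F.
exact: lt2iso_assembly (assembly_tiso F' (assembly_corolla G)).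
Qed.

Lemma cut_found (X : finType) (t : tree X) (K : dcomplex X) (A : assembly t K)
    (T : {set c1 K}) : is_tree t -> cut_triangle T ->
  (forall h, mate h != h -> disjoint_triangles T (tri A h)) ->
  exists2 h, mate h != h & T = tri A h.
Proof.
have [n] := ubnP #|node t|; elim: n X t K A T => // n IH X t K A T tn isT cT D.
case: (pickP (fun h : half t => mate h != h)) => [h hi|fix_]; last first.
  have fx h : mate (t := t) h = h by have := fix_ h; move/negbFE/eqP.
  have [G iG [_ GK]] := cut_iso_irreducible A isT fx.
  have [_ _ iK] := irreducible_iso (lt2iso_sym GK) iG.
  by case: (iK T).
have [X1 [X2 [u [v [t1 [t2 [s [S [[T1 T2 c1 c2 bs] _ _ _ [hE sub1 sub2]]]]]]]]]] :=
  tree_cut A isT hi.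
have [M1 c3] := tree_proper T1; have [M2 c4] := tree_proper T2.
case: (eqVneq T (tri A h)) => [->|Th]; first by exists h.
have := D h hi; rewrite hE => /(disjoint_glued M1 M2 c3 c4)[] [T' TE]; subst T.
  have [|cT' D'] := cut_descend T1 M2 c4 sub1 cT _ D.
    by move=> E; rewrite E hE eqxx in Th.
  have [h1 h1i ->] := IH _ _ _ _ _ (leq_trans c1 tn) T1 cT' D'.
  by have [h' h'i <-] := sub1 _ h1i; exists h'.
have [|cT' D'] := cut_descend (S := swap S) T2 M1 c3 sub2 cT _ D.
  by move=> E; case/eqP: Th; rewrite hE [LHS]E; exact: (swap_rim S).
have [h1 h1i ->] := IH _ _ _ _ _ (leq_trans c2 tn) T2 cT' D'.
by have [h' h'i <-] := sub2 _ h1i; exists h'.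
Qed.

(** A sum determines its summand up to isomorphism from the 2-cells of that side and the glued
    triangle, as everything but the cell [x] is visible in [M]. *)
Lemma side_iso (Z X Y X' Y' : finType) (M : dcomplex Z) (K : dcomplex X) (x : X)
    (L : dcomplex Y) (y : Y) (K' : dcomplex X') (x' : X') (L' : dcomplex Y') (y' : Y')
    (S : summing K x L y M) (S' : summing K' x' L' y' M) :
  m_complex K -> m_complex L -> m_complex K' -> m_complex L' ->
  (forall z, (pX S z == x) = (pX S' z == x')) ->
  j1 S @: rim K x = j1 S' @: rim K' x' ->
  exists s f0 f1, [/\ bijective s, forall z, s (pX S z) = pX S' z,
    is_lt2iso (K := K) (L := crename s K') f0 f1 & forall e, j1 S' (f1 e) = j1 S e].
Proof.
move=> MK ML MK' ML' side rimE.
have HK := m_complex_closed MK; have HK' := m_complex_closed MK'.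
have HM := m_complex_closed (sum_m_complex S MK ML).
have [s bs sE] : exists2 s : X -> X', bijective s & forall z, s (pX S z) = pX S' z.
  apply: same_kernel_bij; [exact: pX_onto ML|exact: pX_onto ML'|move=> z z'].
  case: (eqVneq (pX S z) x) => zx.
    have z'x : pX S' z = x' by apply/eqP; rewrite -side zx.
    by rewrite zx z'x; split=> E; apply/esym/eqP; [rewrite -side|rewrite side]; rewrite -E.
  have zx' : pX S' z != x' by rewrite -side.
  split=> E; first by rewrite (s_injX S E zx).
  by rewrite (s_injX S' E zx').
have sx : s x = x'.
  have [z zx] := pX_onto S ML x.
  by rewrite -zx sE; apply/eqP; rewrite -side zx.
(* The edges of a summand are those of the 2-cells on its side, because even an edge of [w] has a
   second cell. *)
have im1 (W W' V : finType) (N : dcomplex W) (w : W) (P : dcomplex W') (w' : W')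
    (Q : dcomplex V) (R : summing N w P w' Q) : closed_complex N -> forall e,
    (exists e', j1 R e' = e) <-> exists2 z, pX R z != w & edge_of e z.
  move=> HN e; split=> [[e' <-]|[z zw /edge_ofP[i <-]]].
    have [a aw ea] := other_not HN e' w; have [z zE] := s_ontoX R aw; subst a.
    by exists z; rewrite ?edge_jX.
  by exists (d2 N i (pX R z)); rewrite (s_d2X R).
have im0 (W W' V : finType) (N : dcomplex W) (w : W) (P : dcomplex W') (w' : W')
    (Q : dcomplex V) (R : summing N w P w' Q) : closed_complex N -> forall a,
    (exists a', j0 R a' = a) <-> exists2 z, pX R z != w & vertex_of a z.
  move=> HN a; split=> [[a' <-]|[z zw /vertex_ofP[j <-]]].
    have [e we] := cc_end HN a'.
    have [b bw eb] := other_not HN e w; have [z zE] := s_ontoX R bw; subst b.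
    by exists z; rewrite ?vertex_jX // (vertex_of_end eb we).
  by exists (vtx N j (pX R z)); rewrite -vtx_jX.
have [f1 b1 f1E] : exists2 f : c1 K -> c1 K', bijective f & forall e, j1 S' (f e) = j1 S e.
  apply: same_image_bij; [exact: (s_j1 S)|exact: (s_j1 S')|].
  move=> e; rewrite (im1 _ _ _ _ _ _ _ _ S HK) (im1 _ _ _ _ _ _ _ _ S' HK').
  by split=> -[z zx ez]; exists z => //; [rewrite -side|rewrite side].
have [f0 b0 f0E] : exists2 f : c0 K -> c0 K', bijective f & forall e, j0 S' (f e) = j0 S e.
  apply: same_image_bij; [exact: (s_j0 S)|exact: (s_j0 S')|].
  move=> e; rewrite (im0 _ _ _ _ _ _ _ _ S HK) (im0 _ _ _ _ _ _ _ _ S' HK').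
  by split=> -[z zx ez]; exists z => //; [rewrite -side|rewrite side].
exists s, f0, f1; split=> //; split=> // [k e|i a].
  by apply: (s_j0 S'); rewrite f0E -!(s_d1X S) -(s_d1X S') f1E.
apply: (s_j1 S'); rewrite f1E /=; case: (eqVneq a x) => [->|ax].
  rewrite sx.
  (* The numbering of the faces of [x] is not visible in [M]; [tri_uniq] recovers it from the glued
     triangle as a set. *)
  have tS : tri_verts (fun i => j1 S (d2 K i x)) (fun j => j0 S (vtx K j x)).
    by move=> l k; rewrite (s_d1X S) d1_d2.
  have tS' : tri_verts (fun i => j1 S' (d2 K' i x')) (fun j => j0 S' (vtx K' j x')).
    by move=> l k; rewrite (s_d1X S') d1_d2.
  apply: (tri_uniq (cc_faces1 HM) tS tS').
  by move: rimE; rewrite /rim -!imset_comp.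
have [z zE] := s_ontoX S ax; subst a.
by rewrite sE -(s_d2X S) // (s_d2X S') // -side.
Qed.

(** * Grafts of isomorphic trees *)

Section TisoGraft.
Variables (Z X Y X' Y' : finType) (t1 : tree X) (u : X) (t2 : tree Y) (v : Y)
  (t1' : tree X') (u' : X') (t2' : tree Y') (v' : Y')
  (s : Z -> comp_arity u v) (s' : Z -> comp_arity u' v')
  (sx : X -> X') (sy : Y -> Y').
Hypothesis bsy : bijective sy.
Hypotheses (uE : sx u = u') (vE : sy v = v')
  (sX : forall z, sx (sum_pX (s z)) = sum_pX (s' z))
  (sY : forall z, sy (sum_pY (s z)) = sum_pY (s' z)).
Variables (F1 : tiso t1 (trename sx t1')) (F2 : tiso t2 (trename sy t2')).

Let G := graft t1 u t2 v.
Let G' := graft t1' u' t2' v'.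

Let gn (n : node G) : node G' :=
  match n with inl n => inl (tn F1 n) | inr n => inr (tn F2 n) end.

Let gh : half G -> half G' :=
  tot_sum (A := har (t := G)) (B := har (t := G')) (th F1) (th F2).
Let g1 : tot1 G -> tot1 G' :=
  tot_sum (A := fun n : node G => c1 (dec n)) (B := fun n : node G' => c1 (dec n))
    (te F1) (te F2).
Let g0 : tot0 G -> tot0 G' :=
  tot_sum (A := fun n : node G => c0 (dec n)) (B := fun n : node G' => c0 (dec n))
    (tv F1) (tv F2).

Let ghl k : gh (injl t2 k) = injl t2' (th F1 k). Proof. by case: k. Qed.
Let ghr k : gh (injr t1 k) = injr t1' (th F2 k). Proof. by case: k. Qed.

Let gn_bij : bijective gn.
Proof.
apply: bij_onto => [[n|n] [m|m] //= [] E|[n|n]].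
+ by rewrite (bij_inj (tn_bij F1) E).
+ by rewrite (bij_inj (tn_bij F2) E).
+ by have [m <-] := bij_surj (tn_bij F1) n; exists (inl m).
+ by have [m <-] := bij_surj (tn_bij F2) n; exists (inr m).
Qed.

Let gh_mate k : gh (mate k) = mate (gh k).
Proof.
have lX : th F1 (leaf t1 u) = leaf t1' u' by rewrite th_leaf -uE.
have lY : th F2 (leaf t2 v) = leaf t2' v' by rewrite th_leaf -vE.
case: (graft_half k) => -[l ->].
  rewrite mate_injl ghl mate_injl -lX (inj_eq (bij_inj (th_bij F1))).
  by case: eqP => _; rewrite ?ghr ?lY // ghl th_mate.
rewrite mate_injr ghr mate_injr -lY (inj_eq (bij_inj (th_bij F2))).
by case: eqP => _; rewrite ?ghl ?lX // ghr th_mate.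
Qed.

Definition tiso_graft : tiso (trename s G) (trename s' G').
Proof.
apply: (@Tiso Z (trename s G) (trename s' G') gn gh g1 g0 gn_bij
  (tot_sum_bij (th_bij F1) (th_bij F2)) (tot_sum_bij (te_bij F1) (te_bij F2))
  (tot_sum_bij (tv_bij F1) (tv_bij F2))).
- by case=> -[n|n] a; [exact: (congr1 inl (th_tag F1 (existT _ n a)))|
    exact: (congr1 inr (th_tag F2 (existT _ n a)))].
- by case=> -[n|n] a; [exact: (congr1 inl (te_tag F1 (existT _ n a)))|
    exact: (congr1 inr (te_tag F2 (existT _ n a)))].
- by case=> -[n|n] a; [exact: (congr1 inl (tv_tag F1 (existT _ n a)))|
    exact: (congr1 inr (tv_tag F2 (existT _ n a)))].
- move=> i [[n|n] a].
    exact: (congr1 (@inl1 X' Y' t1' u' t2' v') (te_D2 F1 i (existT _ n a))).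
  exact: (congr1 (@inr1 X' Y' t1' u' t2' v') (te_D2 F2 i (existT _ n a))).
- move=> i [[n|n] a].
    exact: (congr1 (@inl0 X' Y' t1' u' t2' v') (tv_D1 F1 i (existT _ n a))).
  exact: (congr1 (@inr0 X' Y' t1' u' t2' v') (tv_D1 F2 i (existT _ n a))).
- exact: gh_mate.
move=> z; change (gh (graft_leaf t1 t2 (s z)) = graft_leaf t1' t2' (s' z)).
have := sX z; have := sY z; case: (s z) => [a|b]; case: (s' z) => [a'|b'].
- move=> _ E; have {}E : sx (val a) = val a' := E.
  change (gh (injl t2 (leaf t1 (val a))) = injl t2' (leaf t1' (val a'))).
  by rewrite ghl th_leaf -E.
- by rewrite /= vE => E; have := valP b'; rewrite /= -E eqxx.
- by move=> /= E; have := valP b; rewrite /= -(inj_eq (bij_inj bsy)) vE /= E eqxx.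
- move=> E _; have {}E : sy (val b) = val b' := E.
  change (gh (injr t1 (leaf t2 (val b))) = injr t1' (leaf t2' (val b'))).
  by rewrite ghr th_leaf -E.
Defined.

End TisoGraft.

Lemma tri_to (X : finType) (t : tree X) (K L : dcomplex X) f0 f1
    (F : @is_lt2iso X K L f0 f1) (A : assembly t K) h :
  tri (assembly_to F A) h = f1 @: tri A h.
Proof. by rewrite /tri -imset_comp. Qed.

Lemma two_sides (Z : finType) (a b : Z -> bool) :
  (forall z z', (a z == a z') = (b z == b z')) -> a =1 b \/ a =1 (fun z => ~~ b z).
Proof.
move=> H; case: (pickP (fun z => a z != b z)) => [z0 ne|eq]; [right|left] => z.
  by move: (H z z0) ne; case: (a z); case: (b z); case: (a z0); case: (b z0).
by apply/eqP; have /negbFE := eq z.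
Qed.

Lemma corolla_tiso (X : finType) (G G' : dcomplex X) :
  lt2iso G G' -> inhabited (tiso (corolla G) (corolla G')).
Proof.
move=> GG; apply: tree_iso_tiso; exists id, (fun _ => id); split=> //.
- by exists id.
by move=> n; exists id.
Qed.

(* Cut both trees along a common triangle and recurse. *)
Lemma tiso_of_disjoint (X : finType) (t t' : tree X) (K : dcomplex X)
    (A : assembly t K) (A' : assembly t' K) : is_tree t -> is_tree t' ->
  (forall h h', mate h != h -> mate h' != h' ->
     disjoint_triangles (tri A h) (tri A' h')) ->
  inhabited (tiso t t').
Proof.
have [n] := ubnP #|node t|; elim: n X t t' K A A' => // n IH X t t' K A A' tn T T' D.
case: (pickP (fun h : half t => mate h != h)) => [h hi|fix_]; last first.
  have fx h : mate (t := t) h = h by have := fix_ h; move/negbFE/eqP.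
  have [G iG [[F] GK]] := cut_iso_irreducible A T fx.
  have [_ _ iK] := irreducible_iso (lt2iso_sym GK) iG.
  have fx' h : mate (t := t') h = h.
    by apply/eqP/negPn/negP => /(tri_cut A' T') /iK.
  have [G' _ [[F'] GK']] := cut_iso_irreducible A' T' fx'.
  have [E] := corolla_tiso (lt2iso_trans GK (lt2iso_sym GK')).
  have [F1] := tiso_sym F.
  by constructor; exact: tiso_trans F1 (tiso_trans E F').
have [X1 [X2 [u [v [t1 [t2 [s [S [[T1 T2 c1 c2 bs] [F] [sX sY] bE [hE sub1 sub2]]]]]]]]]] :=
  tree_cut A T hi.
have [M1 x1] := tree_proper T1; have [M2 x2] := tree_proper T2.
(* The triangle of [h] is disjoint from all those of [t'], hence it is one of them. *)
have [h1 h1i h1E] := cut_found T' (tri_cut A T hi) (fun h' => D h h' hi).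
have mi : mate (mate h1) != mate h1 by rewrite (can_eq (tree_mate T')).
have tauE (h' : half t') : mate h' != h' -> tri A' h' = tri A h ->
    forall z z', (beyond h (tag (leaf t z)) == beyond h (tag (leaf t z'))) =
      (beyond h' (tag (leaf t' z)) == beyond h' (tag (leaf t' z'))).
  move=> hi' E z z'.
  have [X1' [X2' [u' [v' [t1' [t2' [s' [S' [[T1' T2' _ _ _] _ _ bE' [hE' _ _]]]]]]]]]] :=
    tree_cut A' T' hi'.
  have [M1' x1'] := tree_proper T1'; have [M2' x2'] := tree_proper T2'.
  have := tau_gluedE S' M1' M2' x2' z z' x1'; rewrite -hE' E hE.
  rewrite (tau_gluedE S M1 M2 x2 z z' x1) -!bE -!bE'.
  by rewrite !(inj_eq negb_inj).
have [h' h'i [h'E side]] : exists2 h' : half t', mate h' != h' &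
    tri A' h' = tri A h /\ forall z, beyond h (tag (leaf t z)) = beyond h' (tag (leaf t' z)).
  (* Equal triangles have the same [tau], hence induce the same partition of the leaves; if the two
     sides are exchanged, the other half of the edge is taken. *)
  case: (two_sides (tauE h1 h1i (esym h1E))) => side; first by exists h1.
  exists (mate h1) => //; rewrite tri_mate; split=> // z.
  by rewrite side (beyond_other T' h1i).
have [X1' [X2' [u' [v' [t1' [t2' [s' [S' [[T1' T2' _ _ _] [F'] [sX' sY'] bE' [hE' sub1' sub2']]]]]]]]]] :=
  tree_cut A' T' h'i.
have [M1' x1'] := tree_proper T1'; have [M2' x2'] := tree_proper T2'.
have sideX z : (pX S z == u) = (pX S' z == u').
  by apply: negb_inj; rewrite bE bE' side.
have sideY z : (pY S z == v) = (pY S' z == v').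
  by apply: negb_inj; rewrite -!s_side.
have rX : j1 S @: rim (glued t1) u = j1 S' @: rim (glued t1') u' by rewrite -hE -hE'.
have rY : k1 S @: rim (glued t2) v = k1 S' @: rim (glued t2') v' by rewrite !swap_rim.
have [sx [f0 [f1 [bx sxE I1 J1]]]] := side_iso M1 M2 M1' M2' sideX rX.
have [sy [g0 [g1 [bsy syE I2 J2]]]] :=
  side_iso (S := swap S) (S' := swap S') M2 M1 M2' M1' sideY rY.
have [G1] : inhabited (tiso t1 (trename sx t1')).
  apply: (IH _ _ _ _ (assembly_to I1 (glued_assembly t1))
    (assembly_ren sx (glued_assembly t1')) (leq_trans c1 tn) T1 (trename_is_tree bx T1')).
  move=> k k' ki k'i; rewrite tri_to.
  have ct := tri_cut (glued_assembly t1') T1' k'i; have [l lT] := cut_free u' ct.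
  apply: (disjoint_ren bx ct); apply: (disjoint_jX (S := S') M2' x2' lT ct).
  have [m m_i <-] := sub1' k' k'i; have [p p_i pE] := sub1 k ki.
  rewrite -imset_comp (eq_imset _ J1) -pE; exact: D.
have [G2] : inhabited (tiso t2 (trename sy t2')).
  apply: (IH _ _ _ _ (assembly_to I2 (glued_assembly t2))
    (assembly_ren sy (glued_assembly t2')) (leq_trans c2 tn) T2 (trename_is_tree bsy T2')).
  move=> k k' ki k'i; rewrite tri_to.
  have ct := tri_cut (glued_assembly t2') T2' k'i; have [l lT] := cut_free v' ct.
  apply: (disjoint_ren bsy ct); apply: (disjoint_jX (S := swap S') M1' x1' lT ct).
  have [m m_i mE] := sub2' k' k'i; have [p p_i pE] := sub2 k ki.
  rewrite -imset_comp (eq_imset _ J2) /= -mE -pE; exact: D.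
have uE : sx u = u'.
  have [z zu] := pX_onto S M2 u.
  by rewrite -{1}zu sxE; apply/eqP; rewrite -sideX zu.
have vE : sy v = v'.
  have [z zv] := pX_onto (swap S) M1 v.
  by rewrite -{1}zv syE; apply/eqP; rewrite /= -sideY; apply/eqP.
have [F0] := tiso_sym F; constructor.
apply: tiso_trans F0 (tiso_trans _ F').
apply: (tiso_graft bsy uE vE _ _ G1 G2) => z.
  by rewrite sX sX' sxE.
by rewrite sY sY' syE.
Qed.

(** * Cutting along a triangle *)

Section Piece.
Variables (X : finType) (K : dcomplex X).
Hypothesis MK : m_complex K.
Variables (e : 'I_3 -> c1 K) (v : 'I_3 -> c0 K).
Hypothesis He : tri_verts e v.
Variable A : {set X}.
Let T : {set c1 K} := [set e i | i : 'I_3].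
Hypotheses (A0 : exists u, u \in A) (A1 : exists u, u \notin A)
  (tE : forall a b, tau T a b = ((a \in A) == (b \in A))).

Let HK := m_complex_closed MK.

Lemma piece_sub (a : c1 K) : bd A a -> a \in T.
Proof.
case/bdP=> b [c [bA cA ab ac]]; apply/negPn/negP => aT.
have : tau T b c by apply/shares_tau/sharesP; exists a.
by rewrite tE bA (negPf cA).
Qed.

(** The boundary of [A] is nonempty and contained in [T], so it is all of [T]: each edge of [T] has
    one cell in [A] and one outside, the latter to be replaced by the new cell. *)
Lemma piece_bd i : bd A (e i).
Proof.
have [o Ho] := orientation_of_H2 HK MK.
have [[u uA] [w wA]] := (A0, A1); have [a aA] := bd_ex HK uA wA.
exact: (bd_triangle HK Ho He (fun a => @piece_sub a) aA i).
Qed.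

Lemma piece_stay (a : c1 K) b c : a \notin T -> edge_of a b -> edge_of a c ->
  b \in A -> c \in A.
Proof.
by move=> aT ab ac bA; apply/negPn/negP => cA; move: aT; rewrite piece_sub //;
  apply/bdP; exists b, c.
Qed.

(* In [pcell], [None] is the new 2-cell, glued along T. *)
Local Notation pin uA := (Some (exist (fun u => u \in A) _ uA)).
Local Notation ein aS := (exist (fun a : c1 K => a \in side_edges K A) _ aS).

Definition pcell : finType := option {u : X | u \in A}.
Definition pedge : finType := {a : c1 K | a \in side_edges K A}.
Definition pvert : finType := {w : c0 K | [exists a in side_edges K A, end_of w a]}.

Lemma side_d2 i u : u \in A -> d2 K i u \in side_edges K A.
Proof. by move=> uA; apply/side_edgesP; exists u => //; exact: edge_of_d2. Qed.

Lemma side_e i : e i \in side_edges K A.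
Proof. by have /bdP[u [w [uA _ eu _]]] := piece_bd i; apply/side_edgesP; exists u. Qed.

Lemma side_d1 k a : a \in side_edges K A ->
  [exists b in side_edges K A, end_of (d1 k a) b].
Proof. by move=> h; apply/existsP; exists a; rewrite h end_of_d1. Qed.

Definition piece_d1 (k : 'I_2) (a : pedge) : pvert :=
  exist (fun w : c0 K => [exists a in side_edges K A, end_of w a])
    (d1 k (val a)) (side_d1 k (valP a)).

Definition piece_d2 (i : 'I_3) (u : pcell) : pedge :=
  match u with
  | Some u => ein (side_d2 i (valP u))
  | None => ein (side_e i)
  end.

Lemma piece_law (j k : 'I_2) (u : pcell) : j <= k ->
  piece_d1 j (piece_d2 (lift ord0 k) u) = piece_d1 k (piece_d2 (lift ord_max j) u).
Proof.
move=> jk; apply: val_inj; case: u => [u|] /=; first exact: face_law.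
by rewrite !He co_face_law.
Qed.

Definition piece : dcomplex pcell := DComplex piece_law.

Lemma val_vtx j u : val (vtx piece j (Some u)) = vtx K j (val u).
Proof.
have [i ij _] := third j j; have [k <-] := co_ex ij.
by rewrite -!d1_d2.
Qed.

Lemma val_vtxN j : val (vtx piece j None) = v j.
Proof.
have [i ij _] := third j j; have [k <-] := co_ex ij.
by rewrite -d1_d2 /= He.
Qed.

Lemma piece_edge (a : pedge) u : edge_of (K := piece) a (Some u) = edge_of (val a) (val u).
Proof.
apply/edge_ofP/edge_ofP => -[i]; first by move<-; exists i.
by move=> E; exists i; apply: val_inj.
Qed.

Lemma piece_edgeN (a : pedge) : edge_of (K := piece) a None = (val a \in T).
Proof.
apply/edge_ofP/imsetP => -[i]; first by move<-; exists i.
by move=> _ E; exists i; apply: val_inj.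
Qed.

Lemma piece_end (w : pvert) (a : pedge) : end_of (K := piece) w a = end_of (val w) (val a).
Proof.
apply/end_ofP/end_ofP => -[k]; first by move<-; exists k.
by move=> E; exists k; apply: val_inj.
Qed.

Lemma piece_two (a : c1 piece) : #|[set u | edge_of a u]| = 2.
Proof.
apply/eqP/cards2P; case: (boolP (val a \in T)) => aT.
  have [i _ iE] := imsetP aT; have := piece_bd i; rewrite -iE.
  case/bdP=> b [c [bA cA ab ac]].
  have bc : b != c by apply: contraNneq cA => <-.
  exists (pin bA), None; split=> //.
  apply/setP => -[[u uA]|]; rewrite !inE ?piece_edgeN ?aT // piece_edge /= orbF.
  apply/idP/eqP => [au|[E]]; last by rewrite E.
  congr Some; apply: val_inj => /=.
  by case: (cells_of HK bc ab ac au) => // E; rewrite E (negPf cA) in uA.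
have [b bA ab] := side_edgesP _ _ (valP a).
have [c [cb ac acP]] := other_cell HK ab.
have cA : c \in A := piece_stay aT ab ac bA.
exists (pin bA), (pin cA).
split; first by apply: contraNneq cb => -[->].
apply/setP => -[[u uA]|]; rewrite !inE ?piece_edgeN ?(negPf aT) // piece_edge /=.
apply/idP/orP => [au|]; last by case=> /eqP[->].
by case: (acP _ au) => E; [left|right]; apply/eqP; congr Some; exact: val_inj.
Qed.

Lemma piece_adj (w w' : pvert) u : u \in A ->
  vertex_of (val w) u -> vertex_of (val w') u ->
  connect (@adjacent _ piece) w w'.
Proof.
move=> uA /vertex_ofP[j jE] /vertex_ofP[l lE].
case: (eqVneq j l) => [E|jl].
  by have -> : w = w' by apply: val_inj; rewrite -jE -lE E.
apply/connect1/existsP; have [i ij il] := third j l.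
exists (piece_d2 i (pin uA)).
have eq k (x : pvert) : (d1 (d := piece) k (piece_d2 i (pin uA)) == x) =
    (vtx K (co i k) u == val x) by rewrite -val_eqE /= d1_d2.
rewrite !eq -jE -lE !(inj_eq (@vtx_injK _ _ HK u)) !coE.
by move: jl ij il; case: (I3P i) => ->; case: (I3P j) => ->; case: (I3P l) => ->.
Qed.

Lemma piece_vertex (w : pvert) : exists2 u, u \in A & vertex_of (val w) u.
Proof.
have /existsP[a /andP[/side_edgesP[u uA au] wa]] := valP w.
by exists u => //; exact: vertex_of_end au wa.
Qed.

(** The walk of 2-cells given by [tau] crosses only edges outside [T], so it stays in [A]; the
    vertices follow it. *)
Lemma piece_connected (w w' : pvert) : connect (@adjacent _ piece) w w'.
Proof.
have [[u uA wu] [u' u'A w'u']] := (piece_vertex w, piece_vertex w').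
have : tau T u u' by rewrite tE uA u'A.
case/tauP=> x h1 h2; have := connect_trans (connect1 h1) h2.
case/connectP=> p; elim: p u w uA wu {x h1 h2} => [|x p IH] u w uA wu /=.
  by move=> _ E; subst u'; exact: piece_adj uA wu w'u'.
case/andP=> /sharesP[a [aT au ax]] pp lp.
have xA := piece_stay aT au ax uA.
have aS : a \in side_edges K A by apply/side_edgesP; exists u.
pose y := piece_d1 ord0 (ein aS).
have ya : end_of (val y) a by exact: end_of_d1.
apply: connect_trans (piece_adj (w' := y) uA wu (vertex_of_end au ya)) _.
exact: IH xA (vertex_of_end ax ya) pp lp.
Qed.

Lemma piece_nb (w : pvert) b c (bA : b \in A) (cA : c \in A) : neighbours (val w) b c ->
  neighbours (K := piece) w (pin bA)
    (pin cA).
Proof.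
case/existsP=> a /and3P[ab ac wa]; apply/existsP.
have aS : a \in side_edges K A by apply/side_edgesP; exists b.
exists (ein aS).
by rewrite !piece_edge piece_end /= ab ac.
Qed.

(** The walk around [w] is followed until it first leaves [A]. It leaves across an edge of [T],
    where the new 2-cell takes over. *)
Lemma piece_walk (w : pvert) b c (bA : b \in A) :
  connect (neighbours (val w)) b c ->
  (exists cA : c \in A, connect (neighbours (K := piece) w)
     (pin bA) (pin cA)) \/
  connect (neighbours (K := piece) w) (pin bA) None /\
  vertex_of (K := piece) w None.
Proof.
case/connectP=> p; elim: p b bA => [|d p IH] b bA /=.
  by move=> _ E; subst c; left; exists bA; exact: connect0.
case/andP=> bd pp lp; case: (boolP (d \in A)) => dA.
  have nb := connect1 (piece_nb bA dA bd).
  case: (IH d dA pp lp) => [[cA h]|[h wN]]; [left; exists cA|right; split=> //];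
    exact: connect_trans nb h.
right; case/existsP: bd => a /and3P[ab ad wa].
have aS : a \in side_edges K A by apply/side_edgesP; exists b.
pose a' : c1 piece := ein aS.
have aN : edge_of (K := piece) a' None.
  by rewrite piece_edgeN; apply: piece_sub; apply/bdP; exists b, d.
have wa' : end_of (K := piece) w a' by rewrite piece_end.
split; last exact: vertex_of_end aN wa'.
by apply/connect1/existsP; exists a'; rewrite aN wa' piece_edge ab.
Qed.

Lemma piece_linkN (w : pvert) b (bA : b \in A) :
  vertex_of (val w) b -> vertex_of (K := piece) w None ->
  connect (neighbours (K := piece) w) (pin bA) None.
Proof.
move=> wb /vertex_ofP[j jE]; have wE : val w = v j by rewrite -jE val_vtxN.
have [i ij _] := third j j.
(* At a vertex of [T] there is a 2-cell outside [A]; a walk towards it must leave [A], and so meets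
   the new cell. *)
have /bdP[c [d [cA dA ec ed]]] := piece_bd i.
have wd : vertex_of (val w) d.
  by apply: vertex_of_end ed _; rewrite wE (tri_end (cc_faces1 HK) _ _ He).
case: (piece_walk bA (cc_link HK wb wd)) => [[dA' _]|[]] //.
by rewrite dA' in dA.
Qed.

Lemma piece_closed : closed_complex piece.
Proof.
split.
- by exists None.
- exact: piece_connected.
- move=> w; have /existsP[a /andP[aS wa]] := valP w.
  exists (ein aS).
  by rewrite piece_end.
- move=> a; have /side_edgesP[u uA au] := valP a.
  by exists (pin uA); rewrite piece_edge.
- move=> i j [u|] ij; rewrite -val_eqE /=; first exact: cc_faces2.
  by apply: contra_neq ij => /(tri_einj (cc_faces1 HK) He).
- by move=> i j a ij; rewrite -val_eqE /=; exact: cc_faces1.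
- exact: piece_two.
have vS (w : pvert) b (bA : b \in A) : vertex_of (K := piece) w (pin bA) ->
    vertex_of (val w) b.
  by case/vertex_ofP=> j <-; rewrite val_vtx; exact: vertex_of_vtx.
move=> w [[b bA]|] [[c cA]|] wb wc.
- have wb' := vS _ _ _ wb; have wc' := vS _ _ _ wc.
  case: (piece_walk bA (cc_link HK wb' wc')) => [[cA' h]|[h wN]].
    by rewrite (bool_irrelevance cA cA').
  by apply: connect_trans h _; rewrite neighbours_sym; exact: piece_linkN.
- exact: piece_linkN (vS _ _ _ wb) wc.
- by rewrite neighbours_sym; exact: piece_linkN (vS _ _ _ wc) wb.
- exact: connect0.
Qed.

Lemma piece_m : m_complex piece.
Proof.
have [o Ho] := orientation_of_H2 HK MK; have [o1 oE] := Ho.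
have bt := chain_triangle HK Ho He (fun a => @piece_sub a).
have [_ bo] := chain_bd HK A Ho.
pose b := boundary (d2 K) [ffun u => if u \in A then o u else 0%R].
(* The new cell takes the sign opposite to the boundary coefficient at edge 0; by [chain_triangle]
   it then cancels along the other two edges as well. *)
pose q (u : pcell) : int := if u is Some u then o (val u) else (- b (e i0))%R.
have qN : (b (e i0) * b (e i0) = 1)%R.
  have /bdP[u [w [uA wA eu ew]]] := piece_bd i0; have [k kE] := edge_ofP _ _ eu.
  rewrite /b (bo _ k u (piece_bd i0) uA kE) mulrACA -expr2 sqrr_sign mul1r.
  exact: o1.
have oN (i j : 'I_3) (u : {u : X | u \in A}) : d2 K i (val u) = e j ->
    ((-1) ^+ i * o (val u) + (-1) ^+ j * - b (e i0) = 0)%R.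
  move=> E; rewrite -(bo _ i _ (piece_bd j) (valP u) E) mulrN.
  by rewrite -/b (bt j) subrr.
apply: (H2_of_orientation piece_closed (o := q)); split.
  by case=> [u|] /=; rewrite ?o1 ?mulrNN.
move=> i j [u|] [w|] uw /(congr1 val) /= E.
- by apply: oE E; apply: contra_neq uw => h; congr Some; exact: val_inj.
- exact: oN.
- by rewrite addrC; apply: oN.
- by rewrite eqxx in uw.
Qed.

(** A cell of [A] has an edge outside [T], and the cell across it is again in [A]. With the new cell
    the piece has three 2-cells at least, hence is proper; applied to the other side, the bound
    shows that it is smaller than [K]. *)
Lemma piece_card : 1 < #|A|.
Proof.
have [u uA] := A0; have : tau T u u by rewrite tE eqxx.
case/tauP=> x /sharesP[a [aT au _]] _.
have [w [wu aw _]] := other_cell HK au.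
have wA := piece_stay aT au aw uA.
apply: (@leq_trans #|[set u; w]|); first by rewrite cards2 eq_sym wu.
by apply/subset_leq_card/subsetP => z; rewrite !inE => /orP[] /eqP->.
Qed.

Lemma pcell_card : #|pcell| = #|A|.+1.
Proof. by rewrite card_option card_sig. Qed.

End Piece.

Lemma in_sub (I : Type) (P : pred I) (a : I) :
  P a -> exists b : {a : I | P a}, val b = a.
Proof. by move=> Pa; exists (exist _ a Pa). Qed.

(** * The complex as the sum of its two pieces *)

Section CutSum.
Variables (X : finType) (K : dcomplex X).
Hypothesis MK : m_complex K.
Variables (e : 'I_3 -> c1 K) (v : 'I_3 -> c0 K).
Hypothesis He : tri_verts e v.
Variables (A B : {set X}).
Hypothesis AB : B = ~: A.
Let T : {set c1 K} := [set e i | i : 'I_3].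
Hypotheses (A0 : exists u, u \in A) (A1 : exists u, u \notin A)
  (B0 : exists u, u \in B) (B1 : exists u, u \notin B)
  (tA : forall a b, tau T a b = ((a \in A) == (b \in A)))
  (tB : forall a b, tau T a b = ((a \in B) == (b \in B))).

Let HK := m_complex_closed MK.

Lemma cut_sides_edge (a : c1 K) : a \in side_edges K A -> a \in side_edges K B -> a \in T.
Proof.
move=> /side_edgesP[u uA au] /side_edgesP[w wB aw].
apply: (piece_sub tA); apply/bdP; exists u, w; split=> //.
by rewrite AB inE in wB.
Qed.

(** The link of [w] joins [b] to [c], and it passes from [A] to [B] across an edge of [T] ending at
    [w]. *)
Lemma cut_sides_vertex (w : c0 K) (b c : X) : b \in A -> c \in B ->
  vertex_of w b -> vertex_of w c -> exists j, w = v j.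
Proof.
move=> bA cB wb wc; have cA : c \notin A by rewrite AB inE in cB.
have [x [y [xA yA /existsP[a /and3P[ax ay wa]]]]] := connect_exit (cc_link HK wb wc) bA cA.
have /imsetP[i _ iE] : a \in T by apply: (piece_sub tA); apply/bdP; exists x, y.
by move: wa; rewrite iE => /end_ofP[k <-]; exists (co i k); rewrite He.
Qed.

(** [insub] sends the 2-cells of the other side to [None], the new cell of the piece, which is what
    the two projections of [summing] must do. *)
Definition cut_summing :
  summing (piece MK He A0 A1 tA) None (piece MK He B0 B1 tB) None K.
Proof.
apply: (@Summing _ _ _ (piece MK He A0 A1 tA) None (piece MK He B0 B1 tB) None K
  (fun z => insub z) (fun z => insub z) val val val val).
- move=> z; case: insubP => [u zA _|zA]; case: insubP => [w zB _|zB] //.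
    by exfalso; have := zB; rewrite {1}AB inE zA.
  by exfalso; have := zB; rewrite {1}AB inE zA.
- move=> z z'; case: insubP => [u zA uE|zA] //; case: insubP => [w zB wE|zB] // [].
  by rewrite -uE -wE => ->.
- move=> z z'; case: insubP => [u zA uE|zA] //; case: insubP => [w zB wE|zB] // [].
  by rewrite -uE -wE => ->.
- by case=> [u|] // _; exists (val u); exact: valK.
- by case=> [u|] // _; exists (val u); exact: valK.
- by move=> i z; case: insubP => [u zA uE|zA] // _; rewrite /= uE.
- by move=> i z; case: insubP => [u zA uE|zA] // _; rewrite /= uE.
- exact: val_inj.
- exact: val_inj.
- exact: val_inj.
- exact: val_inj.
- by [].
- by [].
- move=> a; have [u au] := cc_edge HK a; case: (boolP (u \in A)) => uA.
    by left; apply: in_sub; apply/side_edgesP; exists u.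
  by right; apply: in_sub; apply/side_edgesP; exists u => //; rewrite AB inE.
- move=> w; have [a wa] := cc_end HK w.
  have [u au] := cc_edge HK a; case: (boolP (u \in A)) => uA.
    left; apply: in_sub; apply/existsP; exists a; rewrite wa andbT.
    by apply/side_edgesP; exists u.
  right; apply: in_sub; apply/existsP; exists a; rewrite wa andbT.
  by apply/side_edgesP; exists u => //; rewrite AB inE.
- move=> a b; split=> [E|[i <- <-]] //.
  have /imsetP[i _ iE] := cut_sides_edge (valP a) (etrans (congr1 (fun a => a \in side_edges K B) E) (valP b)).
  by exists i; apply: val_inj; rewrite /= -?E iE.
move=> a b; split=> [E|[j <- <-]]; last by rewrite !val_vtxN.
have [u uA au] := piece_vertex a; have [w wB bw] := piece_vertex b.
rewrite -E in bw; have [j jE] := cut_sides_vertex uA wB au bw.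
by exists j; apply: val_inj; rewrite val_vtxN -?E jE.
Defined.

End CutSum.

Lemma tree_exists (X : finType) (K : dcomplex X) : m_complex K -> ~ unit_complex K ->
  exists2 t : tree X, is_tree t & lt2iso (glued t) K.
Proof.
have [n] := ubnP #|X|; elim: n X K => // n IH X K Xn MK pK.
have HK := m_complex_closed MK.
case: (classic (exists T : {set c1 K}, cut_triangle T)) => [[T cT]|nT]; last first.
  have iK : irreducible K by split=> // T cT; apply: nT; exists T.
  exists (corolla K); first exact: corolla_is_tree.
  exact: lt2iso_assembly (assembly_corolla K).
have [/(triangleP (cc_faces1 HK))[e [v [TE He]]] [A [A0 A1 tA]]] := (cutP T).1 cT.
subst T; pose B := ~: A.
have B0 : exists u, u \in B by case: A1 => u uA; exists u; rewrite inE.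
have B1 : exists u, u \notin B by case: A0 => u uA; exists u; rewrite inE uA.
have tB a b : tau [set e i | i : 'I_3] a b = ((a \in B) == (b \in B)).
  by rewrite tA !inE; case: (a \in A); case: (b \in A).
pose S := cut_summing MK He erefl A0 A1 B0 B1 tA tB.
have MA := piece_m MK He A0 A1 tA; have MB := piece_m MK He B0 B1 tB.
have cA := piece_card MK A0 tA; have cB := piece_card MK B0 tB.
have cAB : #|A| + #|B| = #|X| by exact: cardsC.
have pA : 2 < #|pcell A| by rewrite pcell_card.
have pB : 2 < #|pcell B| by rewrite pcell_card.
have nA : #|pcell A| < n by rewrite pcell_card; lia.
have nB : #|pcell B| < n by rewrite pcell_card; lia.
have [t1 T1 [f0 [f1 I1]]] := IH _ _ nA MA ((not_unit_card MA).2 pA).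
have [t2 T2 [g0 [g1 I2]]] := IH _ _ nB MB ((not_unit_card MB).2 pB).
(* [summing_from] replaces the first summand, so the second is reached between two exchanges. *)
pose S' := swap (summing_from I2 (swap (summing_from I1 S))).
have [s bs [sX sY]] := summing_arity S'.
exists (trename s (graft t1 None t2 None)).
  exact: trename_is_tree bs (graft_is_tree _ _ T1 T2).
exact: lt2iso_assembly (assembly_graft (leaf_mate T1) (leaf_mate T2)
  (glued_assembly t1) (glued_assembly t2) sX sY).
Qed.

(** * The isomorphism *)

Lemma sum_pX_bij (X Y : finType) (x : X) (y : Y) : #|Y| = 2 ->
  bijective (@sum_pX X Y x y).
Proof.
move=> Y2; apply: bij_onto => [[[a ha]|[b hb]] [[a' ha']|[b' hb']] /= E|a].
- by congr inl; exact: val_inj.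
- by exfalso; move: ha; rewrite E eqxx.
- by exfalso; move: ha'; rewrite E eqxx.
- by congr inr; apply: val_inj; exact: card2_other Y2 hb hb'.
case: (eqVneq a x) => [->|ax]; last by exists (inl (exist (fun a => a != x) a ax)).
have : 0 < #|[set~ y]| by rewrite cardsC1 Y2.
case/card_gt0P=> b; rewrite !inE => hb.
by exists (inr (exist (fun b => b != y) b hb)).
Qed.

Lemma sum_pY_bij (X Y : finType) (x : X) (y : Y) : #|X| = 2 ->
  bijective (@sum_pY X Y x y).
Proof.
move=> X2; pose c (X Y : finType) (x : X) (y : Y) (z : comp_arity x y) : comp_arity y x :=
  match z with inl a => inr a | inr b => inl b end.
have cK X' Y' x' y' : cancel (@c X' Y' x' y') (@c Y' X' y' x') by case.
apply: (eq_bij (f := @sum_pX Y X y x \o @c X Y x y)); last by case.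
by apply: bij_comp; [exact: sum_pX_bij|exists (@c Y X y x)].
Qed.

Definition realize (X : finType) (f : free_op X) : dcomplex X :=
  match f with FTree t => glued t | FUnit => unit_on X end.

Lemma realize_m (X : finType) (f : free_op X) : free_isop f -> m_complex (realize f).
Proof.
case: f => [t|] /=; first by case/tree_proper.
by case/unit_on_unit.
Qed.

Lemma realize_evaluates (X : finType) (f : free_op X) (K : dcomplex X) :
  free_isop f -> (free_evaluates f K <-> lt2iso (realize f) K).
Proof.
case: f => [t|] /= T; split.
- by case/evaluates_glued.
- by move/lt2iso_sym/evaluates_iso; apply; exact: glued_evaluates.
- exact: unit_iso.
- by move/unit_complex_iso; apply; exact: unit_on_unit.
Qed.

(** Two trees fall under [assembly_graft]; as soon as a unit occurs, the composite is a renaming,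
    which [summing_unit] presents as the required sum. *)
Lemma realize_comp (X Y : finType) (f : free_op X) (x : X) (g : free_op Y) (y : Y) :
  free_isop f -> free_isop g ->
  lt2iso (realize (free_comp f x g y)) (csum (realize f) (realize g) x y).
Proof.
move=> Pf Pg; have Hf := m_complex_closed (realize_m Pf).
have Hg := m_complex_closed (realize_m Pg).
have side z : (@sum_pY X Y x y z == y) = (sum_pX z != x) by rewrite sum_side negbK.
have uniq M (S : summing (realize f) x (realize g) y M) :
    pX S =1 @sum_pX X Y x y -> pY S =1 @sum_pY X Y x y ->
    lt2iso M (csum (realize f) (realize g) x y).
  move=> EX EY.
  have [f0 [f1 [I _ _]]] := summing_iso (S := S) (S' := csum_summing x y Hf Hg) EX EY.
  by exists f0, f1.
case: f g Pf Pg Hf Hg uniq => [t1|] [t2|] /= Pf Pg Hf Hg uniq.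
- exact: lt2iso_assembly (assembly_graft (s := id) (leaf_mate Pf) (leaf_mate Pg)
    (glued_assembly t1) (glued_assembly t2) (S := csum_summing x y Hf Hg)
    (fun _ => erefl) (fun _ => erefl)).
- apply: (lt2iso_trans (L := crename (@sum_pX X Y x y) (glued t1))).
    exact: lt2iso_assembly (assembly_ren _ (glued_assembly t1)).
  exact: (uniq _ (summing_unit Hf (sum_pX_bij x y Pg) Pg (@sum_side X Y x y))).
- apply: (lt2iso_trans (L := crename (@sum_pY X Y x y) (glued t2))).
    exact: lt2iso_assembly (assembly_ren _ (glued_assembly t2)).
  exact: (uniq _ (swap (summing_unit Hg (sum_pY_bij x y Pf) Pf side))).
(* The faces of [unit_on] ignore the 2-cell, so its renaming is again [unit_on] by computation. *)
exact: (uniq _ (summing_unit Hf (sum_pX_bij x y Pg) Pg (@sum_side X Y x y))).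
Qed.

Lemma menelaus_eq_realize (X : finType) (f g : free_op X) :
  menelaus_eq f g -> lt2iso (realize f) (realize g).
Proof.
case=> X1 [Y1 [u [v [t1 [t2 [s [X2 [Y2 [u' [v' [t1' [t2' [s' H]]]]]]]]]]]]].
case: H => K1 [K2 [K1' [K2' [K [p0 [p1 [q0 [q1 H]]]]]]]].
case: H => _ [bs bs' -> ->] [e1 e2 e1' e2'] [_ I I'] _ /=.
have ev (Z1 Z2 : finType) (w : Z1) (w' : Z2) (r1 : tree Z1) (r2 : tree Z2)
    (r : X -> comp_arity w w') (L1 : dcomplex Z1) (L2 : dcomplex Z2) :
    bijective r -> evaluates r1 L1 -> evaluates r2 L2 ->
    lt2iso (crename r (csum L1 L2 w w')) K ->
    lt2iso (glued (trename r (graft r1 w r2 w'))) K.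
  move=> br E1 E2 J; have [] // := @evaluates_glued _ (trename r (graft r1 w r2 w')) K _.
  exact: EvGraft br E1 E2 (tiso_tree_iso (tiso_refl _)) (lt2iso_sym J).
apply: lt2iso_trans (ev _ _ _ _ _ _ _ _ _ bs e1 e2 _) (lt2iso_sym (ev _ _ _ _ _ _ _ _ _ bs' e1' e2' _)).
  by exists p0, p1.
by exists q0, q1.
Qed.

Lemma quotient_realize (X : finType) (f g : free_op X) :
  clos_refl_sym_trans _ (fun f g => free_same f g \/ menelaus_eq f g) f g ->
  lt2iso (realize f) (realize g).
Proof.
elim=> {f g} [f g [|]|f|f g _|f g h _ fg _ gh].
- case: f g => [t|] [t'|] //= h; first exact: glued_iso.
  exact: lt2iso_refl.
- exact: menelaus_eq_realize.
- exact: lt2iso_refl.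
- exact: lt2iso_sym.
- exact: lt2iso_trans fg gh.
Qed.

(** A generating equality relates literal grafts, whence the intermediate trees [r] and [r'],
    obtained by cutting at [h] and [h']; transported to [K], their glued triangles are those of [h]
    and [h']. *)
Lemma imbricated_menelaus_eq (X : finType) (t t' : tree X) (K : dcomplex X)
    (A : assembly t K) (A' : assembly t' K) h h' :
  is_tree t -> is_tree t' -> mate h != h -> mate h' != h' ->
  ~ disjoint_triangles (tri A h) (tri A' h') ->
  exists r r', [/\ tree_iso t r, tree_iso r' t' & menelaus_eq (FTree r) (FTree r')].
Proof.
move=> T T' hi h'i nD.
have [X1 [X2 [u [v [t1 [t2 [s [S [[T1 T2 _ _ bs] [F] [sX sY] _ [hE _ _]]]]]]]]]] :=
  tree_cut A T hi.
have [X1' [X2' [u' [v' [t1' [t2' [s' [S' [[T1' T2' _ _ bs'] [F'] [sX' sY'] _ [hE' _ _]]]]]]]]]] :=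
  tree_cut A' T' h'i.
have [[M1 _] [M2 _]] := (tree_proper T1, tree_proper T2).
have [[M1' _] [M2' _]] := (tree_proper T1', tree_proper T2').
have [p0 [p1 [I pE]]] :=
  summing_csum (m_complex_closed M1) (m_complex_closed M2) bs sX sY.
have [q0 [q1 [I' qE]]] :=
  summing_csum (m_complex_closed M1') (m_complex_closed M2') bs' sX' sY'.
have [F0] := tiso_sym F.
exists (trename s (graft t1 u t2 v)), (trename s' (graft t1' u' t2' v')).
split; [exact: tiso_tree_iso|exact: tiso_tree_iso|].
exists X1, X2, u, v, t1, t2, s, X1', X2', u', v', t1', t2', s'.
exists (glued t1), (glued t2), (glued t1'), (glued t2'), K, p0, p1, q0, q1.
split=> //; first by split; exact: glued_evaluates.
  by split=> //; exact: (tree_m A).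
have -> : p1 @: glued_triangle (glued t1) (glued t2) u v = tri A h.
  by rewrite hE -!imset_comp; apply: eq_imset => i; exact: pE.
have -> : q1 @: glued_triangle (glued t1') (glued t2') u' v' = tri A' h'.
  by rewrite hE' -!imset_comp; apply: eq_imset => i; exact: qE.
by split=> //; exact: tri_cut.
Qed.

Lemma realize_quotient (X : finType) (f g : free_op X) :
  free_isop f -> free_isop g -> lt2iso (realize f) (realize g) ->
  clos_refl_sym_trans _ (fun f g => free_same f g \/ menelaus_eq f g) f g.
Proof.
case: f g => [t|] [t'|] //=; last by move=> _ _ _; exact: rst_refl.
- move=> T T' [f0 [f1 I]].
  pose A := assembly_to I (glued_assembly t); pose A' := glued_assembly t'.
  case: (classic (exists h h', [/\ mate h != h, mate h' != h'
      & ~ disjoint_triangles (tri A h) (tri A' h')])) => [[h [h' [hi h'i nD]]]|nI].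
    have [r [r' [tr rt E]]] := imbricated_menelaus_eq T T' hi h'i nD.
    apply: rst_trans (rst_step _ _ _ (FTree r) _) (rst_trans _ _ _ (FTree r') _ _ _).
    + by left.
    + by apply: rst_step; right.
    by apply: rst_step; left.
  have [|F] := @tiso_of_disjoint _ _ _ _ A A' T T'.
    by move=> h h' hi h'i; apply: NNPP => nD; apply: nI; exists h, h'.
  by apply: rst_step; left; exact: tiso_tree_iso.
(* A tree and a unit never have the same arity: a tree has more than two leaves. *)
- by case/tree_proper=> _ X3 X2; rewrite X2 in X3.
by move=> X2 /tree_proper[_ X3]; rewrite X2 in X3.
Qed.

Theorem theorem10p11 :
  exists phi : forall X : finType, rep free_operad X -> rep menelaus X,
    (forall (X : finType) (f : free_op X) (K : dcomplex X), free_isop f ->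
       (free_evaluates f K <-> lt2iso (phi X f) K)) /\
    @operad_isomorphism (quotient (C := free_operad) menelaus_eq) menelaus phi.
Proof.
exists realize; split; first by move=> X f K; exact: realize_evaluates.
split.
- exact: realize_m.
- move=> X f g Pf Pg; split; first exact: quotient_realize.
  exact: realize_quotient.
- move=> X K MK; case: (classic (unit_complex K)) => [U|nU].
    by exists (@FUnit X); [case: U|exact: unit_iso].
  by have [t T I] := tree_exists MK nU; exists (FTree t).
split.
- move=> X Z s [t|] bs _ /=; last exact: lt2iso_refl.
  exact: lt2iso_assembly (assembly_ren s (glued_assembly t)).
- by move=> X Y f x g y; exact: realize_comp.
by move=> X f + fE; rewrite [f]fE; exact: unit_on_unit.
Qed.
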